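(* Let $n\in\mathbb{N}$, let $s$ be a weakly singular kernel on $\mathbb{R}^n\setminus\{0\}$ satisfying the dilation property with constant $\delta\in(0,n)$ and the symmetry property with integer $0\le\kappa\le n$, and let $p\in\mathbb{N}_0$ satisfy $2p\ge\kappa$. Let $\phi\in C_c^{N}(\mathbb{R}^n)$ with $N>\max(2p-\kappa+2+\delta,\,n)$, or $\phi\in\mathcal{S}(\mathbb{R}^n)$. Let $g\in\mathcal{S}(\mathbb{R}^n)$ be radially symmetric with $g(0)=1$ and $\partial^k g(0)=0$ for all multi-indices $k$ with $|k|_1=1,\dots,2p-\kappa+1$. For $h>0$ sufficiently small let $\omega(h)$ be the solution of the linear system $\boldsymbol{K}\boldsymbol{G}(h)\omega(h)=c(h)$ associated with this $g$. Then $\omega(h)$ converges, as $h\to0$, to some $\bar\omega\in\mathbb{R}^{I_{n,p}}$, and $$|\omega(h)-\bar\omega|_2=O(h^{2p-\kappa+2})\quad (h\to 0).$$ Moreover, with $Q_h^p$ the modified trapezoidal rule built from the weights $\bar\omega$, there exists $C>0$ such that for all $0<h\le 1$ $$\left|Q_h^p[\phi\cdot s]-\int_{\mathbb{R}^n\setminus\{0\}}\phi(x)s(x)\,dx\right|\le C\,h^{2p-\kappa+2+\delta}.$$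
   Context: Conventions: $\mathbb{N}=\{1,2,\dots\}$, $\mathbb{N}_0=\{0,1,2,\dots\}$; $|x|$ is the Euclidean norm, $|x|_1=\sum_i|x_i|$; $x^\gamma=\prod_j x_j^{\gamma_j}$ for multi-indices, with $0^0=1$; $e_j$ is the $j$-th standard basis vector; empty products equal $1$. $C_c^N(\mathbb{R}^n)$ is the space of compactly supported $N$-times continuously differentiable functions and $\mathcal{S}(\mathbb{R}^n)$ the Schwartz space. Weakly singular kernel: $s$ is a real function, smooth on $\mathbb{R}^n\setminus\{0\}$, such that $\lim_{h\to0}\int_{h<|x|\le1}s(x)\,dx$ exists in $\mathbb{R}$. Dilation property: there are $\delta\in(0,n)$ and a non-zero smooth $\rho:\mathbb{R}^n\to\mathbb{R}$ with $s(x)=|x|^{\delta-n}\rho(x/|x|)$ for all $x\ne0$. Symmetry property: there is an integer $0\le\kappa\le n$ such that for all $x\neq 0$: $s(x_1,\dots,x_j,\dots,x_n)=-s(x_1,\dots,-x_j,\dots,x_n)$ for $1\le j\le\kappa$, and $s(x_1,\dots,x_j,\dots,x_n)=s(x_1,\dots,-x_j,\dots,x_n)$ for $\kappa<j\le n$. Punctured trapezoidal rule: $T_h^0[f]=h^n\sum_{\beta\in\mathbb{Z}^n\setminus\{0\}}f(\beta h)$. Grids: $\mathcal{M}_{n,p}=\{\beta\in\mathbb{Z}^n:|\beta|_1\le p,\ \prod_{1\le j\le\kappa}\beta_j\ne0\}$; $\mathcal{I}(n,p)=\{\beta\in\mathcal{M}_{n,p}:\beta_j\ge0\ \forall j\}$;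 $I_{n,p}=|\mathcal{I}(n,p)|$; for $\eta\in\mathcal{I}(n,p)$, $\mathcal{G}_\eta$ is the set $\{((-1)^{k_1}\eta_1,\dots,(-1)^{k_n}\eta_n):k_j\in\{0,1\}\}$. Fix an enumeration $\xi_1,\dots,\xi_{I_{n,p}}$ of $\mathcal{I}(n,p)$ and put $\mathcal{G}_j=\mathcal{G}_{\xi_j}$. Linear system: for $1\le i,j\le I_{n,p}$, $$K_{i,j}=\sum_{\beta\in\mathcal{G}_j}\mathrm{sgn}\Big(\prod_{l=1}^{\kappa}\beta_l\Big)\beta^{2\xi_i-\sum_{l=1}^{\kappa}e_l},\qquad \boldsymbol{G}(h)=\mathrm{diag}\big(g(\xi_1h),\dots,g(\xi_{I_{n,p}}h)\big),$$ $$c_i(h)=\frac{1}{h^{2|\xi_i|_1-\kappa+\delta}}\left(\int_{\mathbb{R}^n} g(x)s(x)x^{2\xi_i-\sum_{l=1}^{\kappa}e_l}\,dx-T_h^0\big[g\cdot s\cdot x^{2\xi_i-\sum_{l=1}^{\kappa}e_l}\big]\right),$$ $c(h)=(c_1(h),\dots,c_{I_{n,p}}(h))^T$. Modified trapezoidal rule: with $\bar\omega_\eta$, $\eta\in\mathcal{I}(n,p)$, the components of $\bar\omega=\lim_{h\to0}\omega(h)$ (the component $\bar\omega_j$ corresponding to $\eta=\xi_j$), $$Q_h^p[\phi\cdot s]=T_h^0[\phi\cdot s]+h^\delta\sum_{\eta\in\mathcal{I}(n,p)}\bar\omega_\eta\sum_{\beta\in\mathcal{G}_\eta}\mathrm{sgn}\Big(\prod_{l=1}^{\kappa}\beta_l\Big)\phi(\beta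 h).$$ If $\mathcal{I}(n,p)=\varnothing$ the linear system is empty and $Q_h^p=T_h^0$. *)

(* Defs.v *)
From HB Require Import structures.
From mathcomp Require Import all_boot all_order all_algebra.
From mathcomp Require Import all_classical all_reals all_analysis.

Set Implicit Arguments.
Unset Strict Implicit.
Unset Printing Implicit Defensive.

Import Order.TTheory GRing.Theory Num.Theory.
Import numFieldNormedType.Exports.

Local Open Scope classical_set_scope.
Local Open Scope ring_scope.

(* Lebesgue measure on R^n: the library only provides n = 1. 'rV[R]_n gets the
   product sigma-algebra generated by the coordinates (as the library does for
   tuples) and the measure is an iterated product, characterised by
   lebesgue_Rn_box below. *)

Definition measure_row_display : measure_display -> measure_display.
Proof. exact. Qed.

Section measurable_row.
Variables (R : realType) (n : nat).

Definition row_coord : 'I_n -> 'rV[R]_n -> measurableTypeR R :=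
  fun i x => x 0 i.

Let row_set0 : g_sigma_preimage row_coord set0.
Proof. exact: sigma_algebra0. Qed.

Let row_setC A : g_sigma_preimage row_coord A ->
  g_sigma_preimage row_coord (~` A).
Proof. exact: sigma_algebraC. Qed.

Let row_bigcup (F : (set 'rV[R]_n)^nat) :
  (forall i, g_sigma_preimage row_coord (F i)) ->
  g_sigma_preimage row_coord (\bigcup_i (F i)).
Proof. exact: sigma_algebra_bigcup. Qed.

HB.instance Definition _ := @isMeasurable.Build
  (measure_row_display default_measure_display) 'rV[R]_n
  (g_sigma_preimage row_coord) row_set0 row_setC row_bigcup.

Lemma measurable_row_coord (i : 'I_n) : measurable_fun setT (row_coord i).
Proof.
move=> _ Y mY; rewrite setTI; apply: sub_sigma_algebra => /=.
rewrite -bigcup_seq/=; exists i => /=; first by rewrite mem_index_enum.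
by exists Y => //; rewrite setTI.
Qed.

Lemma measurable_fun_row d (T : measurableType d) (f : T -> 'rV[R]_n) :
  (forall i, measurable_fun setT (row_coord i \o f)) -> measurable_fun setT f.
Proof.
move=> mf; suff H : g_sigma_preimage row_coord `<=`
    [set A | measurable (f @^-1` A)].
  by move=> _ A mA; rewrite setTI; exact: H.
apply: smallest_sub.
  split=> /=.
  - by rewrite preimage_set0.
  - by move=> A mA; rewrite setTD preimage_setC; exact: measurableC.
  - by move=> F mF; rewrite preimage_bigcup; exact: bigcup_measurable.
move=> A; rewrite -bigcup_seq => -[i _ [B mB <-]] /=.
by rewrite setTI -comp_preimage -[X in measurable X]setTI; exact: mf.
Qed.

End measurable_row.

Section lebesgue_row.
Local Lemma sigma_finite_prod d1 d2 (T1 : measurableType d1)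
    (T2 : measurableType d2) (R : realType)
    (m1 : {sigma_finite_measure set T1 -> \bar R})
    (m2 : {sigma_finite_measure set T2 -> \bar R}) :
  sigma_finite setT (m1 \x m2)%E.
Proof.
have /sigma_finiteP[F [TF ndF Foo]] := sigma_finiteT m1.
have /sigma_finiteP[G [TG ndG Goo]] := sigma_finiteT m2.
exists (fun k => F k `*` G k).
  rewrite -setXTT TF TG; apply/seteqP; split=> [[x y]|[x y]].
    move=> [/= [k _ Fkx] [l _ Gly]]; exists (maxn k l) => //; split.
    - by move: x Fkx; exact/subsetPset/ndF/leq_maxl.
    - by move: y Gly; exact/subsetPset/ndG/leq_maxr.
  by move=> [k _ []/= ? ?]; split; exists k.
move=> k; have [? ?] := Foo k; have [? ?] := Goo k.
split; first exact: measurableX.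
by rewrite product_measure1E// lte_mul_pinfty// ge0_fin_numE.
Qed.

Variable R : realType.

Definition cons_row n (p : measurableTypeR R * 'rV[R]_n) : 'rV[R]_n.+1 :=
  row_mx (p.1 : R)%:M p.2.

Lemma cons_row0 n p : @cons_row n p 0 0 = p.1.
Proof.
transitivity (row_mx (p.1 : R)%:M p.2 0 (lshift n (0 : 'I_1))).
  by congr (row_mx _ _ _ _); exact: val_inj.
by rewrite row_mxEl mxE.
Qed.

Lemma cons_rowS n p (j : 'I_n) : @cons_row n p 0 (lift ord0 j) = p.2 0 j.
Proof.
transitivity (row_mx (p.1 : R)%:M p.2 0 (rshift 1 j)).
  by congr (row_mx _ _ _ _); exact: val_inj.
by rewrite row_mxEr.
Qed.

Lemma measurable_cons_row n : measurable_fun setT (@cons_row n).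
Proof.
apply: measurable_fun_row => i.
have [j ->|->] := unliftP ord0 i.
  rewrite (_ : _ \o _ = row_coord j \o snd).
    by apply: measurableT_comp; [exact: measurable_row_coord|].
  by apply/funext => p; rewrite /row_coord/= cons_rowS.
rewrite (_ : _ \o _ = fst)//.
by apply/funext => p; rewrite /row_coord/= cons_row0.
Qed.

Section step.
Variables (n : nat) (mu : {sigma_finite_measure set 'rV[R]_n -> \bar R}).
Local Open Scope ereal_scope.

Definition lebesgue_cons : set 'rV[R]_n.+1 -> \bar R :=
  pushforward (lebesgue_measure \x mu) (@cons_row n).

Let mcons A : measurable A -> measurable (@cons_row n @^-1` A).
Proof.
by move=> mA; rewrite -[X in measurable X]setTI; exact: measurable_cons_row.
Qed.

Let lebesgue_cons0 : lebesgue_cons set0 = 0.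
Proof. by rewrite /lebesgue_cons /pushforward preimage_set0 measure0. Qed.

Let lebesgue_cons_ge0 A : 0 <= lebesgue_cons A.
Proof. by rewrite /lebesgue_cons /pushforward; exact: measure_ge0. Qed.

Let lebesgue_cons_sigma_additive : semi_sigma_additive lebesgue_cons.
Proof.
move=> F mF tF mUF; rewrite /lebesgue_cons /pushforward preimage_bigcup.
apply: measure_semi_sigma_additive.
- by move=> k; exact: mcons.
- apply/trivIsetP => /= i j _ _ ij; rewrite -preimage_setI.
  by move/trivIsetP : tF => /(_ _ _ _ _ ij) ->//; rewrite preimage_set0.
- by rewrite -preimage_bigcup; exact: mcons.
Qed.

HB.instance Definition _ := isMeasure.Build _ _ _ lebesgue_cons
  lebesgue_cons0 lebesgue_cons_ge0 lebesgue_cons_sigma_additive.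

Definition uncons_row (x : 'rV[R]_n.+1) : measurableTypeR R * 'rV[R]_n :=
  (x ord0 ord0, \row_j x ord0 (lift ord0 j)).

Lemma cons_rowK : cancel (@cons_row n) uncons_row.
Proof.
move=> [a v]; rewrite /uncons_row cons_row0; congr pair.
by apply/rowP => j; rewrite mxE cons_rowS.
Qed.

Lemma measurable_uncons_row : measurable_fun setT uncons_row.
Proof.
apply/measurable_fun_pairP; split.
  exact: (@measurable_row_coord R n.+1 ord0).
apply: measurable_fun_row => j.
rewrite (_ : _ \o _ = row_coord (lift ord0 j)).
  exact: measurable_row_coord.
by apply/funext => x; rewrite /row_coord/= mxE.
Qed.

Let lebesgue_cons_sigma_finite : sigma_finite setT lebesgue_cons.
Proof.
have [F TF Foo] := sigma_finite_prod lebesgue_measure mu.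
exists (fun k => uncons_row @^-1` F k).
  by rewrite -preimage_bigcup -TF preimage_setT.
move=> k; have [mF Fk] := Foo k; split.
  by rewrite -[X in measurable X]setTI; exact: measurable_uncons_row.
rewrite /lebesgue_cons /pushforward -comp_preimage.
by rewrite (_ : _ \o _ = id) ?preimage_id//; apply/funext; exact: cons_rowK.
Qed.

HB.instance Definition _ := @Measure_isSigmaFinite.Build _ _ _
  lebesgue_cons lebesgue_cons_sigma_finite.

End step.

Fixpoint lebesgue_Rn n : {sigma_finite_measure set 'rV[R]_n -> \bar R} :=
  match n with
  | 0 => \d_ (0 : 'rV[R]_0)
  | k.+1 => lebesgue_cons (lebesgue_Rn k)
  end.

Lemma lebesgue_Rn_box n (A : 'I_n -> set (measurableTypeR R)) :
  (forall i, measurable (A i)) ->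
  lebesgue_Rn n [set x : 'rV[R]_n | forall i, A i (x 0 i)] =
  (\prod_(i < n) lebesgue_measure (A i))%E.
Proof.
elim: n A => [|n IHn] A mA /=.
  rewrite big_ord0 diracE mem_set//.
  by case.
have mB : measurable [set x : 'rV[R]_n | forall i, A (lift ord0 i) (x 0 i)].
  rewrite (_ : mkset _ = \bigcap_(i in [set: 'I_n])
      (row_coord i @^-1` A (lift ord0 i))).
    apply: fin_bigcap_measurable => // i _.
    by rewrite -[X in measurable X]setTI; exact: measurable_row_coord.
  by apply/seteqP; split=> x Ax i; [move=> _; exact: (Ax i)|exact: (Ax i I)].
rewrite big_ord_recl -IHn// -product_measure1E//.
rewrite /lebesgue_cons /pushforward; congr (_ _).
apply/seteqP; split=> [p Ap|p [A0 AS] i] /=.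
  split=> [|i] /=; first by have := Ap ord0; rewrite cons_row0.
  by have := Ap (lift ord0 i); rewrite cons_rowS.
by have [j ->|->] := unliftP ord0 i; rewrite ?cons_rowS ?cons_row0.
Qed.

End lebesgue_row.

Section Rn.
Variable R : realType.

(* The norm of the library on matrices is the sup norm; this is the Euclidean
   one. *)
Definition enorm m n (A : 'M[R]_(m, n)) : R :=
  Num.sqrt (\sum_i \sum_j A i j ^+ 2).

(* Sum of an absolutely convergent family: esum is only meaningful for
   nonnegative terms, so positive and negative parts are summed separately. *)
Definition real_sum (T : choiceType) (D : set T) (F : T -> R) : R :=
  fine (esum D (EFin \o F)^\+ - esum D (EFin \o F)^\-)%E.

Section fixed_dimension.
Variable n : nat.
Implicit Types (f s phi g : 'rV[R]_n -> R) (x : 'rV[R]_n).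

Definition ebasis (j : 'I_n) : 'rV[R]_n := delta_mx 0 j.

(* C^k regularity on an open set U, through iterated partial derivatives *)
Fixpoint Ck_on (U : set 'rV[R]_n) (k : nat) f : Prop :=
  (forall x, U x -> {for x, continuous f}) /\
  match k with
  | 0 => True
  | k'.+1 => forall j, (forall x, U x -> derivable f x (ebasis j)) /\
                       Ck_on U k' ('D_(ebasis j) f)
  end.

Definition smooth_on (U : set 'rV[R]_n) f := forall k, Ck_on U k f.

Definition CkC (k : nat) f :=
  Ck_on setT k f /\ compact (closure [set x | f x != 0]).

Definition mdegree (a : 'rV[nat]_n) : nat := (\sum_j a ord0 j)%N.

Definition mderive (a : 'rV[nat]_n) f : 'rV[R]_n -> R :=
  foldr (fun j h => iter (a ord0 j) (fun u => 'D_(ebasis j) u) h) f (enum 'I_n).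

(* 0 ^ 0 = 1 *)
Definition monomial (gamma : 'rV[int]_n) x : R := \prod_j x 0 j ^ gamma 0 j.

Definition schwartz f :=
  smooth_on setT f /\
  forall a b : 'rV[nat]_n, exists M : R,
    forall x, `|monomial (map_mx Posz a) x * mderive b f x| <= M.

Definition radial f := forall x y, enorm x = enorm y -> f x = f y.

(* Kernels are total functions whose value at 0 is arbitrary. *)
Definition weakly_singular s :=
  smooth_on (~` [set 0]) s /\
  cvg ((\int[lebesgue_Rn R n]_(x in [set x | h < enorm x <= 1]) s x)
         @[h --> 0^'+]).

Definition dilation (delta : R) s :=
  exists rho : 'rV[R]_n -> R,
    [/\ smooth_on setT rho, exists x, rho x != 0 &
        forall x, x != 0 ->
          s x = enorm x `^ (delta - n%:R) * rho ((enorm x)^-1 *: x)].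

Definition reflect_coord (j : 'I_n) x : 'rV[R]_n :=
  \row_i (if i == j then - x 0 i else x 0 i).

Definition symmetric_kernel (kappa : nat) s :=
  forall x, x != 0 -> forall j : 'I_n,
    s x = if (j < kappa)%N then - s (reflect_coord j x)
          else s (reflect_coord j x).

Definition lattice_pt (h : R) (b : 'rV[int]_n) : 'rV[R]_n :=
  h *: map_mx intr b.

Definition punctured_trapezoidal (h : R) f : R :=
  h ^+ n * real_sum (~` [set 0]) (fun b => f (lattice_pt h b)).

(* Coordinates are numbered from 0, so 1 <= j <= kappa reads j < kappa. *)
Section grids.
Variable kappa : nat.
Implicit Types (b eta : 'rV[int]_n).

Definition norm1 b : nat := (\sum_j `|b ord0 j|)%N.

Definition kprod b : int := \prod_(j < n | (j < kappa)%N) b 0 j.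

Definition grid (p : nat) : set 'rV[int]_n :=
  [set b | (norm1 b <= p)%N /\ kprod b != 0].

Definition nonneg_grid (p : nat) : set 'rV[int]_n :=
  [set b | grid p b /\ forall j, 0 <= b 0 j].

Definition sign_orbit eta : set 'rV[int]_n :=
  [set b | exists k : 'I_n -> bool, b = \row_j ((-1) ^+ k j * eta 0 j)].

(* 2 xi - e_1 - ... - e_kappa *)
Definition moment_exponent (xi : 'rV[int]_n) : 'rV[int]_n :=
  xi *+ 2 - \sum_(l < n | (l < kappa)%N) delta_mx 0 l.

Section system.
(* an enumeration of nonneg_grid *)
Variables (m : nat) (xi : 'I_m -> 'rV[int]_n).

Definition system_K : 'M[R]_m :=
  \matrix_(i, j) \sum_(b \in sign_orbit (xi j))
    (Num.sg (kprod b))%:~R * monomial (moment_exponent (xi i)) (map_mx intr b).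

Definition system_G g (h : R) : 'M[R]_m :=
  diag_mx (\row_i g (lattice_pt h (xi i))).

Definition system_c (delta : R) s g (h : R) : 'cV[R]_m :=
  \col_i
    ((h `^ ((2 * norm1 (xi i))%:R - kappa%:R + delta))^-1 *
     (\int[lebesgue_Rn R n]_x
         (g x * s x * monomial (moment_exponent (xi i)) x) -
      punctured_trapezoidal h
        (fun x => g x * s x * monomial (moment_exponent (xi i)) x))).

Definition modified_trapezoidal (delta : R) s (w : 'cV[R]_m) (h : R) phi : R :=
  punctured_trapezoidal h (fun x => phi x * s x) +
  h `^ delta * \sum_(i < m) w i 0 *
    \sum_(b \in sign_orbit (xi i)) (Num.sg (kprod b))%:~R * phi (lattice_pt h b).

End system.
End grids.
End fixed_dimension.
End Rn.

(* Main.v *)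
(** Write T_h for the punctured rule and r = 2p - kappa + 2. If F and its
    derivatives d_j^k F, k <= N, are bounded by A |x|^(q-n-k) with 0 < q < N, then
    |T_h F - int F| <= C A h^q: T_(h/2) F - T_h F is a combination of alternating
    sums over the lattice, in which summation by parts trades the alternating
    weight for N-th differences of F, and the errors of the scales h, h/2, h/4, ...
    are summed.

    For F(x) = x^w (g(x) - g(lx)) s(x) the flatness of g allows q = |w| + r + delta;
    with homogeneity this says that the scaled moment errors c_i(h) are Cauchy as
    h -> 0 with rate h^r. The matrix K consists, up to the sizes of the orbits, of
    the values of the monomials x^(2 xi_i - e_1 - ... - e_kappa) at the grid points,
    and is triangular in a Newton interpolation basis. As G(h) = 1 + O(h^r), omega(h)
    converges with rate h^r to K^-1 (lim c).

    For the error of the modified rule write phi = P g + Phi with P the Taylor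
    polynomial of degree < r. On Phi the quadrature estimate applies with
    q = r + delta. A monomial of P without the parity of s contributes 0 by
    reflection; any other one is one of the grid monomials, and its error is
    h^(|w| + delta) times (lim c_i) - c_i(h) + O(h^r). *)

From HB Require Import structures.
Require Import Defs.
From mathcomp Require Import all_boot all_order all_algebra.
From mathcomp Require Import all_classical all_reals all_analysis.
From mathcomp Require Import measurable_realfun ring lra zify.

Set Implicit Arguments.
Unset Strict Implicit.
Unset Printing Implicit Defensive.

Import Order.TTheory GRing.Theory Num.Theory.
Import numFieldNormedType.Exports.

Local Open Scope classical_set_scope.
Local Open Scope ring_scope.

(** * Lebesgue measure and lattice sums *)

(** The integral enters only as the limit of the rule under halving of the mesh, obtained by
    dominated convergence. Dilations and reflections are therefore checked on lattice sums and
    carried over to the integral by this limit; no change of variables on R^n occurs. Within a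
    distance of order N h of the origin the N-th differences meet the singularity and derivative
    bounds say nothing; there the size bound on F takes over, and on these finitely many lattice
    points it costs only a constant. Summing the decay of the differences over the lattice is what
    needs q < N. The constant C of the quadrature estimate depends only on n, q and N, not on F;
    this is what makes the Cauchy estimate for c_i(h) uniform in 0 < l <= 1. The kernel is redefined
    to be 0 at the origin, so that punctured sums become sums over the whole lattice. Estimates use
    the sup norm; the Euclidean norm matters only in the dilation and radiality hypotheses and in
    the rate for omega(h). *)

Section cells.
Variables (R : realType) (n : nat).
Local Notation mu := (lebesgue_Rn R n).

Lemma measurable_box (A : 'I_n -> set (measurableTypeR R)) :
  (forall i, measurable (A i)) ->
  measurable [set x : 'rV[R]_n | forall i, A i (x 0 i)].
Proof.
move=> mA; rewrite (_ : mkset _ = \bigcap_(i in [set: 'I_n])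
    (@row_coord R n i @^-1` A i)).
  apply: fin_bigcap_measurable => // i _.
  by rewrite -[X in measurable X]setTI; exact: measurable_row_coord.
by apply/seteqP; split=> x Ax i; [move=> _; exact: (Ax i)|exact: (Ax i I)].
Qed.

Definition cell (h : R) (x : 'rV[R]_n) : 'rV[int]_n :=
  map_mx Num.floor (h^-1 *: x).

Lemma cell_fiber (h : R) (b : 'rV[int]_n) : 0 < h ->
  cell h @^-1` [set b] =
  [set x : 'rV[R]_n | forall i, `[h * (b 0 i)%:~R, h * (b 0 i)%:~R + h[%classic (x 0 i)].
Proof.
move=> h0; apply/seteqP; split=> x /=.
  move=> <- i /=; rewrite !mxE in_itv/=.
  have := floor_le_tmp (h^-1 * x 0 i); have := floorD1_gt (h^-1 * x 0 i).
  rewrite -ler_pdivlMl// => + ->/=; rewrite intrD ltr_pdivrMl//.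
  by rewrite mulrDr mulr1.
move=> xb; apply/rowP => i; rewrite !mxE; apply: floor_def.
have /= := xb i; rewrite in_itv/= => /andP[hb bh].
by rewrite ler_pdivlMl// hb/= ltr_pdivrMl// intrD mulrDr mulr1.
Qed.

Lemma measurable_cell_fiber (h : R) (b : 'rV[int]_n) : 0 < h ->
  measurable (cell h @^-1` [set b]).
Proof.
move=> h0; rewrite cell_fiber//.
by apply: (measurable_box (A := fun i => `[h * (b 0 i)%:~R, h * (b 0 i)%:~R + h[%classic)).
Qed.

Lemma lebesgue_cell_fiber (h : R) (b : 'rV[int]_n) : 0 < h ->
  mu (cell h @^-1` [set b]) = (h ^+ n)%:E.
Proof.
move=> h0; rewrite cell_fiber//.
rewrite (lebesgue_Rn_box (A := fun i => `[h * (b 0 i)%:~R, h * (b 0 i)%:~R + h[%classic))//.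
under eq_bigr do rewrite lebesgue_measure_itv/= lte_fin ltrDl h0 -EFinB addrC addKr.
by rewrite prodEFin prodr_const card_ord.
Qed.

(** Countable additivity runs over the natural numbers, so the cells are numbered by [pickle];
    numbers that code no lattice point give the empty set. *)
Let piece (h : R) (k : nat) : set 'rV[R]_n := [set x | pickle (cell h x) = k].

Let pieceE h k : piece h k = if pickle_inv k is Some b
  then cell h @^-1` [set b] else set0.
Proof.
case E : (pickle_inv k) => [b|].
  apply/seteqP; split=> x; rewrite /piece/=.
    by move=> xk; move: E; rewrite -xk pickleK_inv => -[].
  by move=> ->; have := @pickle_invK 'rV[int]_n k; rewrite E.
by apply/seteqP; split=> x//=; rewrite /piece/= => xk; move: E; rewrite -xk pickleK_inv.
Qed.

Lemma measurable_cell_comp d (T : measurableType d) (f : 'rV[int]_n -> T) (h : R) :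
  0 < h -> measurable_fun setT (f \o cell h).
Proof.
move=> h0 _ Y mY; rewrite setTI.
rewrite (_ : _ @^-1` _ = \bigcup_(k in [set k | exists2 b, pickle_inv k = Some b & Y (f b)]) piece h k).
  apply: bigcup_measurable => k _; rewrite pieceE.
  by case: pickle_inv => [b|//]; exact: measurable_cell_fiber.
apply/seteqP; split=> x /=.
  by move=> Yx; exists (pickle (cell h x)) => //=; exists (cell h x); rewrite ?pickleK_inv.
by move=> [k /= [b kb Yb]]; rewrite pieceE kb/= => ->.
Qed.

(** Each cell has volume h^n, so integrating a function constant on cells is summing over the
    lattice. Linearity and domination of lattice sums are later drawn from integration through this
    identity. *)
Lemma ge0_integral_cell (h : R) (a : 'rV[int]_n -> \bar R) : 0 < h ->
  (forall b, 0 <= a b)%E ->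
  (\int[mu]_x a (cell h x) = (h ^+ n)%:E * \esum_(b in setT) a b)%E.
Proof.
move=> h0 a0.
have UT : \bigcup_k piece h k = setT.
  by apply/seteqP; split=> x // _; exists (pickle (cell h x)).
have mp k : measurable (piece h k).
  by rewrite pieceE; case: pickle_inv => [b|//]; exact: measurable_cell_fiber.
rewrite -UT ge0_integral_bigcup//; first last.
- apply/trivIsetP => i j _ _ ij; apply/seteqP; split=> x //= [xi xj].
  by move: ij; rewrite -xi -xj eqxx.
- by rewrite UT; exact: (measurable_cell_comp a h0).
pose a' k := if pickle_inv k is Some b then a b else 0%E.
have a'0 k : (0 <= a' k)%E by rewrite /a'; case: pickle_inv.
have hn0 : (0 <= (h ^+ n)%:E :> \bar R)%E by rewrite lee_fin exprn_ge0// ltW.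
rewrite (eq_eseriesr (g := fun k => ((h ^+ n)%:E * a' k)%E)); last first.
  move=> k _; rewrite /a' pieceE; case E: pickle_inv => [b|]; last first.
    by rewrite integral_set0 mule0.
  rewrite (eq_integral (cst (a b))); last by move=> x /[!inE]/= ->.
  rewrite integral_cst; last exact: measurable_cell_fiber.
  by rewrite [X in (_ * X)%E]lebesgue_cell_fiber// muleC.
rewrite nneseriesZl//; congr (_ * _)%E; rewrite nneseries_esumT//.
rewrite (_ : \esum_(b in setT) _ = \esum_(b in [set: 'rV[int]_n]) a' (pickle b))%E; last first.
  by apply: eq_esum => b _; rewrite /a' pickleK_inv.
rewrite -(esum_image setT (@pickle 'rV[int]_n) a'); last first.
  by move=> x y _ _; exact: (pcan_inj (@pickleK 'rV[int]_n)).
rewrite [RHS]esum_mkcond; apply: eq_esum => k _.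
case: ifPn => // /negP; rewrite inE => kE; rewrite /a'.
case E: pickle_inv => [b|//]; exfalso; apply: kE; exists b => //.
by have := @pickle_invK 'rV[int]_n k; rewrite E.
Qed.
End cells.

Section sup_norm.
Variables (R : realType) (n : nat).
Implicit Types x y : 'rV[R]_n.

Lemma ler_norm_coord x i : `|x 0 i| <= `|x|.
Proof.
rewrite [leRHS]/Num.Def.normr/= mx_normrE.
exact: (le_bigmax _ (fun ij : 'I_1 * 'I_n => `|x ij.1 ij.2|) (0, i)).
Qed.

Lemma row_norm_le x (c : R) : 0 <= c -> (forall i, `|x 0 i| <= c) -> `|x| <= c.
Proof.
move=> c0 xc; rewrite [leLHS]/Num.Def.normr/= mx_normrE.
by apply/bigmax_leP; split=> // -[i j] _ /=; rewrite (ord1 i).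
Qed.

Lemma row_norm_attained x : (0 < n)%N -> exists i, `|x| = `|x 0 i|.
Proof.
move=> n0; have [->|x0] := eqVneq x 0.
  by exists (Ordinal n0); rewrite mxE !normr0.
have : mx_norm x != 0 by apply: contra_neq x0 => /mx_norm_eq0.
by move/mx_norm_neq0 => [[i j]]; rewrite (ord1 i) => ?; exists j.
Qed.

End sup_norm.

Section powR_extra.
Variable R : realType.
Implicit Types x y r s : R.

Lemma powR_le_neg x y r : 0 < x -> x <= y -> r <= 0 -> y `^ r <= x `^ r.
Proof.
move=> x0 xy r0; rewrite -(opprK r) powRN [leRHS]powRN lef_pV2 ?posrE ?powR_gt0//; last first.
  exact: lt_le_trans xy.
by rewrite ge0_ler_powR// ?nnegrE ?oppr_ge0// ltW//; exact: lt_le_trans xy.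
Qed.

Lemma powRD_gt0 x r s : 0 < x -> x `^ (r + s) = x `^ r * x `^ s.
Proof. by move=> x0; rewrite powRD// (gt_eqF x0) implybT. Qed.

Lemma powR_pexp x r (k : nat) : 0 <= x -> (x ^+ k) `^ r = (x `^ r) ^+ k.
Proof.
move=> x0; elim: k => [|k IH]; first by rewrite !expr0 powR1.
by rewrite !exprS powRM ?exprn_ge0// IH.
Qed.

Lemma dyadic_scale x : 1 <= x -> exists k : nat, 2 ^+ k <= x < 2 ^+ k.+1.
Proof.
move=> x1; have ex : exists k, x < 2 ^+ k.+1.
  exists (Num.Def.archi_bound x); apply: lt_trans (upper_nthrootP (leqnn _)) _.
  by rewrite ltr_eXn2l// ltr1n.
exists (ex_minn ex); case: ex_minnP => -[|k] xk min; first by rewrite expr0 x1.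
rewrite xk andbT leNgt; apply/negP => /min; by rewrite ltnn.
Qed.

End powR_extra.

(** * Integrable majorants of radial powers *)

Section shells.
Variables (R : realType) (n : nat).
Local Notation mu := (lebesgue_Rn R n).

Definition sup_ball (r : R) : set 'rV[R]_n := [set x | `|x| <= r].

Lemma sup_ball_box r : 0 <= r ->
  sup_ball r = [set x : 'rV[R]_n | forall i, `[- r, r]%classic (x 0 i)].
Proof.
move=> r0; apply/seteqP; split=> x /= xr.
  by move=> i; rewrite in_itv/= -ler_norml (le_trans (ler_norm_coord _ _)).
by apply: row_norm_le => // i; have := xr i; rewrite in_itv/= -ler_norml.
Qed.

Lemma measurable_sup_ball r : 0 <= r -> measurable (sup_ball r).
Proof.
move=> r0; rewrite sup_ball_box//.
exact: (measurable_box (A := fun=> `[- r, r]%classic)).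
Qed.

Lemma lebesgue_sup_ball r : 0 <= r -> mu (sup_ball r) = ((2 * r) ^+ n)%:E.
Proof.
move=> r0; rewrite sup_ball_box// (lebesgue_Rn_box (A := fun=> `[- r, r]%classic))//.
have E : lebesgue_measure `[- r, r]%classic = (2 * r)%:E.
  rewrite lebesgue_measure_itv/= lte_fin; case: ifPn => [_|].
    by rewrite -EFinB; congr EFin; ring.
  by rewrite -leNgt => rr; congr EFin; lra.
under eq_bigr do rewrite E.
by rewrite prodEFin prodr_const card_ord.
Qed.

Variables (a r : nat -> R) (C z : R).
Hypotheses (a0 : forall k, 0 <= a k) (r0 : forall k, 0 <= r k).
Hypotheses (z1 : `|z| < 1) (arCz : forall k, a k * (2 * r k) ^+ n = C * z ^+ k).

(** Superposing indicators of balls whose weighted volumes form a geometric series ([arCz]) gives an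
    integrable function that can dominate a radial power, with no polar coordinates. *)
Definition shells (x : 'rV[R]_n) : \bar R :=
  (\sum_(k <oo) (a k * \1_(sup_ball (r k)) x)%:E)%E.

Let shell_ge0 k x : (0 <= (a k * \1_(sup_ball (r k)) x)%:E)%E.
Proof. by rewrite lee_fin mulr_ge0. Qed.

Lemma shells_ge0 x : (0 <= shells x)%E.
Proof. by apply: nneseries_ge0. Qed.

Lemma shells_ge k x : `|x| <= r k -> ((a k)%:E <= shells x)%E.
Proof.
move=> xk; apply: le_trans (nneseries_lim_ge k.+1 _) => //.
rewrite big_nat_recr//= indicE mem_set// mulr1.
by rewrite leeDr// sume_ge0.
Qed.

Let measurable_shell k :
  measurable_fun setT (fun x => (a k * \1_(sup_ball (r k)) x)%:E).
Proof.
apply/measurable_EFinP; apply: measurable_funM => //.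
by apply: measurable_indic; exact: measurable_sup_ball.
Qed.

Lemma integrable_shells : mu.-integrable setT shells.
Proof.
apply/integrableP; split.
  by apply: ge0_emeasurable_sum => // k *; exact: measurable_shell.
under eq_integral do rewrite gee0_abs ?shells_ge0//.
rewrite integral_nneseries//.
rewrite (eq_eseriesr (g := fun k => (C * z ^+ k)%:E)); last first.
  move=> k _; under eq_integral do rewrite EFinM.
  rewrite ge0_integralZl//; last 2 first.
  - by apply/measurable_EFinP; apply: measurable_indic; exact: measurable_sup_ball.
  - by rewrite lee_fin.
  rewrite integral_indic ?setIT//; last exact: measurable_sup_ball.
  by rewrite [X in (_ * X)%E]lebesgue_sup_ball// -EFinM arCz.
have Cz0 k : 0 <= C * z ^+ k by rewrite -arCz mulr_ge0// exprn_ge0// mulr_ge0.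
apply: (@le_lt_trans _ _ (C / (1 - z))%:E); last exact: ltry.
apply: lime_le; first by apply: is_cvg_nneseries => k _ _; rewrite lee_fin.
apply: nearW => k; rewrite sumEFin lee_fin.
have := @cvg_geometric_series _ C z z1 => /cvg_lim <- //.
apply: nondecreasing_cvgn_le => //; last exact: is_cvg_geometric_series.
by apply: nondecreasing_series => i _ _; exact: Cz0.
Qed.

End shells.

Section lattice_approximation.
Variables (R : realType) (n : nat).
Implicit Types (x : 'rV[R]_n) (b : 'rV[int]_n).

Lemma cell_approx (h : R) x : 0 < h -> `|x - lattice_pt h (cell h x)| <= h.
Proof.
move=> h0; apply: row_norm_le; first exact: ltW.
move=> i; rewrite !mxE; set t := x 0 i.
have -> : t - h * (Num.floor (h^-1 * t))%:~R =
    h * (h^-1 * t - (Num.floor (h^-1 * t))%:~R).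
  by rewrite mulrBr mulrA divff ?mul1r// gt_eqF.
have := floor_le_tmp (h^-1 * t); have := floorD1_gt (h^-1 * t); rewrite intrD => f1 f2.
rewrite normrM gtr0_norm// ler_piMr ?(ltW h0)// ger0_norm ?subr_ge0//.
by rewrite lerBlDl; exact: ltW.
Qed.

Lemma int_norm_ge1 b : b != 0 -> 1 <= `|map_mx intr b : 'rV[R]_n|.
Proof.
move=> b0; have [i bi] : exists i, b 0 i != 0.
  apply/existsP; apply: contraNT b0 => /existsPn b0.
  by apply/eqP/rowP => i; rewrite mxE; apply/eqP; have := b0 i; rewrite negbK.
apply: le_trans (ler_norm_coord _ i); rewrite mxE -intr_norm -[1]/(1%:~R) ler_int.
by rewrite -gtz0_ge1 normr_gt0.
Qed.

Lemma lattice_norm (h : R) b : 0 < h -> `|lattice_pt h b| = h * `|map_mx intr b : 'rV[R]_n|.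
Proof. by move=> h0; rewrite /lattice_pt normrZ gtr0_norm. Qed.

Lemma lattice_pt_eq0 (h : R) b : 0 < h -> (lattice_pt h b == 0) = (b == 0).
Proof.
move=> h0; apply/eqP/eqP => [|->]; last by rewrite /lattice_pt map_mx0 scaler0.
move=> hb0; apply/eqP/negP => /negP/int_norm_ge1.
have := lattice_norm b h0; rewrite hb0 normr0 => /esym/eqP.
by rewrite mulf_eq0 (gt_eqF h0)/= => /eqP ->; rewrite ler10.
Qed.

(** x is within h of the corner of its cell, and a nonzero corner has norm at least h. The cell
    whose corner is the origin is excluded; functions vanishing at 0 contribute nothing there. *)
Lemma cell_norm_le (h : R) x : 0 < h -> cell h x != 0 ->
  `|x| <= 2 * `|lattice_pt h (cell h x)|.
Proof.
move=> h0 x0; rewrite -[x in leLHS](subrK (lattice_pt h (cell h x))).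
rewrite (le_trans (ler_normD _ _))// mulrDl !mul1r lerD2r.
rewrite (le_trans (cell_approx _ h0))// lattice_norm// ler_peMr// ?(ltW h0)//.
exact: int_norm_ge1.
Qed.

End lattice_approximation.

Section weights.
Variables (R : realType) (n : nat).
Local Notation mu := (lebesgue_Rn R n).

(** A majorant of |x|^(-(n+e)) for |x| >= 1; [near_weight] is one of |x|^(d-n) for |x| <= 1. The
    radii carry a spare factor so that the value at x also controls the power at any y with |x| <=
    2|y|, in particular at a nonzero corner of the cell of x. *)
Definition far_weight (e : R) : 'rV[R]_n -> \bar R :=
  shells (fun k => (2 `^ (- (n%:R + e))) ^+ k) (fun k => 4 * 2 ^+ k).

Definition near_weight (d : R) : 'rV[R]_n -> \bar R :=
  shells (fun k => (2 `^ (n%:R - d)) ^+ k.+1) (fun k => 2 * 2 ^- k).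

Lemma powR2N_lt1 (e : R) : 0 < e -> `|2 `^ (- e) : R| < 1.
Proof.
move=> e0; rewrite ger0_norm ?powR_ge0// powRN invf_lt1 ?powR_gt0//.
rewrite [ltLHS](_ : 1 = 1 `^ e); last by rewrite powR1.
by apply: gt0_ltr_powR; rewrite ?nnegrE// ltr1n.
Qed.

Lemma integrable_far_weight (e : R) : 0 < e -> mu.-integrable setT (far_weight e).
Proof.
move=> e0; apply: (integrable_shells (C := 8 ^+ n) (z := 2 `^ (- e))).
- by move=> k; rewrite exprn_ge0// powR_ge0.
- by move=> k; rewrite mulr_ge0// exprn_ge0.
- exact: powR2N_lt1.
move=> k; rewrite mulrA -natrM exprMn -exprM mulnC exprM.
have -> : 2 `^ (- e) = 2 `^ (- (n%:R + e)) * 2 ^+ n :> R.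
  by rewrite -powR_mulrn// -powRD_gt0//; congr (_ `^ _); ring.
by rewrite (_ : (4 * 2 = 8)%N)// [in RHS]exprMn [2 ^+ k ^+ n]exprAC; ring.
Qed.

Lemma integrable_near_weight (d : R) : 0 < d -> mu.-integrable setT (near_weight d).
Proof.
move=> d0; apply: (integrable_shells (C := 4 ^+ n * 2 `^ (n%:R - d)) (z := 2 `^ (- d))).
- by move=> k; rewrite exprn_ge0// powR_ge0.
- by move=> k; rewrite mulr_ge0.
- exact: powR2N_lt1.
move=> k; rewrite mulrA -natrM exprMn exprS.
have -> : 2 `^ (- d) = 2 `^ (n%:R - d) * 2 ^- n :> R.
  by rewrite -powR_mulrn// -powRN -powRD_gt0//; congr (_ `^ _); ring.
by rewrite !exprMn !exprVn -!exprM mulnC; ring.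
Qed.

Lemma far_weight_ge0 e x : (0 <= far_weight e x)%E.
Proof. by apply: shells_ge0 => k; rewrite exprn_ge0// powR_ge0. Qed.

Lemma near_weight_ge0 d x : (0 <= near_weight d x)%E.
Proof. by apply: shells_ge0 => k; rewrite exprn_ge0// powR_ge0. Qed.

Lemma far_weight_ge (e rho : R) x : 0 < e -> 1 <= rho -> `|x| <= 2 * rho ->
  ((rho `^ (- (n%:R + e)))%:E <= far_weight e x)%E.
Proof.
move=> e0 rho1 xrho; have [k /andP[k1 k2]] := dyadic_scale rho1.
have xk : `|x| <= 4 * 2 ^+ k.
  apply: le_trans xrho _; rewrite -[4]/(2 * 2)%:R natrM -mulrA -exprS.
  by rewrite ler_pM2l// ltW.
have a0 j : 0 <= (2 `^ (- (n%:R + e))) ^+ j :> R by rewrite exprn_ge0// powR_ge0.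
apply: le_trans (shells_ge a0 xk).
rewrite lee_fin -powR_pexp//; apply: powR_le_neg => //.
by rewrite oppr_le0 addr_ge0// ltW.
Qed.

Lemma near_weight_ge (d rho : R) x : d <= n%:R -> 0 < rho <= 1 -> `|x| <= 2 * rho ->
  ((rho `^ (d - n%:R))%:E <= near_weight d x)%E.
Proof.
move=> dn /andP[rho0 rho1] xrho.
have [|k /andP[k1 k2]] := @dyadic_scale R rho^-1; first by rewrite invf_ge1.
have xk : `|x| <= 2 * 2 ^- k.
  apply: le_trans xrho _; rewrite ler_pM2l//.
  by rewrite -[leLHS]invrK lef_pV2 ?posrE ?invr_gt0 ?exprn_gt0.
have a0 j : 0 <= (2 `^ (n%:R - d)) ^+ j.+1 :> R by rewrite exprn_ge0// powR_ge0.
apply: le_trans (shells_ge a0 xk).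
rewrite lee_fin -powR_pexp// -opprB powRN -(powR_inv1 (powR_ge0 _ _)) -powRrM mulrC powRrM.
rewrite powR_inv1 ?(ltW rho0)// ge0_ler_powR// ?subr_ge0// ?nnegrE ?exprn_ge0//.
  by rewrite invr_ge0 ltW.
exact: ltW.
Qed.

End weights.

(** * Functions whose trapezoid sums converge to the integral *)

Section tame.
Variables (R : realType) (n : nat).
Local Notation mu := (lebesgue_Rn R n).
Implicit Types (F : 'rV[R]_n -> R) (h d : R).

(** The first bound matters near 0, where it is integrable for d > 0, the second at infinity; both
    are asked everywhere to spare a case distinction. F 0 = 0 lets lattice sums include the
    origin. *)
Definition tame d F :=
  [/\ F 0 = 0, forall x, x != 0 -> {for x, continuous F} &
      exists A, forall x, x != 0 ->
        `|F x| <= A * `|x| `^ (d - n%:R) /\ `|F x| <= A * `|x| `^ (- (n%:R + 1))].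

Definition step h F x : R := F (lattice_pt h (cell h x)).

Lemma measurable_step h F : 0 < h -> measurable_fun setT (step h F).
Proof. by move=> h0; exact: (measurable_cell_comp (F \o @lattice_pt R n h)). Qed.

Lemma step_cvg (u : nat -> R) F x : (forall k, 0 < u k) -> u @ \oo --> (0 : R) ->
  {for x, continuous F} -> step (u k) F x @[k --> \oo] --> F x.
Proof.
move=> u0 u_cvg Fx.
have : lattice_pt (u k) (cell (u k) x) @[k --> \oo] --> x.
  apply/cvgrPdist_le => e e0; near=> k.
  apply: le_trans (cell_approx _ _) _ => //.
  near: k; move/cvgrPdist_le : u_cvg => /(_ _ e0); apply: filterS => k.
  by rewrite sub0r normrN gtr0_norm.
by move/continuous_cvg; apply.
Unshelve. all: by end_near. Qed.

Lemma step0 h F : step h F 0 = F 0.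
Proof.
rewrite /step /cell scaler0 (_ : map_mx _ _ = 0) ?/lattice_pt ?map_mx0 ?scaler0//.
by apply/rowP => i; rewrite !mxE floor0.
Qed.

(** The sigma-algebra on rows is generated by the coordinates, not by the open sets, so continuity
    alone does not give measurability. Instead F is a pointwise limit of step functions of mesh
    1/(k+1), which are measurable cell by cell; at 0 they are constantly F 0. *)
Lemma continuous_off0_measurable F : (forall x, x != 0 -> {for x, continuous F}) ->
  measurable_fun setT F.
Proof.
move=> cF; apply/measurable_EFinP.
apply: (emeasurable_fun_cvg (fun k => EFin \o step (k.+1%:R^-1) F)).
  by move=> k; apply/measurable_EFinP; apply: measurable_step; rewrite invr_gt0.
move=> x _; apply: cvg_EFin; first by apply: nearW.
have [->|x0] := eqVneq x 0.
  under eq_fun do rewrite /= step0; exact: cvg_cst.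
apply: (@step_cvg (fun k => k.+1%:R^-1)) => //; last exact: cF.
exact: cvg_harmonic.
Qed.

Definition tame_weight d (x : 'rV[R]_n) : \bar R := (far_weight 1 x + near_weight d x)%E.

Lemma integrable_tame_weight d : 0 < d -> mu.-integrable setT (tame_weight d).
Proof.
by move=> d0; apply: integrableD => //; [exact: integrable_far_weight|exact: integrable_near_weight].
Qed.

Lemma tame_weight_ge d F A : d <= n%:R ->
  (forall x, x != 0 -> `|F x| <= A * `|x| `^ (d - n%:R) /\
     `|F x| <= A * `|x| `^ (- (n%:R + 1))) ->
  forall x y, y != 0 -> `|x| <= 2 * `|y| -> (`|F y|%:E <= `|A|%:E * tame_weight d x)%E.
Proof.
move=> dn FA x y y0 xy; have [Fn Ff] := FA _ y0.
have ny0 : 0 < `|y| by rewrite normr_gt0.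
have Aw (t : R) z : 0 <= t -> `|F y| <= A * t -> (t%:E <= z)%E ->
    (`|F y|%:E <= `|A|%:E * z)%E.
  move=> t0 FAt tz; apply: (@le_trans _ _ (`|A| * t)%:E).
    by rewrite lee_fin (le_trans FAt)// ler_wpM2r// ler_norm.
  by rewrite EFinM lee_wpmul2l// lee_fin.
have [y1|y1] := leP 1 `|y|.
  apply: Aw Ff _; first exact: powR_ge0.
  by apply: le_trans (far_weight_ge _ y1 xy) _ => //; rewrite leeDl// near_weight_ge0.
apply: Aw Fn _; first exact: powR_ge0.
apply: (@le_trans _ _ (near_weight d x)).
  by apply: near_weight_ge => //; rewrite ny0 ltW.
by rewrite leeDr// far_weight_ge0.
Qed.

(** Dominated convergence along the meshes h / 2^k. The majorant does not depend on the mesh: the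
    value of F at a nonzero cell corner y is controlled at every x of that cell through |x| <=
    2|y|. *)
Lemma tame_cvg d F h : 0 < d <= n%:R -> 0 < h -> tame d F ->
  [/\ mu.-integrable setT (EFin \o F),
      mu.-integrable setT (EFin \o step h F) &
      (\int[mu]_x step (h / 2 ^+ k) F x) @[k --> \oo] --> \int[mu]_x F x].
Proof.
move=> /andP[d0 dn] h0 [F0 cF [A FA]].
have mF := continuous_off0_measurable cF.
have u0 k : 0 < h / 2 ^+ k by rewrite divr_gt0// exprn_gt0.
have iw : mu.-integrable setT (fun x => `|A|%:E * tame_weight d x)%E.
  by apply: integrableZl => //; exact: integrable_tame_weight.
have dom k x : 0 < k -> (`|(step k F x)%:E| <= `|A|%:E * tame_weight d x)%E.
  move=> k0; rewrite /step; have [->|x0] := eqVneq (cell k x) 0.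
    rewrite /lattice_pt map_mx0 scaler0 F0 abse0 mule_ge0// adde_ge0//.
      exact: far_weight_ge0.
    exact: near_weight_ge0.
  apply: tame_weight_ge => //; first by rewrite lattice_pt_eq0.
  exact: cell_norm_le.
have lim x : step (h / 2 ^+ k) F x @[k --> \oo] --> F x.
  have [->|x0] := eqVneq x 0.
    under eq_fun do rewrite /= step0; exact: cvg_cst.
  apply: (@step_cvg (fun k => h / 2 ^+ k)) => //; last exact: cF.
  rewrite -(mulr0 h); apply: cvgM; first exact: cvg_cst.
  under eq_fun do rewrite -exprVn; apply: cvg_expr.
  by rewrite ger0_norm ?invr_ge0// invf_lt1// ltr1n.
have mstep k : measurable_fun setT (EFin \o step (h / 2 ^+ k) F).
  by apply/measurable_EFinP; exact: measurable_step.
have mEF : measurable_fun setT (EFin \o F) by apply/measurable_EFinP.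
have limE : {ae mu, forall x, setT x ->
    (EFin \o step (h / 2 ^+ k) F) x @[k --> \oo] --> (EFin \o F) x}.
  apply: aeW => x _; apply: cvg_EFin; first exact: nearW.
  exact: lim.
have domE : {ae mu, forall x k, setT x ->
    (`|(EFin \o step (h / 2 ^+ k) F) x| <= `|A|%:E * tame_weight d x)%E}.
  by apply: aeW => x k _; exact: dom.
have [iF _ cvgF] := dominated_convergence measurableT mstep mEF limE iw domE.
split=> //.
  apply: le_integrable iw => //.
    by apply/measurable_EFinP; exact: measurable_step.
  by move=> x _; rewrite (le_trans (dom _ _ h0))// lee_abs.
apply: fine_cvg; rewrite fineK//; exact: integrable_fin_num.
Qed.

End tame.

(** * Absolutely convergent sums over the lattice *)

Section lattice_sum.
Variables (R : realType) (n : nat).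
Local Notation mu := (lebesgue_Rn R n).
Implicit Types (u v : 'rV[int]_n -> R) (h : R) (F : 'rV[R]_n -> R).

Definition lattice_sum u : R := real_sum setT u.

Definition lattice_summable u := summable setT (EFin \o u).

(** As [real_sum] treats positive and negative parts separately, additivity is not immediate. This
    equivalence and [lattice_sum_cell] transport additivity and the triangle inequality from
    integrals of step functions. *)
Lemma integrable_cell h u : 0 < h ->
  mu.-integrable setT (EFin \o (u \o cell h)) <-> lattice_summable u.
Proof.
move=> h0.
have E : (\int[mu]_x `|(EFin \o (u \o cell h)) x| =
    (h ^+ n)%:E * \esum_(b in setT) `|(EFin \o u) b|)%E.
  exact: (ge0_integral_cell (a := fun b => `|(EFin \o u) b|%E)).
have hn0 : 0 < h ^+ n by rewrite exprn_gt0.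
split=> [/integrableP[_]|su].
  rewrite E /lattice_summable /summable.
  have : (0 <= \esum_(b in setT) `|(EFin \o u) b|)%E by exact: esum_ge0.
  case: (\esum_(b in setT) _)%E => [r _ _|_|//]; first exact: ltry.
  by rewrite mulry gtr0_sg// mul1e.
apply/integrableP; split.
  by apply/measurable_EFinP; exact: measurable_cell_comp.
by rewrite E lte_mul_pinfty// lee_fin ltW.
Qed.

Lemma lattice_sum_cell h u : 0 < h -> lattice_summable u ->
  h ^+ n * lattice_sum u = \int[mu]_x u (cell h x).
Proof.
move=> h0 su; rewrite /Rintegral integralE.
have P : (\int[mu]_x (fun x => (u (cell h x))%:E)^\+ x = (h ^+ n)%:E * esum setT (EFin \o u)^\+)%E.
  rewrite (funepos_comp (EFin \o u) (cell h)).
  by apply: (@ge0_integral_cell R n h (EFin \o u)^\+%E h0) => b; exact: funepos_ge0.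
have N : (\int[mu]_x (fun x => (u (cell h x))%:E)^\- x = (h ^+ n)%:E * esum setT (EFin \o u)^\-)%E.
  rewrite (funeneg_comp (EFin \o u) (cell h)).
  by apply: (@ge0_integral_cell R n h (EFin \o u)^\-%E h0) => b; exact: funeneg_ge0.
rewrite {}P {}N.
have pos : esum setT (EFin \o u)^\+%E \is a fin_num.
  rewrite ge0_fin_numE ?esum_ge0//; apply: le_lt_trans (summable_funepos su).
  by apply: le_esum => b _; rewrite lee_abs.
have neg : esum setT (EFin \o u)^\-%E \is a fin_num.
  rewrite ge0_fin_numE ?esum_ge0//; apply: le_lt_trans (summable_funeneg su).
  by apply: le_esum => b _; rewrite lee_abs.
by rewrite -muleBr ?fin_num_adde_defr// fineM ?fin_numB ?pos.
Qed.

Lemma lattice_sumE u : lattice_summable u -> lattice_sum u = \int[mu]_x u (cell 1 x).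
Proof. by move=> su; rewrite -lattice_sum_cell// expr1n mul1r. Qed.

Lemma lattice_summable_le u v : (forall b, `|u b| <= v b) ->
  lattice_summable v -> lattice_summable u.
Proof.
move=> uv; apply: le_lt_trans; apply: le_esum => b _ /=.
by rewrite lee_fin (le_trans (uv b))// ler_norm.
Qed.

Lemma lattice_summableD u v : lattice_summable u -> lattice_summable v ->
  lattice_summable (u \+ v).
Proof. by move=> su sv; have := summableD su sv. Qed.

Lemma lattice_summableZ c u : lattice_summable u -> lattice_summable (c \*o u).
Proof.
move=> /(integrable_cell _ ltr01) su; apply/(integrable_cell _ ltr01).
have /= := integrableZl measurableT c su.
by apply: eq_integrable => // x _ /=; rewrite EFinM.
Qed.

Lemma lattice_sumD u v : lattice_summable u -> lattice_summable v ->
  lattice_sum (u \+ v) = lattice_sum u + lattice_sum v.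
Proof.
move=> su sv; rewrite !lattice_sumE//; last exact: lattice_summableD.
by rewrite -RintegralD//; exact/integrable_cell.
Qed.

Lemma lattice_sumZ c u : lattice_summable u ->
  lattice_sum (c \*o u) = c * lattice_sum u.
Proof.
move=> su; rewrite !lattice_sumE//; last exact: lattice_summableZ.
by rewrite -RintegralZl//; exact/integrable_cell.
Qed.

Lemma lattice_sum_le u v : (forall b, `|u b| <= v b) -> lattice_summable v ->
  `|lattice_sum u| <= lattice_sum v.
Proof.
move=> uv sv; have su := lattice_summable_le uv sv.
have iu : mu.-integrable setT (EFin \o (u \o cell 1)) by exact/integrable_cell.
rewrite !lattice_sumE// (le_trans (le_normr_Rintegral _ iu))//.
apply: le_Rintegral => //; last 2 first.
- exact/integrable_cell.
- by move=> x _; exact: uv.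
apply/(@integrable_cell 1 (fun b => `|u b|))=> //.
by apply: lattice_summable_le sv => b; rewrite normr_id.
Qed.

Lemma lattice_sum_inj u (e : 'rV[int]_n -> 'rV[int]_n) : injective e ->
  lattice_sum (u \o e) = lattice_sum (u \_ (range e)).
Proof.
move=> inj_e; have ie : set_inj setT e by move=> x y _ _; exact: inj_e.
have E (a : 'rV[int]_n -> \bar R) : esum setT (a \o e) = esum setT (a \_ (range e)).
  by rewrite -(esum_image _ _ a ie) esum_mkcond.
rewrite /lattice_sum /real_sum (funepos_comp (EFin \o u) e) (funeneg_comp (EFin \o u) e) !E.
by rewrite -funepos_restrict -funeneg_restrict restrict_EFin.
Qed.

Lemma lattice_summable_inj u (e : 'rV[int]_n -> 'rV[int]_n) : injective e ->
  lattice_summable u -> lattice_summable (u \o e).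
Proof.
move=> inj_e; have ie : set_inj setT e by move=> x y _ _; exact: inj_e.
apply: le_lt_trans; rewrite -(esum_image _ _ (fun b => `|(EFin \o u) b|)%E ie).
rewrite esum_mkcond; apply: le_esum => b _ /=.
by case: ifPn.
Qed.

Lemma lattice_sum_bij u (e : 'rV[int]_n -> 'rV[int]_n) : bijective e ->
  lattice_sum (u \o e) = lattice_sum u.
Proof.
move=> be; rewrite lattice_sum_inj; last exact: bij_inj.
rewrite (_ : range e = setT) ?patch_setT//.
by apply/seteqP; split=> // b _; case: be => f _ fe; exists (f b).
Qed.

Lemma real_sum_punctured u :
  real_sum (~` [set 0]) u = lattice_sum (fun b => if b == 0 then 0 else u b).
Proof.
have E (a : 'rV[int]_n -> \bar R) : esum (~` [set 0]) a =
    esum setT (fun b => if b == 0 then 0%E else a b).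
  rewrite esum_mkcond; apply: eq_esum => b _.
  have [->|/eqP b0] := eqVneq b 0; first by rewrite memNset//=; exact.
  by rewrite mem_set.
rewrite /lattice_sum /real_sum !E; congr (fine (_ - _)%E); apply: eq_esum => b _;
  rewrite ?(funeposE, funenegE) /=; case: ifPn => _ //; by rewrite ?oppr0 /maxe ltxx.
Qed.

Definition decay_weight (e : R) (b : 'rV[int]_n) : R :=
  (1 + `|map_mx intr b : 'rV[R]_n|) `^ (- (n%:R + e)).

Lemma lattice_summable_decay (e : R) : 0 < e -> lattice_summable (decay_weight e).
Proof.
move=> e0; apply/(integrable_cell _ ltr01).
apply: le_integrable (@integrable_far_weight R n e e0) => //.
  by apply/measurable_EFinP; exact: measurable_cell_comp.
move=> x _; rewrite /= ger0_norm ?powR_ge0// gee0_abs ?far_weight_ge0//.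
apply: far_weight_ge => //; first by rewrite lerDl.
rewrite -[x in leLHS](subrK (lattice_pt 1 (cell 1 x))).
rewrite (le_trans (ler_normD _ _))// lattice_norm// mul1r mulrDr mulr1 lerD//.
  by rewrite (le_trans (cell_approx _ _))// ler1n.
by rewrite ler_peMl// ler1n.
Qed.

End lattice_sum.

(** * The quadrature error *)

Section forward_difference.
Variables (R : realType) (V : zmodType).
Implicit Types (f : V -> R) (v x : V).

Definition fdiff v f x : R := f (x + v) - f x.

Lemma iter_fdiff_le (k : nat) v f x (M : R) :
  (forall i, (i <= k)%N -> `|f (x + v *+ i)| <= M) ->
  `|iter k (fdiff v) f x| <= 2 ^+ k * M.
Proof.
elim: k x => [|k IH] x fM /=; first by have := fM 0%N; rewrite mulr0n addr0 expr0 mul1r; apply.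
rewrite exprS -mulrA mulrDl mul1r /fdiff (le_trans (ler_normB _ _))// lerD//; apply: IH => i ik.
  by rewrite -addrA -mulrS; exact: fM.
by apply: fM; exact: leqW.
Qed.

Lemma iter_fdiff_comp (W : zmodType) (p : W -> V) (w : W) f (k : nat) :
  {morph p : x y / x + y} ->
  iter k (fdiff (p w)) f \o p = iter k (fun g y => g (y + w) - g y) (f \o p).
Proof.
move=> pD; elim: k => //= k IH; rewrite -IH.
by apply/funext => y /=; rewrite /fdiff pD.
Qed.

End forward_difference.

(** * Comparison of a lattice with its even sublattice *)

Section coarsening.
Variables (R : realType) (n : nat).
Implicit Types (u w : 'rV[int]_n -> R) (b : 'rV[int]_n).

Definition int_basis (i : 'I_n) : 'rV[int]_n := delta_mx 0 i.

Lemma shift_bij (v : 'rV[int]_n) : bijective (fun b => b + v).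
Proof. by exists (fun b => b - v) => b; rewrite ?addrK ?subrK. Qed.

Lemma fdiff_summable v u : lattice_summable u -> lattice_summable (fdiff v u).
Proof.
move=> su; apply: lattice_summableD.
  exact: (lattice_summable_inj (bij_inj (shift_bij v))).
have := lattice_summableZ (-1) su; congr lattice_summable.
by apply/funext => b /=; rewrite mulN1r.
Qed.

Lemma lattice_summable_norm u : lattice_summable u -> lattice_summable (fun b => `|u b|).
Proof.
by apply: le_lt_trans; apply: le_esum => b _ /=; rewrite normr_id.
Qed.

Lemma lattice_summableM u w (B : R) : (forall b, `|w b| <= B) ->
  lattice_summable u -> lattice_summable (u \* w).
Proof.
move=> wB su; have su' : lattice_summable (fun b => `|u b|).
  exact: lattice_summable_norm.
apply: lattice_summable_le (lattice_summableZ B su') => b /=.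
by rewrite normrM mulrC ler_wpM2r.
Qed.

(* A weight w that changes sign under b |-> b + v turns the shift by v into -1,
   hence the forward difference into -2. *)
Lemma lattice_sum_alternating v u w (B : R) (N : nat) :
  (forall b, `|w b| <= B) -> (forall b, w (b + v) = - w b) -> lattice_summable u ->
  lattice_sum (iter N (fdiff v) u \* w) = (- 2) ^+ N * lattice_sum (u \* w).
Proof.
move=> wB wv; elim: N u => [|N IH] u su; first by rewrite expr0 mul1r.
rewrite iterSr IH; last exact: fdiff_summable.
rewrite exprSr -mulrA; congr (_ * _).
have suw := lattice_summableM wB su.
have E : (fdiff v u \* w) = ((-1) \*o ((u \* w) \o (fun b => b + v))) \+ ((-1) \*o (u \* w)).
  by apply/funext => b /=; rewrite /fdiff wv; ring.
have ssh := lattice_summable_inj (bij_inj (shift_bij v)) suw.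
rewrite E lattice_sumD ?lattice_sumZ//; try exact: lattice_summableZ.
by rewrite lattice_sum_bij; [ring|exact: shift_bij].
Qed.

(** The value is 2^i if the first i coordinates of b are even and 0 otherwise; letting i run from 0
    to n restricts to the even sublattice one coordinate at a time. *)
Definition parity_weight (i : nat) b : R :=
  \prod_(l < n | (l < i)%N) (1 + (-1) ^+ absz (b 0 l)).

Lemma parity_weightS (i : 'I_n) b :
  parity_weight i.+1 b = parity_weight i b * (1 + (-1) ^+ absz (b 0 i)).
Proof.
rewrite /parity_weight (bigD1 i)//= mulrC; congr (_ * _).
by apply: eq_bigl => l; rewrite ltnS ltn_neqAle andbC.
Qed.

Lemma parity_weight0 b : parity_weight 0 b = 1.
Proof. by rewrite /parity_weight big_pred0. Qed.

Lemma parity_weight_n b :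
  parity_weight n b = if `[< range (fun c : 'rV[int]_n => c *+ 2) b >] then 2 ^+ n else 0.
Proof.
rewrite /parity_weight (eq_bigl xpredT); last by move=> i; rewrite ltn_ord.
case: asboolP => [[c _ <-]|nb].
  rewrite -[n in RHS]card_ord -prodr_const; apply: eq_bigr => i _.
  rewrite mulr2n mxE (_ : absz _ = (2 * absz (c ord0 i))%N); last first.
    by rewrite -mulr2n -mulr_natr abszM mulnC.
  by rewrite exprM sqrrN !expr1n.
have [l bl] : exists l : 'I_n, odd (absz (b 0 l)).
  apply/existsP; apply: contra_notT nb => /existsPn nb.
  exists (\row_l (b ord0 l %/ 2)%Z) => //; apply/rowP => l.
  have E : (b ord0 l %/ 2)%Z * 2%Z = b ord0 l.
    by apply: divzK; rewrite dvdzE /= dvdn2; exact: nb.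
  by rewrite mulr2n !mxE -[RHS]E; ring.
by rewrite (bigD1 l)//= -signr_odd bl expr1 subrr mul0r.
Qed.

Lemma parity_weight_le i b : `|parity_weight i b| <= 2 ^+ n.
Proof.
rewrite /parity_weight normr_prod big_mkcond/= -[n in leRHS]card_ord -prodr_const.
apply: ler_prod => l _; case: ifP => _; last by rewrite ler01 ler1n.
rewrite normr_ge0/= (le_trans (ler_normD _ _))//.
by rewrite normr1 normrX normrN1 expr1n.
Qed.

(** The difference of [parity_weight] at i+1 and at i. Its first factor ignores coordinate i, so it
    changes sign under a unit step in direction i. *)
Definition alternating_weight (i : 'I_n) b : R :=
  parity_weight i b * (-1) ^+ absz (b 0 i).

Lemma alternating_weight_le i b : `|alternating_weight i b| <= 2 ^+ n.
Proof.
by rewrite normrM normrX normrN1 expr1n mulr1; exact: parity_weight_le.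
Qed.

Lemma sign_absz_succ (z : int) : (-1) ^+ absz (z + 1) = - (-1) ^+ absz z :> R.
Proof.
case: z => m; first by rewrite -PoszD addn1 !absz_nat exprS mulN1r.
have -> : Negz m + 1 = - m%:Z by rewrite NegzE; lia.
by rewrite NegzE !abszN !absz_nat exprS mulN1r opprK.
Qed.

Lemma alternating_weight_shift i b :
  alternating_weight i (b + int_basis i) = - alternating_weight i b.
Proof.
rewrite /alternating_weight !mxE !eqxx/=. rewrite sign_absz_succ mulrN; congr (- (_ * _)).
rewrite /parity_weight; apply: eq_bigr => l li.
by rewrite !mxE/= (_ : (l == i) = false) ?addr0//; apply: ltn_eqF.
Qed.

(** The parity weights telescope from the constant 1 to 2^n times the indicator of the even
    sublattice. *)
Lemma lattice_sum_even u : lattice_summable u ->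
  2 ^+ n * lattice_sum (u \o (fun b => b *+ 2)) - lattice_sum u =
  \sum_(i < n) lattice_sum (u \* alternating_weight i).
Proof.
move=> su.
have spw i := lattice_summableM (parity_weight_le i) su.
have saw i := lattice_summableM (alternating_weight_le i) su.
have -> : \sum_(i < n) lattice_sum (u \* alternating_weight i) =
    \sum_(0 <= i < n) (lattice_sum (u \* parity_weight i.+1) - lattice_sum (u \* parity_weight i)).
  rewrite big_mkord; apply: eq_bigr => i _; apply/esym/eqP; rewrite subr_eq; apply/eqP.
  rewrite -lattice_sumD//; congr lattice_sum; apply/funext => b /=.
  by rewrite parity_weightS /alternating_weight; ring.
rewrite telescope_sumr//; congr (_ - _); last first.
  by congr lattice_sum; apply/funext => b /=; rewrite parity_weight0 mulr1.
have inj2 : injective (fun b : 'rV[int]_n => b *+ 2).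
  by move=> b c /rowP bc; apply/rowP => i; have := bc i; rewrite !mulr2n !mxE -!mulr2n => /pmulrnI; exact.
rewrite lattice_sum_inj// -lattice_sumZ; last first.
  apply: lattice_summable_le (lattice_summable_norm su) => b /=.
  by rewrite patchE; case: ifP => //; rewrite normr0.
congr lattice_sum; apply/funext => b /=; rewrite parity_weight_n patchE mulrC.
rewrite (_ : `[< _ >] = (b \in range (fun c : 'rV[int]_n => c *+ 2)))//.
by case: ifP => //; rewrite ?mul0r ?mulr0.
Qed.

Lemma coarsening_le u v (N : nat) : lattice_summable u -> lattice_summable v ->
  (forall i b, `|iter N (fdiff (int_basis i)) u b| <= v b) ->
  `|2 ^+ n * lattice_sum (u \o (fun b => b *+ 2)) - lattice_sum u| <=
  n%:R * 2 ^+ n * lattice_sum v.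
Proof.
move=> su sv uv; rewrite lattice_sum_even// (le_trans (ler_norm_sum _ _ _))//.
rewrite -mulrA -[n in n%:R]card_ord -sum1_card natr_sum mulr_suml; apply: ler_sum => i _.
rewrite mul1r -lattice_sumZ//.
have := @lattice_sum_alternating (int_basis i) u _ (2 ^+ n) N
  (alternating_weight_le i) (alternating_weight_shift i) su.
move=> /(congr1 Num.norm); rewrite normrM normrX normrN => E.
(* Each summation by parts gains a factor 1/2; the total gain 2^-N is given away. *)
apply: (@le_trans _ _ (`|2| ^+ N * `|lattice_sum (u \* alternating_weight i)|)).
  by rewrite ler_peMl// exprn_ege1// ger0_norm// ler1n.
rewrite -E; apply: lattice_sum_le; last exact: lattice_summableZ.
by move=> b /=; rewrite normrM mulrC ler_pM// alternating_weight_le.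
Qed.

End coarsening.

Section quadrature.
Variables (R : realType) (n : nat).
Local Notation mu := (lebesgue_Rn R n).
Implicit Types (F : 'rV[R]_n -> R) (h d q A : R) (b : 'rV[int]_n).

Definition trapezoid h F : R := h ^+ n * lattice_sum (F \o @lattice_pt R n h).

Lemma tame_lattice_summable d F h : 0 < d <= n%:R -> 0 < h -> tame d F ->
  lattice_summable (F \o @lattice_pt R n h).
Proof.
move=> d0 h0 tF; have [_ iF _] := tame_cvg d0 h0 tF.
by apply/(integrable_cell _ h0); exact: iF.
Qed.

Lemma trapezoid_cvg d F h : 0 < d <= n%:R -> 0 < h -> tame d F ->
  trapezoid (h / 2 ^+ k) F @[k --> \oo] --> \int[mu]_x F x.
Proof.
move=> d0 h0 tF; have [_ _] := tame_cvg d0 h0 tF.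
rewrite (_ : (fun k => trapezoid (h / 2 ^+ k) F) =
  fun k => \int[mu]_x step (h / 2 ^+ k) F x)//.
apply/funext => k.
have hk0 : 0 < h / 2 ^+ k by rewrite divr_gt0// exprn_gt0.
by rewrite /trapezoid lattice_sum_cell//; exact: tame_lattice_summable tF.
Qed.

Lemma lattice_ptD h : {morph @lattice_pt R n h : x y / x + y}.
Proof. by move=> x y; rewrite /lattice_pt map_mxD scalerDr. Qed.

Lemma lattice_pt_basis h (i : 'I_n) : lattice_pt h (int_basis i) = h *: ebasis R i.
Proof. by rewrite /lattice_pt /int_basis map_delta_mx. Qed.

Lemma iter_fdiff_lattice h F (i : 'I_n) (N : nat) b :
  iter N (fdiff (int_basis i)) (F \o @lattice_pt R n h) b =
  iter N (fdiff (h *: ebasis R i)) F (lattice_pt h b).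
Proof.
have := iter_fdiff_comp (int_basis i) F N (lattice_ptD h).
by rewrite lattice_pt_basis => /(congr1 (@^~ b)).
Qed.

(** The discrete form of |d_j^N F| <= A |x|^(q-n-N) along segments that keep the distance rho from
    the origin. *)
Definition diff_bound (N : nat) q A F := forall (j : 'I_n) x (tau rho : R),
  0 < tau -> 0 < rho ->
  (forall t, 0 <= t <= N%:R * tau -> rho <= `|x + t *: ebasis R j|) ->
  `|iter N (fdiff (tau *: ebasis R j)) F x| <= A * tau ^+ N * rho `^ (q - n%:R - N%:R).

Lemma norm_ebasis_le (j : 'I_n) : `|ebasis R j| <= 1.
Proof.
apply: row_norm_le => // i; rewrite mxE; case: (_ && _); by rewrite ?normr1 ?normr0.
Qed.

Variables (q : R) (N : nat).
Hypotheses (q_gt0 : 0 < q) (qN : q < N%:R).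

(** For |b| >= 2N the segment keeps the distance |b|/2 >= (1+|b|)/4 in units of tau, whence the base
    1/4. The factors of [near_const] serve |b| < 2N: 2^N comes from expanding the difference, the
    middle factor bounds |b'|^(q-n) over 1 <= |b'| <= 3N for either sign of q - n, and the last one
    undoes the decay weight. *)
Let far_const : R := 4^-1 `^ (q - n%:R - N%:R).
Let near_const : R :=
  2 ^+ N * (1 + (3 * N%:R) `^ (q - n%:R)) * (1 + 2 * N%:R) `^ (n%:R + N%:R - q).

(** If |b| >= 2N, the N steps of length tau stay at distance tau |b|/2 from the origin and
    [diff_bound] applies. Otherwise the difference is expanded and each value estimated by size,
    with the origin contributing 0. *)
Lemma lattice_fdiff_bound F A (tau : R) (i : 'I_n) b : 0 <= A -> 0 < tau -> F 0 = 0 ->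
  (forall x, x != 0 -> `|F x| <= A * `|x| `^ (q - n%:R)) ->
  diff_bound N q A F ->
  `|iter N (fdiff (int_basis i)) (F \o @lattice_pt R n tau) b| <=
  (far_const + near_const) * (A * tau `^ (q - n%:R)) * decay_weight (N%:R - q) b.
Proof.
move=> A0 t0 F0 FA dF.
have N0 : 0 < N%:R :> R by exact: (lt_trans q_gt0 qN).
have n0 : 0 <= n%:R :> R by exact: ler0n.
set nb := `|map_mx intr b : 'rV[R]_n|; have nb0 : 0 <= nb by exact: normr_ge0.
have fc0 : 0 <= far_const by exact: powR_ge0.
have nc0 : 0 <= near_const.
  by rewrite !mulr_ge0 ?powR_ge0 ?exprn_ge0// addr_ge0// powR_ge0.
have tq0 : 0 <= A * tau `^ (q - n%:R) by rewrite mulr_ge0// powR_ge0.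
have dw0 : 0 <= decay_weight (N%:R - q) b by exact: powR_ge0.
have [far|near] := leP (2 * N%:R) nb.
  have nb1 : 1 <= nb.
    apply: le_trans far; rewrite -natrM ler1n.
    by move: N0; rewrite ltr0n; case: (N).
  apply: (@le_trans _ _ (far_const * (A * tau `^ (q - n%:R)) * decay_weight (N%:R - q) b)); last first.
    by do 2 (apply: ler_wpM2r => //); rewrite lerDl.
  rewrite iter_fdiff_lattice (le_trans (dF i _ tau (tau * (nb / 2)) _ _ _))//.
  - by rewrite mulr_gt0// divr_gt0//; lra.
  - move=> t /andP[t1 t2]; rewrite -[leRHS]opprK.
    have : `|lattice_pt tau b| <= `|lattice_pt tau b + t *: ebasis R i| + t.
      rewrite -[X in `|X| <= _](addrK (t *: ebasis R i)).
      rewrite (le_trans (ler_normB _ _))// lerD2l normrZ ger0_norm// ler_piMr//.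
      exact: norm_ebasis_le.
    rewrite lattice_norm// -/nb opprK => H.
    have : tau * N%:R <= tau * (nb / 2) by rewrite ler_pM2l//; lra.
    by move: t2; rewrite mulrC; lra.
  have s0 : q - n%:R - N%:R <= 0 by rewrite subr_le0 lerBlDr (le_trans (ltW qN))// lerDl.
  rewrite powRM ?(ltW t0)//; last by rewrite divr_ge0.
  rewrite (_ : A * tau ^+ N * (_ * _) =
      A * tau `^ (q - n%:R) * (nb / 2) `^ (q - n%:R - N%:R)); last first.
    rewrite -powR_mulrn ?ltW// mulrA; congr (_ * _); rewrite -mulrA -powRD_gt0//.
    by congr (_ * _ `^ _); ring.
  rewrite (mulrC far_const) -[leRHS]mulrA ler_wpM2l//.
  have -> : decay_weight (N%:R - q) b = (1 + nb) `^ (q - n%:R - N%:R).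
    by congr (_ `^ _); ring.
  rewrite -powRM; [|lra|lra].
  by apply: powR_le_neg => //; lra.
have pt (k : nat) : (k <= N)%N ->
    `|(F \o @lattice_pt R n tau) (b + int_basis i *+ k)| <=
    A * tau `^ (q - n%:R) * (1 + (3 * N%:R) `^ (q - n%:R)).
  move=> kN; set b' := b + _; rewrite /=.
  have M0 : 0 <= A * tau `^ (q - n%:R) * (1 + (3 * N%:R) `^ (q - n%:R)).
    by rewrite mulr_ge0// addr_ge0// powR_ge0.
  have [->|b'0] := eqVneq b' 0; first by rewrite /lattice_pt map_mx0 scaler0 F0 normr0.
  rewrite (le_trans (FA _ _)) ?lattice_pt_eq0// lattice_norm//.
  have b'1 := int_norm_ge1 R b'0; set nb' := `|map_mx _ _| in b'1 *.
  rewrite powRM ?(ltW t0)//; last by exact: le_trans b'1.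
  rewrite mulrA ler_wpM2l//.
  have nb'3 : nb' <= 3 * N%:R.
    have : nb' <= nb + k%:R.
      rewrite /nb' map_mxD (le_trans (ler_normD _ _))// lerD2l.
      have -> : map_mx intr (int_basis i *+ k) = k%:R *: ebasis R i.
        by rewrite raddfMn /= /int_basis map_delta_mx scaler_nat.
      by rewrite normrZ ger0_norm// ler_piMr// norm_ebasis_le.
    have : k%:R <= N%:R :> R by rewrite ler_nat.
    by move: near; lra.
  have [qn|qn] := leP 0 (q - n%:R).
    apply: (@le_trans _ _ ((3 * N%:R) `^ (q - n%:R))); last by rewrite lerDr.
    by rewrite ge0_ler_powR// nnegrE; lra.
  apply: (@le_trans _ _ 1); last by rewrite lerDl powR_ge0.
  rewrite [leRHS](_ : 1 = 1 `^ (q - n%:R)); last by rewrite powR1.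
  by apply: powR_le_neg => //; exact: ltW.
rewrite (le_trans (iter_fdiff_le pt))//.
apply: (@le_trans _ _ (near_const * (A * tau `^ (q - n%:R)) * decay_weight (N%:R - q) b)); last first.
  by do 2 (apply: ler_wpM2r => //); rewrite lerDr.
rewrite /near_const -!mulrA ler_pM2l ?exprn_gt0// mulrCA.
rewrite [leRHS](_ : _ = A * (tau `^ (q - n%:R) * (1 + (3 * N%:R) `^ (q - n%:R))) *
   ((1 + 2 * N%:R) `^ (n%:R + N%:R - q) * decay_weight (N%:R - q) b)); last by ring.
rewrite mulrCA [leLHS](_ : _ = A * (tau `^ (q - n%:R) * (1 + (3 * N%:R) `^ (q - n%:R)))); last by ring.
rewrite ler_peMr//; first by rewrite !mulr_ge0// ?powR_ge0// addr_ge0// powR_ge0.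
have -> : decay_weight (N%:R - q) b = (1 + nb) `^ (- (n%:R + N%:R - q)).
  by congr (_ `^ _); ring.
rewrite powRN -ler_pdivrMr ?invr_gt0 ?powR_gt0//; try lra.
rewrite invrK mul1r; apply: ge0_ler_powR.
- by rewrite subr_ge0 (le_trans (ltW qN))// lerDr.
- by rewrite nnegrE addr_ge0.
- by rewrite nnegrE addr_ge0// mulr_ge0.
by rewrite lerD2l ltW.
Qed.

Let halving_const : R :=
  n%:R * 2 ^+ n * (far_const + near_const) * lattice_sum (@decay_weight R n (N%:R - q)).

Let halving_const_ge0 : 0 <= halving_const.
Proof.
rewrite !mulr_ge0 ?exprn_ge0 ?addr_ge0 ?powR_ge0//.
  by rewrite !mulr_ge0 ?exprn_ge0 ?addr_ge0 ?powR_ge0.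
apply: le_trans (normr_ge0 (lattice_sum (fun=> 0 : R))) _.
apply: lattice_sum_le => [b|]; first by rewrite normr0 powR_ge0.
by apply: lattice_summable_decay; rewrite subr_gt0.
Qed.

(** The lattice of mesh h is the even sublattice of the one of mesh h/2. The prefactor (h/2)^n and
    the bound (h/2)^(q-n) on the differences combine to (h/2)^q. *)
Lemma trapezoid_halving d F A h : 0 < d <= n%:R -> tame d F -> 0 <= A -> 0 < h ->
  (forall x, x != 0 -> `|F x| <= A * `|x| `^ (q - n%:R)) ->
  diff_bound N q A F ->
  `|trapezoid h F - trapezoid (h / 2) F| <= halving_const * A * (h / 2) `^ q.
Proof.
move=> d0 tF A0 h0 FA dF.
have t0 : 0 < h / 2 by rewrite divr_gt0.
have F0 : F 0 = 0 by case: tF.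
pose w b : R := (far_const + near_const) * (A * (h / 2) `^ (q - n%:R)) * decay_weight (N%:R - q) b.
have sd : lattice_summable (@decay_weight R n (N%:R - q)).
  by apply: lattice_summable_decay; rewrite subr_gt0.
have su := tame_lattice_summable d0 t0 tF.
have := coarsening_le su (lattice_summableZ _ sd)
  (fun i b => lattice_fdiff_bound i b A0 t0 F0 FA dF).
rewrite lattice_sumZ// => H.
have -> : trapezoid h F = (h / 2) ^+ n * (2 ^+ n *
    lattice_sum ((F \o @lattice_pt R n (h / 2)) \o (fun b => b *+ 2))).
  rewrite mulrA -exprMn divfK//; congr (_ * lattice_sum _).
  apply/funext => b /=; congr F; rewrite mulr2n lattice_ptD.
  by rewrite /lattice_pt -scalerDl -splitr.
rewrite /trapezoid -mulrBr normrM gtr0_norm ?exprn_gt0//.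
apply: (le_trans (ler_wpM2l _ H)); first by rewrite exprn_ge0// ltW.
have -> : (h / 2) `^ q = (h / 2) ^+ n * (h / 2) `^ (q - n%:R).
  by rewrite -powR_mulrn ?ltW// -powRD_gt0//; congr (_ `^ _); ring.
rewrite -subr_ge0 [leRHS](_ : _ = 0)//; rewrite /halving_const; ring.
Qed.

(** The errors of the successive halvings form a geometric series of ratio 2^-q, which converges as
    q > 0. C is chosen before d, F and A; the exponent d secures convergence of the rule and may
    differ from the rate q. *)
Theorem quadrature_error : exists2 C : R, 0 <= C & forall d F A,
  0 < d <= n%:R -> tame d F -> 0 <= A ->
  (forall x, x != 0 -> `|F x| <= A * `|x| `^ (q - n%:R)) ->
  diff_bound N q A F ->
  forall h, 0 < h -> `|trapezoid h F - \int[mu]_x F x| <= C * A * h `^ q.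
Proof.
pose z : R := 2 `^ (- q).
have z1 : z < 1 by have := powR2N_lt1 q_gt0; rewrite ger0_norm// powR_ge0.
have z0 : 0 <= z by exact: powR_ge0.
exists (halving_const / (1 - z)).
  by rewrite divr_ge0// subr_ge0 ltW.
move=> d F A d0 tF A0 FA dF h h0.
pose D := halving_const * A * h `^ q.
have D0 : 0 <= D by rewrite mulr_ge0 ?powR_ge0//; exact: mulr_ge0.
have step k : `|trapezoid h F - trapezoid (h / 2 ^+ k) F| <= D / (1 - z) * (1 - z ^+ k).
  elim: k => [|k IH]; first by rewrite expr0 divr1 !subrr normr0 mulr0.
  have hk0 : 0 < h / 2 ^+ k by rewrite divr_gt0// exprn_gt0.
  rewrite -[X in `|X|](subrKA (trapezoid (h / 2 ^+ k) F)).
  rewrite (le_trans (ler_normD _ _))//.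
  have -> : D / (1 - z) * (1 - z ^+ k.+1) = D / (1 - z) * (1 - z ^+ k) + D * z ^+ k.
    by rewrite exprS; field; rewrite subr_eq0 (gt_eqF z1).
  have -> : h / 2 ^+ k.+1 = h / 2 ^+ k / 2 by rewrite exprSr invfM mulrA.
  rewrite lerD// (le_trans (trapezoid_halving d0 tF A0 hk0 FA dF))//.
  have zE : z = 2^-1 `^ q.
    by rewrite /z -[in RHS]powR_inv1// -powRrM mulN1r.
  rewrite /D -[leRHS]mulrA; apply: ler_wpM2l; first exact: mulr_ge0.
  rewrite zE -powR_pexp ?invr_ge0// -powRM ?exprn_ge0 ?invr_ge0 ?(ltW h0)// exprVn.
  apply: ge0_ler_powR; rewrite ?nnegrE ?ltW// ?divr_gt0//.
  by rewrite ltr_pdivrMr// mulr_natr mulr2n ltrDl.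
have cv : `|trapezoid h F - trapezoid (h / 2 ^+ k) F| @[k --> \oo] -->
    `|trapezoid h F - \int[mu]_x F x|.
  apply: cvg_norm; apply: cvgB; first exact: cvg_cst.
  exact: trapezoid_cvg d0 h0 tF.
rewrite -(cvg_lim _ cv)//; apply: limr_le; first by apply/cvg_ex; eexists; exact: cv.
apply: nearW => k; apply: le_trans (step k) _.
rewrite (_ : _ * A * _ = D / (1 - z)); last by rewrite /D; ring.
rewrite ler_piMr ?divr_ge0 ?subr_ge0 ?(ltW z1)//.
by rewrite lerBlDr lerDl exprn_ge0.
Qed.

End quadrature.

(** * Bounds on iterated derivatives *)

Section directional_derivative.
Variables (R : realType) (V : normedModType R).
Implicit Types (f g : V -> R) (x y v : V) (d : R).

Lemma is_derive_quotientP f x v d : is_derive x v f d <->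
  h^-1 *: (f (h *: v + x) - f x) @[h --> (0 : R)^'] --> d.
Proof.
split=> [[df <-]|cvd]; first exact: df.
apply: DeriveDef; first by apply/cvg_ex; exists d.
exact: (cvg_lim _ cvd).
Qed.

End directional_derivative.

Section derivative_along_lines.
Variables (R : realType) (V : normedModType R).
Implicit Types (f g : V -> R) (x y v : V) (d : R).

Lemma is_derive_translate f x y v d : is_derive (x + y) v f d ->
  is_derive x v (fun z => f (z + y)) d.
Proof.
move=> /is_derive_quotientP df; apply/is_derive_quotientP.
by under eq_fun do rewrite -addrA.
Qed.

Lemma is_derive_line f x v (t : R) d : is_derive (x + t *: v) v f d ->
  is_derive t 1 (fun s : R => f (x + s *: v)) d.
Proof.
move=> /is_derive_quotientP df; apply/is_derive_quotientP.
under eq_fun => h.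
  rewrite (_ : x + (h *: 1 + t) *: v = h *: v + (x + t *: v)); first over.
  by rewrite [h *: 1]mulr1 scalerDl addrCA.
exact: df.
Qed.

Lemma is_derive_from_line f x v d :
  is_derive (0 : R) 1 (fun s : R => f (x + s *: v)) d -> is_derive x v f d.
Proof.
move=> /is_derive_quotientP df; apply/is_derive_quotientP.
apply: cvg_trans df; apply: near_eq_cvg; apply: nearW => h.
by rewrite /= [h *: 1]mulr1 !addr0 scale0r addr0 [h *: v + x]addrC.
Qed.

Lemma is_derive_homothety f x v (l d : R) : is_derive (l *: x) v f d ->
  is_derive x v (fun z => f (l *: z)) (l * d).
Proof.
move=> df; apply: is_derive_from_line.
have df0 : is_derive (l *: x + 0 *: v) v f d by rewrite scale0r addr0.
have dl := is_derive_line df0.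
have dm : is_derive (0 : R) 1 (fun s : R => l * s) l.
  have := @is_deriveZ _ _ _ id l (0 : R) 1 1 (is_derive_id _ _). by rewrite [_ *: _]mulr1.
have dl' : is_derive (l * 0) 1 (fun s : R => f (l *: x + s *: v)) d by rewrite mulr0.
rewrite (_ : (fun s => _) = (fun s => f (l *: x + s *: v)) \o (fun s => l * s)).
  by apply: is_derive_eq (is_derive1_comp dl' dm) _; rewrite mulrC.
by apply/funext => s /=; rewrite scalerDr scalerA.
Qed.

Lemma is_derive_segment_continuous f f' x v (a b : R) :
  (forall t, a <= t <= b -> is_derive (x + t *: v) v f (f' (x + t *: v))) ->
  {within `[a, b], continuous (fun s : R => f (x + s *: v))}.
Proof.
move=> df; apply: derivable_within_continuous => t; rewrite in_itv => /df.
by move=> /is_derive_line[].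
Qed.

Lemma mean_value_line f f' x v (a b : R) : a <= b ->
  (forall t, a <= t <= b -> is_derive (x + t *: v) v f (f' (x + t *: v))) ->
  exists2 c, a <= c <= b &
    f (x + b *: v) - f (x + a *: v) = f' (x + c *: v) * (b - a).
Proof.
move=> ab df.
have := @MVT_segment R (fun s => f (x + s *: v)) (fun s => f' (x + s *: v)) a b ab.
case; first by move=> t /itvP tab; apply/is_derive_line/df; rewrite !tab.
  exact: is_derive_segment_continuous df.
by move=> c; rewrite in_itv => cab E; exists c.
Qed.

Lemma is_derive_open_eq (U : set V) f g x v d : open U -> U x ->
  (forall y, U y -> f y = g y) -> is_derive x v f d -> is_derive x v g d.
Proof.
move=> oU Ux fg; apply: near_eq_is_derive; near=> y; apply: fg.
by near: y; exact: open_nbhs_nbhs.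
Unshelve. all: by end_near. Qed.

End derivative_along_lines.

(** * Calculus of power bounds on pure derivatives *)

Section power_bounds.
Variables (R : realType) (n : nat).
Implicit Types (U W : set 'rV[R]_n) (u v F : 'rV[R]_n -> R) (a b C : R) (j : 'I_n).

(** One constant serves all orders k <= N, with exponent a - k. The derivatives are existential
    witnesses rather than iterated ['D], so that the rules of calculus can supply closed forms. *)
Fixpoint derive_bound U j (N : nat) a C u : Prop :=
  (forall x, U x -> `|u x| <= C * `|x| `^ a) /\
  match N with
  | 0 => True
  | N'.+1 => exists2 u', (forall x, U x -> is_derive x (ebasis R j) u (u' x)) &
                         derive_bound U j N' (a - 1) C u'
  end.

Lemma derive_bound_norm U j N a C u : derive_bound U j N a C u ->
  forall x, U x -> `|u x| <= C * `|x| `^ a.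
Proof. by case: N => [|N] []. Qed.

Lemma derive_bound_pred U j N a C u : derive_bound U j N.+1 a C u ->
  derive_bound U j N a C u.
Proof.
elim: N a u => [|N IH] a u [ub [u' du bu']]; first by split.
by split=> //; exists u' => //; exact: IH.
Qed.

Lemma derive_bound_leq U j N M a C u : (M <= N)%N -> derive_bound U j N a C u ->
  derive_bound U j M a C u.
Proof.
move=> MN; rewrite -(subnK MN); elim: (N - M)%N => [//|k IH] bu.
by apply: IH; exact: derive_bound_pred.
Qed.

Lemma derive_bound_sub U W j N a C u : W `<=` U -> derive_bound U j N a C u ->
  derive_bound W j N a C u.
Proof.
move=> WU; elim: N a u => [|N IH] a u /= [ub H]; split=> //; try by move=> x /WU; exact: ub.
by case: H => u' du bu'; exists u' => [x /WU Ux|]; [exact: du|exact: IH].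
Qed.

Lemma derive_bound_le U j N a C C' u : C <= C' -> derive_bound U j N a C u ->
  derive_bound U j N a C' u.
Proof.
move=> CC'; have H x b : C * `|x : 'rV[R]_n| `^ b <= C' * `|x| `^ b.
  by rewrite ler_wpM2r// powR_ge0.
elim: N a u => [|N IH] a u /= [ub Hu]; split=> //;
  try by move=> x Ux; exact: le_trans (ub _ Ux) (H _ _).
by case: Hu => u' du bu'; exists u' => //; exact: IH.
Qed.

Lemma derive_bound_congr U j N a C u v : open U -> (forall x, U x -> u x = v x) ->
  derive_bound U j N a C u -> derive_bound U j N a C v.
Proof.
move=> oU uv; case: N => [|N] [ub Hu]; split=> //;
  try by move=> x Ux; rewrite -uv//; exact: ub.
case: Hu => u' du bu'; exists u' => // x Ux.
exact: (is_derive_open_eq oU Ux uv (du _ Ux)).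
Qed.

(** The witnesses on U and on W may be different functions, but each agrees on its own set with the
    partial derivative ['D] of u, which becomes the common witness. *)
Lemma derive_bound_union U W j N a C u : open U -> open W ->
  derive_bound U j N a C u -> derive_bound W j N a C u ->
  derive_bound (U `|` W) j N a C u.
Proof.
move=> oU oW; elim: N a u => [|N IH] a u /= [ub Hu] [wb Hw].
  by split=> // x [Ux|Wx]; [exact: ub|exact: wb].
split=> [x [Ux|Wx]|]; [exact: ub|exact: wb|].
case: Hu => u' du bu'; case: Hw => w' dw bw'.
have eqU x : U x -> u' x = 'D_(ebasis R j) u x.
  by move=> Ux; have [_ <-] := du _ Ux.
have eqW x : W x -> w' x = 'D_(ebasis R j) u x.
  by move=> Wx; have [_ <-] := dw _ Wx.
exists ('D_(ebasis R j) u).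
  by move=> x [Ux|Wx]; apply: derivableP; [have [] := du _ Ux|have [] := dw _ Wx].
apply: IH; [exact: derive_bound_congr bu'|exact: derive_bound_congr bw'].
Qed.

Lemma derive_boundD U j N a C1 C2 u v : derive_bound U j N a C1 u ->
  derive_bound U j N a C2 v -> derive_bound U j N a (C1 + C2) (fun x => u x + v x).
Proof.
have H x (b c1 c2 p q : R) : `|p| <= c1 * `|x : 'rV[R]_n| `^ b -> `|q| <= c2 * `|x| `^ b ->
    `|p + q| <= (c1 + c2) * `|x| `^ b.
  by move=> pc qc; rewrite (le_trans (ler_normD _ _))// mulrDl lerD.
elim: N a u v => [|N IH] a u v /= [ub Hu] [vb Hv]; split=> //;
  try by move=> x Ux; apply: H; [exact: ub|exact: vb].
case: Hu => u' du bu'; case: Hv => v' dv bv'.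
exists (fun x => u' x + v' x); last exact: IH.
by move=> x Ux; have := du _ Ux; have := dv _ Ux => ? ?; exact: is_deriveD.
Qed.

(** By the product rule each differentiation doubles the number of terms, whence 2^N. *)
Lemma derive_boundM (U : set 'rV[R]_n) j N a b C1 C2 u v :
  (forall x, U x -> x != 0) -> 0 <= C1 -> 0 <= C2 ->
  derive_bound U j N a C1 u -> derive_bound U j N b C2 v ->
  derive_bound U j N (a + b) (2 ^+ N * (C1 * C2)) (fun x => u x * v x).
Proof.
move=> U0 C10 C20.
have H x (a' b' p q : R) : U x -> `|p| <= C1 * `|x| `^ a' -> `|q| <= C2 * `|x| `^ b' ->
    `|p * q| <= C1 * C2 * `|x| `^ (a' + b').
  move=> Ux pc qc; rewrite normrM powRD_gt0 ?normr_gt0 ?U0//.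
  by rewrite mulrACA ler_pM.
elim: N a b u v => [|N IH] a b u v; rewrite ?expr0 ?mul1r => bu bv.
  by split=> // x Ux; apply: H; [|case: bu => + _; apply|case: bv => + _; apply].
split=> [x Ux|].
  apply: le_trans (_ : C1 * C2 * `|x| `^ (a + b) <= _).
    by apply: H; [|exact: (derive_bound_norm bu)|exact: (derive_bound_norm bv)].
  by rewrite ler_wpM2r ?powR_ge0// ler_peMl ?mulr_ge0// exprn_ege1// ler1n.
case: (bu) => _ [u' du bu']; case: (bv) => _ [v' dv bv'].
exists (fun x => u x * v' x + v x * u' x).
  by move=> x Ux; have := du _ Ux; have := dv _ Ux => ? ?; exact: is_deriveM.
have -> : 2 ^+ N.+1 * (C1 * C2) = 2 ^+ N * (C1 * C2) + 2 ^+ N * (C1 * C2).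
  by rewrite exprS; ring.
apply: derive_boundD.
  by rewrite -addrA; apply: IH => //; exact: derive_bound_pred.
rewrite (_ : (fun x => v x * u' x) = fun x => u' x * v x); last first.
  by apply/funext => x; rewrite mulrC.
by rewrite addrAC; apply: IH => //; exact: derive_bound_pred.
Qed.

Lemma derive_bound0 U j N a C : 0 <= C -> derive_bound U j N a C (fun=> 0).
Proof.
move=> C0; elim: N a => [|N IH] a /=; split=> //;
  try by move=> x _; rewrite normr0 mulr_ge0// powR_ge0.
by exists (fun=> 0) => // x _; exact: is_derive_cst.
Qed.

Lemma derive_bound_cst U j N (c : R) : derive_bound U j N 0 `|c| (fun=> c).
Proof.
case: N => [|N] /=; split=> //;
  try by move=> x _; rewrite powRr0 mulr1.
exists (fun=> 0); last exact: derive_bound0.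
by move=> x _; exact: is_derive_cst.
Qed.

Lemma derive_boundZ U j N a C (c : R) u : derive_bound U j N a C u ->
  derive_bound U j N a (`|c| * C) (fun x => c * u x).
Proof.
elim: N a u => [|N IH] a u /= [ub Hu]; split=> //;
  try by move=> x Ux; rewrite normrM -mulrA ler_wpM2l// ub.
case: Hu => u' du bu'; exists (fun x => c * u' x); last exact: IH.
by move=> x Ux; have := du _ Ux => ?; exact: is_deriveZ.
Qed.

Lemma is_derive_coord (i j : 'I_n) (x : 'rV[R]_n) :
  is_derive x (ebasis R j) (fun y : 'rV[R]_n => y 0 i) (i == j)%:R.
Proof.
apply: is_derive_from_line.
have -> : (fun s : R => (x + s *: ebasis R j) 0 i) = cst (x 0 i) + (i == j)%:R \*: id.
  by apply/funext => s; rewrite !mxE eqxx/= mulrC.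

by apply: is_derive_eq; rewrite add0r [_ *: _]mulr1.
Qed.

Lemma derive_bound_coord U j N (i : 'I_n) : derive_bound U j N 1 1 (fun x => x 0 i).
Proof.
case: N => [|N] /=; split=> //;
  try by move=> x _; rewrite powRr1// mul1r ler_norm_coord.
exists (fun=> (i == j)%:R); first by move=> x _; exact: is_derive_coord.
rewrite subrr; apply: derive_bound_le (derive_bound_cst _ _ _ _).
by case: (i == j); rewrite ?normr1 ?normr0.
Qed.

Lemma derive_bound_weaken U j N a b C (K : R) u : (forall x, U x -> x != 0) -> 0 <= C ->
  (forall x, U x -> `|x| `^ (a - b) <= K) ->
  derive_bound U j N a C u -> derive_bound U j N b (C * K) u.
Proof.
move=> U0 C0; have H x (p a' b' : R) : U x -> `|x| `^ (a' - b') <= K -> `|p| <= C * `|x| `^ a' ->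
    `|p| <= C * K * `|x| `^ b'.
  move=> Ux xK /le_trans; apply; rewrite -mulrA ler_wpM2l//.
  rewrite -[a'](subrK b') powRD_gt0 ?normr_gt0 ?U0//.
  by rewrite ler_wpM2r// powR_ge0.
elim: N a b u => [|N IH] a b u UK /= [ub Hu]; split=> //;
  try by move=> x Ux; exact: (H x _ a b Ux (UK _ Ux) (ub _ Ux)).
case: Hu => u' du bu'; exists u' => //; apply: IH bu' => x Ux.
by rewrite opprB addrA subrK; exact: UK.
Qed.

(** The chain rule gives a factor l per derivative, which compensates the drop of the exponent by
    one; hence l^a at every order. *)
Lemma derive_bound_homothety U j N a C (l : R) u : 0 < l ->
  (forall x, U x -> U (l *: x)) -> derive_bound U j N a C u ->
  derive_bound U j N a (C * l `^ a) (fun x => u (l *: x)).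
Proof.
move=> l0 Ul; have H x (p a' : R) : `|p| <= C * `|l *: x : 'rV[R]_n| `^ a' ->
    `|p| <= C * l `^ a' * `|x| `^ a'.
  by rewrite normrZ gtr0_norm// powRM ?(ltW l0)// mulrA.
elim: N a u => [|N IH] a u /= [ub Hu]; split=> //;
  try by move=> x Ux; apply: H; apply: ub; exact: Ul.
case: Hu => u' du bu'; exists (fun x => l * u' (l *: x)).
  by move=> x Ux; apply: is_derive_homothety; apply: du; exact: Ul.
have := derive_boundZ l (IH _ _ bu'); apply: derive_bound_le.
have E : l * l `^ (a - 1) = l `^ a.
  by rewrite -{1}(powRr1 (ltW l0)) -powRD_gt0// addrC subrK.
by rewrite gtr0_norm// mulrCA E.
Qed.

Lemma derive_bound_iter U j N a C u : Ck_on U N u ->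
  (forall k x, (k <= N)%N -> U x ->
    `|iter k (fun v => 'D_(ebasis R j) v) u x| <= C * `|x| `^ (a - k%:R)) ->
  derive_bound U j N a C u.
Proof.
elim: N a u => [|N IH] a u /= [cu Hu] ub; split=> //;
  try by move=> x Ux; have := ub 0%N x (leq0n _) Ux; rewrite subr0.
have [du Cu] := Hu j; exists ('D_(ebasis R j) u).
  by move=> x Ux; apply: derivableP; exact: du.
apply: IH => // k x kN Ux; have := ub k.+1 x kN Ux.
rewrite iterSr (_ : a - k.+1%:R = a - 1 - k%:R)//.
by rewrite -natr1; ring.
Qed.

Section differences.
Variable j : 'I_n.

Fixpoint top_derive_bound (S : set 'rV[R]_n) (N : nat) (B : R) u : Prop :=
  match N with
  | 0 => forall y, S y -> `|u y| <= B
  | N'.+1 => exists2 u', (forall y, S y -> is_derive y (ebasis R j) u (u' y)) &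
                         top_derive_bound S N' B u'
  end.

Lemma derive_bound_top U S N a C (B : R) u : S `<=` U ->
  (forall y, S y -> C * `|y| `^ (a - N%:R) <= B) ->
  derive_bound U j N a C u -> top_derive_bound S N B u.
Proof.
move=> SU; elim: N a u => [|N IH] a u SB /= [ub Hu].
  by move=> y Sy; apply: le_trans (ub _ (SU _ Sy)) _; have := SB _ Sy; rewrite subr0.
case: Hu => u' du bu'; exists u'; first by move=> y /SU; exact: du.
apply: IH bu' => y Sy; have := SB y Sy.
by rewrite (_ : a - N.+1%:R = a - 1 - N%:R)//; rewrite -natr1; ring.
Qed.

(** The mean value theorem turns the last derivative into a factor tau; at the other orders
    differencing commutes with differentiation. Each point of S' needs a segment of length tau
    inside S. *)
Lemma top_derive_bound_fdiff S S' (tau B : R) N u : 0 <= tau ->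
  (forall y t, S' y -> 0 <= t <= tau -> S (y + t *: ebasis R j)) ->
  top_derive_bound S N.+1 B u ->
  top_derive_bound S' N (B * tau) (fdiff (tau *: ebasis R j) u).
Proof.
move=> t0 SS'; elim: N u => [|N IH] u [u' du].
  move=> uB y S'y.
  have [c cab E] := @mean_value_line _ _ u u' y (ebasis R j) 0 tau t0
    (fun t tab => du _ (SS' y t S'y tab)).
  rewrite /fdiff; move: E; rewrite scale0r addr0 subr0 => ->.
  by rewrite normrM (ger0_norm t0) ler_wpM2r// uB//; exact: SS'.
move=> Hu'; exists (fdiff (tau *: ebasis R j) u'); last exact: IH.
move=> y S'y; apply: is_deriveB.
  by apply: is_derive_translate; apply: du; apply: SS' => //; rewrite t0 lexx.
by apply: du; have := SS' y 0 S'y; rewrite scale0r addr0 lexx t0; apply.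
Qed.

Lemma iter_fdiff_top_bound (tau B : R) N u x : 0 <= tau ->
  top_derive_bound [set y | exists2 t, 0 <= t <= N%:R * tau & y = x + t *: ebasis R j] N B u ->
  `|iter N (fdiff (tau *: ebasis R j)) u x| <= B * tau ^+ N.
Proof.
move=> t0; elim: N B u => [|N IH] B u; rewrite ?expr0 ?mulr1.
  by move=> uB; apply: uB; exists 0; rewrite ?scale0r ?addr0// mul0r lexx.
move=> Hu; rewrite iterSr exprS mulrA; apply: IH.
apply: top_derive_bound_fdiff Hu => // y t [s /andP[s0 sN] ->] /andP[t1 t2].
exists (s + t); last by rewrite scalerDl addrA.
by rewrite addr_ge0//= -natr1 mulrDl mul1r lerD.
Qed.

End differences.

(** As q - n - N <= 0, the bound on the N-th derivative along the segment is worst at the smallest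
    admissible distance rho. *)
Lemma derive_bound_diff_bound N (q C : R) F : 0 <= C -> q <= n%:R + N%:R ->
  (forall j, derive_bound (~` [set 0]) j N (q - n%:R) C F) -> diff_bound N q C F.
Proof.
move=> C0 qN bF j x tau rho tau0 rho0 xt.
rewrite mulrAC; apply: iter_fdiff_top_bound; first exact: ltW.
apply: derive_bound_top (bF j).
  move=> y [t tN ->] /= xt0; have := xt _ tN.
  by rewrite xt0 normr0 leNgt rho0.
move=> y [t tN ->]; apply: ler_wpM2l => //; apply: powR_le_neg => //; first exact: xt.
by rewrite subr_le0 lerBlDl.
Qed.

End power_bounds.

(** * Compactness, homogeneous functions and mixed partial derivatives *)

Section compact_bounds.
Variables (R : realType) (n : nat).
Implicit Types (u : 'rV[R]_n -> R) (K : set 'rV[R]_n).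

Lemma compact_bound K u : compact K -> (forall x, K x -> {for x, continuous u}) ->
  exists2 M, 0 <= M & forall x, K x -> `|u x| <= M.
Proof.
move=> cK cu; have cuK : compact (u @` K).
  apply: continuous_compact => //; apply: continuous_in_subspaceT => x.
  by rewrite inE; exact: cu.
have [M [_ uM]] := compact_bounded cuK.
exists (`|M| + 1); first by rewrite addr_ge0.
move=> x Kx; apply: (uM (`|M| + 1)) => /=; last by exists x.
by rewrite (le_lt_trans (ler_norm M))// ltrDl.
Qed.

Lemma sup_ball_compact (r : R) : compact (@sup_ball R n r).
Proof.
apply: bounded_closed_compact.
  exists r; split; first exact: num_real.
  by move=> s rs x /= xr; exact: le_trans xr (ltW rs).
rewrite (_ : sup_ball r = (fun x : 'rV[R]_n => `|x|) @^-1` [set s | s <= r])//.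
by apply: closed_comp => // x _; exact: norm_continuous.
Qed.

Lemma sup_sphere_compact (r : R) : compact [set x : 'rV[R]_n | `|x| = r].
Proof.
apply: subclosed_compact (@sup_ball_compact r) _; last by move=> x xr; rewrite /sup_ball /= xr.
rewrite (_ : mkset _ = (fun x : 'rV[R]_n => `|x|) @^-1` [set r])//.
by apply: closed_comp => [x _|]; [exact: norm_continuous|exact: closed_eq].
Qed.

Lemma open_off0 : open (~` [set (0 : 'rV[R]_n)]).
Proof.
apply: closed_openC; apply: accessible_closed_set1.
by apply: hausdorff_accessible; exact: norm_hausdorff.
Qed.

End compact_bounds.

Section Ck_facts.
Variables (R : realType) (n : nat).
Implicit Types (u v f : 'rV[R]_n -> R) (U : set 'rV[R]_n) (i j : 'I_n).
Local Notation "''d_' j" := (fun u => 'D_(ebasis R j) u) (at level 0, j at level 0).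

Lemma Ck_on_continuous U k u x : Ck_on U k u -> U x -> {for x, continuous u}.
Proof. by case: k => [|k] [cu _] /cu. Qed.

Lemma Ck_on_pred U k u : Ck_on U k.+1 u -> Ck_on U k u.
Proof.
elim: k u => [|k IH] u [cu Hu]; first by split.
by split=> // j; have [du Cu] := Hu j; split=> //; exact: IH.
Qed.

Lemma Ck_on_leq U k l u : (l <= k)%N -> Ck_on U k u -> Ck_on U l u.
Proof.
move=> lk; rewrite -(subnK lk); elim: (k - l)%N => // m IH Cu.
by apply: IH; exact: Ck_on_pred.
Qed.

Lemma Ck_on_derive U k u j : Ck_on U k.+1 u -> Ck_on U k ('D_(ebasis R j) u).
Proof. by case=> _ /(_ j)[]. Qed.

Lemma Ck_on_is_derive U k u j x : Ck_on U k.+1 u -> U x ->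
  is_derive x (ebasis R j) u ('D_(ebasis R j) u x).
Proof. by case=> _ /(_ j)[du _] /du; exact: derivableP. Qed.

Lemma Ck_on_iter U k l u j : Ck_on U (k + l) u ->
  Ck_on U k (iter l (fun v => 'D_(ebasis R j) v) u).
Proof.
elim: l u => [|l IH] u; first by rewrite addn0.
by rewrite addnS iterSr => Cu; apply: IH; exact: Ck_on_derive.
Qed.

Lemma homogeneous_bound N (a : R) u : Ck_on (~` [set 0]) N u ->
  (forall t x, 0 < t -> x != 0 -> u (t *: x) = t `^ a * u x) ->
  exists2 M, 0 <= M & forall x, x != 0 -> `|u x| <= M * `|x| `^ a.
Proof.
move=> Cu hu.
have [x /= x1|M M0 uM] := @compact_bound _ _ _ u (@sup_sphere_compact R n 1).
  apply: (Ck_on_continuous Cu) => /= x0; move: x1; rewrite x0 normr0 => /esym/eqP.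
  by rewrite oner_eq0.
exists M => // x x0; have nx0 : 0 < `|x| by rewrite normr_gt0.
rewrite -[x in `|u x|](scalerK (lt0r_neq0 nx0)) scalerA mulrC -scalerA.
have x0' : `|x|^-1 *: x != 0 by rewrite scaler_eq0 invr_eq0 normr_eq0 (negbTE x0).
rewrite hu// normrM ger0_norm ?powR_ge0// mulrC ler_wpM2r ?powR_ge0//.
by apply: uM => /=; rewrite normrZ ger0_norm ?invr_ge0// mulVf// gt_eqF.
Qed.

(** A partial derivative of a function homogeneous of degree a is homogeneous of degree a - 1, so
    compactness of the unit sphere gives the bound at every order. *)
Lemma homogeneous_derive_bound j N (a : R) u : Ck_on (~` [set 0]) N u ->
  (forall t x, 0 < t -> x != 0 -> u (t *: x) = t `^ a * u x) ->
  exists2 C, 0 <= C & derive_bound (~` [set 0]) j N a C u.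
Proof.
elim: N a u => [|N IH] a u Cu hu; have [M M0 uM] := homogeneous_bound Cu hu.
  by exists M => //; split=> // x /eqP; exact: uM.
have [|C C0 bC] := IH (a - 1) ('D_(ebasis R j) u) (Ck_on_derive j Cu).
  move=> t x t0 x0.
  have tx0 : t *: x != 0 by rewrite scaler_eq0 gt_eqF.
  have d1 := is_derive_homothety (Ck_on_is_derive j Cu (elimN eqP tx0)).
  have d2 : is_derive x (ebasis R j) (fun y => u (t *: y)) (t `^ a * 'D_(ebasis R j) u x).
    apply: (is_derive_open_eq (@open_off0 R n) (elimN eqP x0) (f := fun y => t `^ a * u y)).
      by move=> y /eqP y0; rewrite hu.
    have := Ck_on_is_derive j Cu (elimN eqP x0) => ?; exact: is_deriveZ.
  have E : t * 'D_(ebasis R j) u (t *: x) = t `^ a * 'D_(ebasis R j) u x.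
    by have [_ <-] := d1; have [_ <-] := d2.
  apply: (mulfI (lt0r_neq0 t0)); rewrite E mulrA; congr (_ * _).
  by rewrite -{2}(powRr1 (ltW t0)) -powRD_gt0// addrC subrK.
exists (M + C); first exact: addr_ge0.
split=> [x /eqP x0|].
  by rewrite (le_trans (uM _ x0))// ler_wpM2r ?powR_ge0// lerDl.
exists ('D_(ebasis R j) u).
  by move=> x x0; exact: (Ck_on_is_derive j Cu x0).
by apply: derive_bound_le bC; rewrite lerDr.
Qed.

Lemma second_difference u i j x (t : R) : Ck_on setT 2 u -> 0 <= t ->
  exists2 y, `|x - y| <= 2 * t &
    u (x + t *: ebasis R i + t *: ebasis R j) - u (x + t *: ebasis R i) -
    (u (x + t *: ebasis R j) - u x) =
    'D_(ebasis R j) ('D_(ebasis R i) u) y * t ^+ 2.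
Proof.
move=> Cu t0; pose e := ebasis R i; pose e' := ebasis R j.
have [c /andP[c0 ct] Ec] := @mean_value_line _ _ (fun y => u (y + t *: e') - u y)
  (fun y => 'D_e u (y + t *: e') - 'D_e u y) x e 0 t t0
  (fun s _ => is_deriveB (is_derive_translate (Ck_on_is_derive i Cu I))
    (Ck_on_is_derive i Cu I)).
have [c' /andP[c'0 c't] Ec'] := @mean_value_line _ _ ('D_e u) ('D_e' ('D_e u))
  (x + c *: e) e' 0 t t0
  (fun s _ => Ck_on_is_derive j (Ck_on_derive i Cu) I).
exists (x + c *: e + c' *: e').
  rewrite -addrA opprD addrA subrr add0r normrN (le_trans (ler_normD _ _))//.
  rewrite mulrDl mul1r !normrZ !ger0_norm// lerD//.
    by rewrite (le_trans _ ct)// ler_piMr// norm_ebasis_le.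
  by rewrite (le_trans _ c't)// ler_piMr// norm_ebasis_le.
move: Ec Ec'; rewrite !scale0r !addr0 !subr0 => -> ->.
by rewrite expr2 mulrA.
Qed.

(** The second difference is symmetric in v and w, so for every t > 0 a value of A and a value of B,
    both taken within 2t of x, agree. Continuity at x does the rest. *)
Lemma eq_from_second_difference (A B u : 'rV[R]_n -> R) (x v w : 'rV[R]_n) :
  {for x, continuous A} -> {for x, continuous B} ->
  (forall t : R, 0 <= t -> exists2 y, `|x - y| <= 2 * t &
    u (x + t *: v + t *: w) - u (x + t *: v) - (u (x + t *: w) - u x) = A y * t ^+ 2) ->
  (forall t : R, 0 <= t -> exists2 y, `|x - y| <= 2 * t &
    u (x + t *: w + t *: v) - u (x + t *: w) - (u (x + t *: v) - u x) = B y * t ^+ 2) ->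
  A x = B x.
Proof.
move=> cA cB dA dB.
have AB (t : R) : 0 < t -> exists y z, [/\ `|x - y| <= 2 * t, `|x - z| <= 2 * t & A y = B z].
  move=> t0; have t20 : t ^+ 2 != 0 by rewrite expf_neq0// gt_eqF.
  have [y xy Ey] := dA t (ltW t0); have [z xz Ez] := dB t (ltW t0).
  exists y, z; split=> //; apply: (mulIf t20); rewrite -Ey -Ez [x + _ + _]addrAC.
  have sq (p q r s : R) : p - q - (r - s) = p - r - (q - s) by ring.
  exact: sq.
apply/eqP; rewrite -subr_eq0 -normr_le0.
apply/ler_addgt0Pr => e e0; rewrite add0r.
have e2 : 0 < e / 2 by rewrite divr_gt0.
have near_t (f : 'rV[R]_n -> R) : {for x, continuous f} -> exists2 d : R, 0 < d &
    forall y, `|x - y| <= d -> `|f x - f y| <= e / 2.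
  move=> /cvgrPdist_le/(_ _ e2)/nbhs_normP[d /= d0 Hd].
  exists (d / 2); first by rewrite divr_gt0.
  move=> y xy; apply: Hd => /=; apply: le_lt_trans xy _.
  by rewrite ltr_pdivrMr// mulr_natr mulr2n ltrDl.
have [d d0 Hd] := near_t _ cA; have [d' d'0 Hd'] := near_t _ cB.
have m0 : 0 < Num.min d d' / 2 by rewrite divr_gt0// lt_min d0.
have [y [z]] := AB _ m0; rewrite mulrC divfK// => -[xy xz yz].
have {}Hd : `|A x - A y| <= e / 2 by apply/Hd/(le_trans xy); rewrite ge_min lexx.
have {}Hd' : `|B x - B z| <= e / 2 by apply/Hd'/(le_trans xz); rewrite ge_min lexx orbT.
rewrite -(subrKA (B z)) [e]splitr (le_trans (ler_normD _ _))// lerD//.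
  by rewrite -yz.
by rewrite distrC.
Qed.

(* Both iterated derivatives are limits of the second difference quotient of u
   over the square spanned by [t *: ebasis i] and [t *: ebasis j]. *)
Lemma derive_comm u i j : Ck_on setT 2 u ->
  'D_(ebasis R i) ('D_(ebasis R j) u) = 'D_(ebasis R j) ('D_(ebasis R i) u).
Proof.
move=> Cu; have Cij := Ck_on_derive i (Ck_on_derive j Cu).
have Cji := Ck_on_derive j (Ck_on_derive i Cu).
apply/funext => x; apply: (@eq_from_second_difference
  ('D_(ebasis R i) ('D_(ebasis R j) u)) ('D_(ebasis R j) ('D_(ebasis R i) u))
  u x (ebasis R j) (ebasis R i)).
- exact: (Ck_on_continuous Cij).
- exact: (Ck_on_continuous Cji).
- by move=> t t0; exact: second_difference.
- by move=> t t0; exact: second_difference.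
Qed.

End Ck_facts.

(** * Taylor expansion at 0 *)

Section taylor.
Variables (R : realType) (n : nat).
Implicit Types (u v f : 'rV[R]_n -> R) (i j : 'I_n) (x : 'rV[R]_n).

(* The homogeneous part of degree k of the Taylor expansion of u at 0, times k!. *)
Fixpoint hom_part (k : nat) u x : R :=
  match k with
  | 0 => u 0
  | k'.+1 => \sum_j x 0 j * hom_part k' ('D_(ebasis R j) u) x
  end.

(** In degree k + 1 the product rule yields the part of degree k of d_j u once from the term i = j;
    as partial derivatives commute, the remaining sum recombines by induction into k more copies of
    it. *)
Lemma is_derive_hom_part k u j x : Ck_on setT k u ->
  is_derive x (ebasis R j) (hom_part k u)
    (k%:R * hom_part k.-1 ('D_(ebasis R j) u) x).
Proof.
elim: k u => [|k IH] u Cu; first by rewrite mul0r; exact: is_derive_cst.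
have D i : is_derive x (ebasis R j) (fun y => y 0 i * hom_part k ('D_(ebasis R i) u) y)
    (x 0 i * (k%:R * hom_part k.-1 ('D_(ebasis R j) ('D_(ebasis R i) u)) x) +
     hom_part k ('D_(ebasis R i) u) x * (i == j)%:R).
  apply: is_deriveM; first exact: is_derive_coord.
  by apply: IH; exact: Ck_on_derive.
have -> : hom_part k.+1 u = \sum_i (fun y : 'rV[R]_n => y 0 i * hom_part k ('D_(ebasis R i) u) y).
  by apply/funext => y /=; rewrite fct_sumE.
apply: is_derive_eq; rewrite big_split/=.
rewrite [X in _ + X](bigD1 j)//= eqxx mulr1 [X in _ + (_ + X)]big1 ?addr0; last first.
  by move=> i /negbTE ->; rewrite mulr0.
rewrite -natr1 mulrDl mul1r; congr (_ + _).
case: k {IH D} Cu => [|k] Cu; first by rewrite mul0r big1// => i _; rewrite mul0r mulr0.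
have E i : 'D_(ebasis R j) ('D_(ebasis R i) u) = 'D_(ebasis R i) ('D_(ebasis R j) u).
  by apply: derive_comm; exact: Ck_on_leq Cu.
rewrite (eq_bigr (fun i => k.+1%:R * (x 0 i * hom_part k ('D_(ebasis R i) ('D_(ebasis R j) u)) x))).
  by rewrite -mulr_sumr.
move=> i _.
transitivity (x 0 i * (k.+1%:R * hom_part k ('D_(ebasis R i) ('D_(ebasis R j) u)) x)).
  exact: (congr1 (fun w => x 0 i * (k.+1%:R * hom_part k w x)) (E i)).
exact: mulrCA.
Qed.

Definition taylor (r : nat) u x : R := \sum_(k < r) (k`!)%:R^-1 * hom_part k u x.

Lemma taylorS_0 (r : nat) u : taylor r.+1 u 0 = u 0.
Proof.
rewrite /taylor big_ord_recl/= fact0 invr1 mul1r big1 ?addr0// => i _.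
by rewrite /= big1 ?mulr0// => j _; rewrite mxE mul0r.
Qed.

(** Differentiation passes from u to d_j u and lowers the order by one, which drives the inductions
    on the remainder. *)
Lemma is_derive_taylor r u j x : Ck_on setT r u ->
  is_derive x (ebasis R j) (taylor r.+1 u) (taylor r ('D_(ebasis R j) u) x).
Proof.
move=> Cu.
have D (k : 'I_r.+1) : is_derive x (ebasis R j) (fun y => (k`!)%:R^-1 * hom_part k u y)
    ((k`!)%:R^-1 * (k%:R * hom_part k.-1 ('D_(ebasis R j) u) x)).
  have kr : (k <= r)%N by rewrite -ltnS.
  have := is_derive_hom_part j x (Ck_on_leq kr Cu) => ?; exact: is_deriveZ.
have -> : taylor r.+1 u = \sum_(k < r.+1) (fun y => (k`!)%:R^-1 * hom_part k u y).
  by apply/funext => y; rewrite fct_sumE.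
apply: is_derive_eq; rewrite big_ord_recl/= mul0r mulr0 add0r.
apply: eq_bigr => k _; rewrite /= mulrA; congr (_ * _).
by rewrite /bump/= add1n factS natrM invfM mulrAC mulVf ?mul1r ?pnatr_eq0.
Qed.

Lemma bound_near0 u : (forall x, {for x, continuous u}) ->
  exists2 M, 0 <= M & forall x, `|x| <= 2 -> `|u x| <= M.
Proof.
move=> cu; have [M M0 uM] := compact_bound (@sup_ball_compact R n 2) (fun x _ => cu x).
by exists M.
Qed.

Lemma increment_bound u u' x j (s B : R) :
  (forall t : R, `|t| <= `|s| -> is_derive (x + t *: ebasis R j) (ebasis R j) u
    (u' (x + t *: ebasis R j))) ->
  (forall t : R, `|t| <= `|s| -> `|u' (x + t *: ebasis R j)| <= B) ->
  `|u (x + s *: ebasis R j) - u x| <= B * `|s|.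
Proof.
move=> du uB; have [s0|s0] := leP 0 s.
  have [t /andP[t0 ts]|c /andP[c0 cs]] := @mean_value_line _ _ u u' x (ebasis R j) 0 s s0.
    by apply: du; rewrite !ger0_norm.
  rewrite scale0r addr0 subr0 => ->; rewrite normrM ler_wpM2r// uB//.
  by rewrite !ger0_norm.
have [t /andP[ts t0]|c /andP[cs c0]] := @mean_value_line _ _ u u' x (ebasis R j) s 0 (ltW s0).
  by apply: du; rewrite !ler0_norm ?lerN2// ltW.
rewrite scale0r addr0 sub0r distrC => ->; rewrite normrM normrN ler_wpM2r// uB//.
by rewrite !ler0_norm ?lerN2// ltW.
Qed.

(** The vertices of a path from 0 to x parallel to the axes. *)
Definition truncate (i : nat) x : 'rV[R]_n := \row_l (if (l < i)%N then x 0 l else 0).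

Lemma truncateS (i : 'I_n) x : truncate i.+1 x = truncate i x + x 0 i *: ebasis R i.
Proof.
apply/rowP => l; rewrite !mxE eqxx/= ltnS leq_eqVlt.
by have [->|li] := eqVneq l i; rewrite ?eqxx/= ?ltnn ?mulr1 ?add0r//
  (_ : (l == i :> nat) = false) ?mulr0 ?addr0//; exact/negbTE.
Qed.

Lemma truncate_norm (i : 'I_n) x (t : R) : `|t| <= `|x 0 i| ->
  `|truncate i x + t *: ebasis R i| <= `|x|.
Proof.
move=> tx; apply: row_norm_le => // l; rewrite !mxE eqxx/=.
have [->|li] := eqVneq l i; first by rewrite ltnn add0r mulr1 (le_trans tx)// ler_norm_coord.
by rewrite mulr0 addr0; case: ifP => _; rewrite ?normr0// ler_norm_coord.
Qed.

(** Only partial derivatives are at hand, so u is followed from 0 to x along a path parallel to the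
    axes; by [truncate_norm] this path stays in the sup-norm ball of radius |x|. *)
Lemma path_bound u (B : R) x : u 0 = 0 ->
  (forall j y, is_derive y (ebasis R j) u ('D_(ebasis R j) u y)) ->
  (forall j y, `|y| <= `|x| -> `|'D_(ebasis R j) u y| <= B) ->
  `|u x| <= n%:R * (B * `|x|).
Proof.
move=> u0 du uB.
have -> : u x = \sum_(i < n) (u (truncate i.+1 x) - u (truncate i x)).
  rewrite -(big_mkord xpredT (fun i : nat => u (truncate i.+1 x) - u (truncate i x))).
  rewrite telescope_sumr// (_ : truncate n x = x); last by apply/rowP => l; rewrite mxE ltn_ord.
  rewrite (_ : truncate 0 x = 0) ?u0 ?subr0//.
  by apply/rowP => l; rewrite !mxE.
rewrite (le_trans (ler_norm_sum _ _ _))// -[n in n%:R]card_ord -sum1_card natr_sum mulr_suml.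
apply: ler_sum => i _; rewrite mul1r truncateS.
apply: (@le_trans _ _ (B * `|x 0 i|)).
  exact: (@increment_bound u ('D_(ebasis R i) u) (truncate i x) i (x 0 i) B
    (fun t _ => du i _) (fun t tx => uB i _ (truncate_norm tx))).
rewrite ler_wpM2l ?ler_norm_coord//.
by apply: le_trans (uB i 0 _); rewrite ?normr0.
Qed.

(** The remainder vanishes at 0 and its partial derivatives are the remainders of the partial
    derivatives, of order one less; [path_bound] then integrates the inductive estimate. *)
Lemma taylor_remainder r u : Ck_on setT r u ->
  exists2 C, 0 <= C & forall x, `|x| <= 2 -> `|u x - taylor r u x| <= C * `|x| ^+ r.
Proof.
elim: r u => [|r IH] u Cu.
  have [M M0 uM] := bound_near0 (fun x => Ck_on_continuous (x := x) Cu I).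
  by exists M => // x x2; rewrite /taylor big_ord0 subr0 expr0 mulr1 uM.
have /choice[C HC] j : exists C : R, 0 <= C /\ forall x, `|x| <= 2 ->
    `|'D_(ebasis R j) u x - taylor r ('D_(ebasis R j) u) x| <= C * `|x| ^+ r.
  by have [C C0 HC] := IH _ (Ck_on_derive j Cu); exists C.
pose S := \sum_j C j; have S0 : 0 <= S by apply: sumr_ge0 => j _; case: (HC j).
have CS j : C j <= S.
  by rewrite /S (bigD1 j)//= lerDl sumr_ge0// => k _; case: (HC k).
exists (n%:R * S); first by rewrite mulr_ge0.
move=> x x2.
have D j y : is_derive y (ebasis R j) (fun z => u z - taylor r.+1 u z)
    ('D_(ebasis R j) u y - taylor r ('D_(ebasis R j) u) y).
  apply: is_deriveB; first exact: (Ck_on_is_derive j Cu I).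
  by apply: is_derive_taylor; exact: Ck_on_pred.
rewrite exprSr -!mulrA [S * _]mulrA; apply: (path_bound (u := fun z => u z - taylor r.+1 u z)).
- by rewrite taylorS_0 subrr.
- by move=> j y; apply: derivableP; case: (D j y).
move=> j y yx; have [_ ->] := D j y.
have [C0 Cj] := HC j; rewrite (le_trans (Cj _ (le_trans yx x2)))//.
by apply: ler_pM => //; rewrite lerXn2r// nnegrE.
Qed.

(** The radius exceeds 1 so that this set and |x| > 1 form an open cover of the complement of 0, as
    [derive_bound_union] requires. *)
Definition punctured_ball : set 'rV[R]_n := [set x | 0 < `|x| < 2].

Lemma punctured_ball_neq0 x : punctured_ball x -> x != 0.
Proof. by move=> /= /andP[]; rewrite normr_gt0. Qed.

Lemma bound_powR_near0 (a M : R) u : a <= 0 -> 0 <= M -> (forall x, `|x| <= 2 -> `|u x| <= M) ->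
  forall x, punctured_ball x -> `|u x| <= M * 2 `^ (- a) * `|x| `^ a.
Proof.
move=> a0 M0 uM x /andP[x0 x2]; rewrite (le_trans (uM x (ltW x2)))// -mulrA ler_peMr//.
rewrite [leLHS](_ : 1 = 2 `^ (- a) * 2 `^ a); last first.
  by rewrite powRN mulVf// gt_eqF// powR_gt0.
by rewrite ler_wpM2l ?powR_ge0// powR_le_neg// ltW.
Qed.

Lemma derive_bound_near0 j N (a : R) u : a <= 0 -> Ck_on setT N u ->
  exists2 C, 0 <= C & derive_bound punctured_ball j N a C u.
Proof.
elim: N a u => [|N IH] a u a0 Cu;
  have [M M0 uM] := bound_near0 (fun x => Ck_on_continuous (x := x) Cu I);
  have ub := bound_powR_near0 a0 M0 uM;
  have B0 : 0 <= M * 2 `^ (- a) by rewrite mulr_ge0// powR_ge0.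
  by exists (M * 2 `^ (- a)).
have a1 : a - 1 <= 0 by rewrite subr_le0 (le_trans a0).
have [C C0 bC] := IH _ _ a1 (Ck_on_derive j Cu).
exists (M * 2 `^ (- a) + C); first exact: addr_ge0.
split=> [x xB|].
  by rewrite (le_trans (ub _ xB))// ler_wpM2r ?powR_ge0// lerDl.
exists ('D_(ebasis R j) u); first by move=> x _; exact: (Ck_on_is_derive j Cu I).
by apply: derive_bound_le bC; rewrite lerDr.
Qed.

(** Each derivative lowers the order of the remainder by one. Once the order is 0 the Taylor
    polynomial is empty and all remaining exponents are nonpositive, so boundedness near 0
    suffices. *)
Lemma derive_bound_taylor j N r u : (r <= N)%N -> Ck_on setT N u ->
  exists2 C, 0 <= C &
    derive_bound punctured_ball j N r%:R C (fun x => u x - taylor r u x).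
Proof.
elim: N r u => [|N IH] [|r] u // rN Cu.
- rewrite (_ : (fun x => _) = u); first exact: derive_bound_near0.
  by apply/funext => x; rewrite /taylor big_ord0 subr0.
- rewrite (_ : (fun x => _) = u); first exact: derive_bound_near0.
  by apply/funext => x; rewrite /taylor big_ord0 subr0.
have [C1 C10 H1] := taylor_remainder (Ck_on_leq rN Cu).
have [C2 C20 H2] := IH r _ rN (Ck_on_derive j Cu).
exists (C1 + C2); first exact: addr_ge0.
split=> [x /andP[x0 x2]|].
  by rewrite powR_mulrn// (le_trans (H1 x (ltW x2)))// ler_wpM2r ?exprn_ge0// lerDl.
exists (fun x => 'D_(ebasis R j) u x - taylor r ('D_(ebasis R j) u) x).
  move=> x _; apply: is_deriveB; first exact: (Ck_on_is_derive j Cu I).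
  apply: is_derive_taylor; apply: Ck_on_leq Cu; exact: ltnW.
rewrite -natr1 addrK; apply: derive_bound_le H2; by rewrite lerDr.
Qed.

End taylor.

(** * Order of differentiation, monomials as words *)

Section commuting_operators.
Variables (T : Type) (n : nat) (D : 'I_n -> T -> T) (S : T -> Prop).
Hypothesis S_D : forall i f, S f -> S (D i f).
Hypothesis D_comm : forall i j f, S f -> D i (D j f) = D j (D i f).

(** The shape of [mderive], for operators that commute on a class S stable under them. *)
Definition multi_iter (a : 'I_n -> nat) (s : seq 'I_n) (f : T) : T :=
  foldr (fun j h => iter (a j) (D j) h) f s.

Lemma S_iter i k f : S f -> S (iter k (D i) f).
Proof. by move=> Sf; elim: k => //= k; exact: S_D. Qed.

Lemma S_multi_iter a s f : S f -> S (multi_iter a s f).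
Proof. by move=> Sf; elim: s => //= i s; exact: S_iter. Qed.

Lemma iter_comm i j k f : S f -> D i (iter k (D j) f) = iter k (D j) (D i f).
Proof. by move=> Sf; elim: k => //= k IH; rewrite D_comm ?IH//; exact: S_iter. Qed.

Lemma multi_iter_comm i a s f : S f -> D i (multi_iter a s f) = multi_iter a s (D i f).
Proof.
move=> Sf; elim: s => //= j s IH; rewrite iter_comm ?IH//.
exact: S_multi_iter.
Qed.

Lemma multi_iterS a s j f : S f -> uniq s -> multi_iter (fun i => (i == j) + a i)%N s f =
  if j \in s then multi_iter a s (D j f) else multi_iter a s f.
Proof.
move=> Sf; elim: s => //= i s IH /andP[is_ us]; rewrite IH// in_cons.
case: (eqVneq i j) is_ => [->|ij] is_; last by case: ifP.
by rewrite /= (negbTE is_) add0n -iterS iterSr multi_iter_comm.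
Qed.

(** Commuting operators can be sorted, so only the multiplicities of the letters of w matter. *)
Lemma foldl_multi_iter w f : S f ->
  foldl (fun h j => D j h) f w = multi_iter (fun j => count_mem j w) (enum 'I_n) f.
Proof.
elim: w f => [|j w IH] f Sf /=.
  by elim: (enum _) => //= i s <-.
rewrite IH; last exact: S_D.
have := multi_iterS (fun i => count_mem i w) j Sf (enum_uniq 'I_n).
rewrite mem_enum => E; rewrite -[LHS]E; congr (multi_iter _ _ f).
apply/funext => i. by rewrite eq_sym.
Qed.

End commuting_operators.

Section words.
Variables (R : realType) (n : nat).
Implicit Types (u v f g phi : 'rV[R]_n -> R) (i j : 'I_n) (x : 'rV[R]_n) (w : seq 'I_n).

(** Monomials are indexed by words of coordinates because the recursion of [hom_part] produces them
    letter by letter. *)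
Definition word w x : R := \prod_(i <- w) x 0 i.

Lemma hom_part_words k u : exists l : seq (R * seq 'I_n),
  (forall p, p \in l -> size p.2 = k) /\
  forall x, hom_part k u x = \sum_(p <- l) p.1 * word p.2 x.
Proof.
elim: k u => [|k IH] u.
  exists [:: (u 0, [::])]; split=> [p|x]; first by rewrite inE => /eqP ->.
  by rewrite big_seq1 /word big_nil mulr1.
have /choice[L HL] j := IH ('D_(ebasis R j) u).
exists (flatten [seq [seq (p.1, j :: p.2) | p <- L j] | j <- enum 'I_n]); split.
  move=> p /flattenP[s /mapP[j _ ->] /mapP[q qL ->]] /=.
  by rewrite (proj1 (HL j)).
move=> x; rewrite /= big_flatten/= big_map big_enum/=; apply: eq_bigr => j _.
rewrite big_map (proj2 (HL j)) mulr_sumr; apply: eq_bigr => p _ /=.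
by rewrite /word big_cons; ring.
Qed.

Lemma taylor_words r u : exists l : seq (R * seq 'I_n),
  (forall p, p \in l -> (size p.2 < r)%N) /\
  forall x, taylor r u x = \sum_(p <- l) p.1 * word p.2 x.
Proof.
elim: r => [|r [l [lr Hl]]].
  by exists [::]; split=> // x; rewrite /taylor big_ord0 big_nil.
have [l' [l'r Hl']] := hom_part_words r u.
exists (l ++ [seq ((r`!)%:R^-1 * p.1, p.2) | p <- l']); split.
  move=> p; rewrite mem_cat => /orP[/lr/ltnW//|/mapP[q /l'r qr ->]] /=.
  by rewrite qr.
move=> x; rewrite big_cat/= -Hl /taylor big_ord_recr/=; congr (_ + _).
rewrite Hl' big_map mulr_sumr; apply: eq_bigr => p _ /=; exact: mulrA.
Qed.

Lemma hom_part_flat k u x :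
  (forall w, size w = k -> foldl (fun h j => 'D_(ebasis R j) h) u w 0 = 0) ->
  hom_part k u x = 0.
Proof.
elim: k u => [|k IH] u flat /=; first exact: (flat [::]).
rewrite big1// => j _; rewrite IH ?mulr0// => w wk.
by apply: (flat (j :: w)); rewrite /= wk.
Qed.

Lemma smooth_foldl_mderive g w : smooth_on setT g ->
  foldl (fun h j => 'D_(ebasis R j) h) g w = mderive (\row_j count_mem j w) g.
Proof.
move=> Sg.
have SD i f (Sf : smooth_on setT f) : smooth_on setT ('D_(ebasis R i) f).
  by move=> k; exact: (Ck_on_derive i (Sf k.+1)).
have DC i j f (Sf : smooth_on setT f) := derive_comm i j (Sf 2%N).
apply: (etrans (@foldl_multi_iter _ n (fun j h => 'D_(ebasis R j) h) (smooth_on setT) SD DC w g Sg)).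
by rewrite /mderive /multi_iter; congr foldr; apply/funext => j; rewrite mxE.
Qed.

Lemma taylor_flat r g : smooth_on setT g ->
  (forall k : 'rV[nat]_n, (1 <= mdegree k <= r)%N -> mderive k g 0 = 0) ->
  taylor r.+1 g = fun=> g 0.
Proof.
move=> Sg flat; apply/funext => x; rewrite /taylor big_ord_recl big1 ?addr0 => [|k _].
  by rewrite /= fact0 invr1 mul1r.
rewrite (@hom_part_flat _ g x) ?mulr0// => w wk.
rewrite smooth_foldl_mderive// flat//.
have -> : mdegree (\row_j count_mem j w) = size w.
  rewrite /mdegree; under eq_bigr do rewrite mxE.
  elim: w {wk} => [|j w IH] /=; first by rewrite big1.
  rewrite big_split/= IH -[RHS]add1n; congr (_ + _)%N.
  by rewrite (bigD1 j)//= eqxx big1// => i; rewrite eq_sym => /negbTE ->.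
by rewrite wk /= /bump add1n /= ltn_ord.
Qed.

Lemma Ck_on_sub (U V : set 'rV[R]_n) k u : U `<=` V -> Ck_on V k u -> Ck_on U k u.
Proof.
move=> UV; elim: k u => [|k IH] u [cu Hu]; split=> //; try by move=> x /UV; exact: cu.
by move=> j; have [du Cu] := Hu j; split=> [x /UV|]; [exact: du|exact: IH].
Qed.

Lemma derive_bound_word (U : set 'rV[R]_n) j N w : (forall x, U x -> x != 0) ->
  exists2 C, 0 <= C & derive_bound U j N (size w)%:R C (word w).
Proof.
move=> U0; elim: w => [|i w [C C0 bC]].
  exists `|1 : R| => //; rewrite (_ : word [::] = fun=> 1); first exact: derive_bound_cst.
  by apply/funext => x; rewrite /word big_nil.
exists (2 ^+ N * (1 * C)); first by rewrite !mulr_ge0.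
have := derive_boundM U0 ler01 C0 (derive_bound_coord U j N i) bC.
rewrite (_ : (fun x => _) = word (i :: w)); last by apply/funext => x; rewrite /word big_cons.
by rewrite (_ : 1 + (size w)%:R = (size (i :: w))%:R)//= -natr1 addrC.
Qed.

Definition far_region : set 'rV[R]_n := [set x | 1 < `|x|].

Lemma far_region_neq0 x : far_region x -> x != 0.
Proof. by rewrite /far_region/= -normr_gt0; apply: lt_trans. Qed.

Lemma open_far_region : open far_region.
Proof.
rewrite (_ : far_region = (fun x : 'rV[R]_n => `|x|) @^-1` [set s | 1 < s])//.
by apply: open_comp => [x _|]; [exact: norm_continuous|exact: open_gt].
Qed.

Lemma open_punctured_ball : open (@punctured_ball R n).
Proof.
rewrite (_ : @punctured_ball R n = (fun x : 'rV[R]_n => `|x|) @^-1` ([set s | 0 < s] `&` [set s | s < 2])).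
  apply: open_comp => [x _|]; first exact: norm_continuous.
  by apply: openI; [exact: open_gt|exact: open_lt].
by apply/seteqP; split=> x /=; [move/andP|move=> ?; apply/andP].
Qed.

Lemma off0_cover : ~` [set 0] `<=` @punctured_ball R n `|` far_region.
Proof.
move=> x /= /eqP x0; have [x1|x1] := leP `|x| 1; last by right.
by left; rewrite /punctured_ball /= normr_gt0 x0/= (le_lt_trans x1)// ltr1n.
Qed.

(* All that the estimates use of Schwartz functions and of compactly supported ones. *)
Definition rapidly_decaying (N : nat) u := Ck_on setT N u /\
  forall j k (M : nat), (k <= N)%N -> exists2 C, 0 <= C &
    forall x, 1 <= `|x| -> `|iter k (fun v => 'D_(ebasis R j) v) u x| <= C * `|x| ^- M.

Lemma rapidly_decaying_far N u j (a : R) : rapidly_decaying N u ->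
  exists2 C, 0 <= C & derive_bound far_region j N a C u.
Proof.
move=> [Cu du].
(* With M >= N - a one has |x|^-M <= |x|^(a-k) for |x| >= 1 and all k <= N. *)
pose M := Num.Def.archi_bound `|N%:R - a|.
have Ma : N%:R - a <= M%:R by rewrite (le_trans (ler_norm _))// ltW// archi_boundP.
have /choice[C HC] (k : 'I_N.+1) : exists C, 0 <= C /\ forall x, 1 <= `|x| ->
    `|iter k (fun v => 'D_(ebasis R j) v) u x| <= C * `|x| ^- M.
  have kN : (k <= N)%N by rewrite -ltnS.
  by have [C C0 HC] := du j k M kN; exists C.
have C0 : 0 <= \sum_k C k by apply: sumr_ge0 => k _; case: (HC k).
exists (\sum_k C k) => //; apply: derive_bound_iter; first exact: (Ck_on_sub _ Cu).
move=> k x kN /= x1; have kN' : (k < N.+1)%N by [].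
have [_ Hk] := HC (Ordinal kN'); apply: le_trans (Hk x (ltW x1)) _; apply: ler_pM.
- by case: (HC (Ordinal kN')).
- by rewrite invr_ge0 exprn_ge0.
- by rewrite (bigD1 (Ordinal kN'))//= lerDl sumr_ge0// => i _; case: (HC i).
rewrite -powR_mulrn// -powRN ler_powR//; first exact: ltW.
have : k%:R <= N%:R :> R by rewrite ler_nat.
lra.
Qed.

End words.

(** * Rapid decay and flat remainders *)

Section decay_instances.
Variables (R : realType) (n : nat).
Implicit Types (u v f g phi : 'rV[R]_n -> R) (i j : 'I_n) (x : 'rV[R]_n).

Lemma mderive_pure j k f :
  mderive (\row_i (if i == j then k else 0%N)) f = iter k (fun v => 'D_(ebasis R j) v) f.
Proof.
rewrite /mderive.
have H (s : seq 'I_n) : uniq s ->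
    foldr (fun i h => iter ((\row_i (if i == j then k else 0%N)) ord0 i)
      (fun u => 'D_(ebasis R i) u) h) f s =
    if j \in s then iter k (fun v => 'D_(ebasis R j) v) f else f.
  elim: s => //= i s IH /andP[is_ us]; rewrite IH// mxE in_cons eq_sym.
  by case: (eqVneq j i) is_ => [->|ij] is_ /=; rewrite ?(negbTE is_).
by rewrite H ?enum_uniq// mem_enum.
Qed.

(** The sup norm of x is attained at some coordinate, so bounds on x_i^M times pure derivatives, one
    for each i, are enough. *)
Lemma schwartz_rapidly_decaying N u : (0 < n)%N -> schwartz u -> rapidly_decaying N u.
Proof.
move=> n0 [Su Du]; split; first exact: Su.
move=> j k M _.
have /choice[B HB] i : exists B, forall x,
    `|x 0 i| ^+ M * `|iter k (fun v => 'D_(ebasis R j) v) u x| <= B.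
  have [B HB] := Du (\row_l (if l == i then M else 0%N)) (\row_i (if i == j then k else 0%N)).
  exists B => x; have := HB x; rewrite mderive_pure normrM; congr (_ * _ <= _).
  rewrite /monomial (bigD1 i)//= !mxE eqxx big1 ?mulr1; first by rewrite -exprnP normrX.
  by move=> l li; rewrite !mxE (negbTE li) expr0z.
have B0 i : 0 <= B i by apply: le_trans (HB i 0); rewrite mulr_ge0// exprn_ge0.
exists (\sum_i B i); first exact: sumr_ge0.
move=> x x1; have x0 : 0 < `|x| by apply: lt_le_trans x1.
have [i xi] := row_norm_attained x n0.
rewrite ler_pdivlMr ?exprn_gt0// mulrC xi (le_trans (HB i x))//.
by rewrite (bigD1 i)//= lerDl sumr_ge0.
Qed.

Lemma derive_vanish (U : set 'rV[R]_n) u j : open U -> (forall x, U x -> u x = 0) ->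
  forall x, U x -> 'D_(ebasis R j) u x = 0.
Proof.
move=> oU u0 x Ux.
have [] // : is_derive x (ebasis R j) u 0.
exact: (is_derive_open_eq oU Ux (fun y Uy => esym (u0 y Uy)) (is_derive_cst _ _ _)).
Qed.

Lemma CkC_rapidly_decaying N u : CkC N u -> rapidly_decaying N u.
Proof.
move=> [Cu cu]; split=> // j k M kN.
have [B [_ HB]] := compact_bounded cu.
pose rho := `|B| + 1.
have rho0 : 0 < rho by rewrite ltr_wpDl.
have oU : open [set x : 'rV[R]_n | rho < `|x|].
  rewrite (_ : mkset _ = (fun x : 'rV[R]_n => `|x|) @^-1` [set s | rho < s])//.
  by apply: open_comp => [x _|]; [exact: norm_continuous|exact: open_gt].
have u0 x : rho < `|x| -> u x = 0.
  move=> xr; apply/eqP/negP => /negP ux0; move: xr; apply/negP; rewrite -leNgt.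
  apply: HB; first by rewrite /rho (le_lt_trans (ler_norm B))// ltrDl.
  exact: subset_closure.
have it0 x : rho < `|x| -> iter k (fun v => 'D_(ebasis R j) v) u x = 0.
  elim: k {kN} x => [|k IH] x xr /=; first exact: u0.
  exact: (derive_vanish j oU IH xr).
have Ck : Ck_on setT 0 (iter k (fun v => 'D_(ebasis R j) v) u).
  by apply: Ck_on_iter; rewrite add0n; exact: Ck_on_leq Cu.
have [C C0 HC] := compact_bound (@sup_ball_compact R n rho)
  (fun x _ => Ck_on_continuous (x := x) Ck I).
(* The factor rho^M pays for |x|^-M on 1 <= |x| <= rho; beyond rho the derivatives vanish. *)
exists (C * rho ^+ M); first by rewrite mulr_ge0// exprn_ge0// ltW.
move=> x x1; have x0 : 0 < `|x| by apply: lt_le_trans x1.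
have [xr|xr] := leP `|x| rho; last first.
  by rewrite it0// normr0 !mulr_ge0// ?exprn_ge0// ltW.
rewrite (le_trans (HC x xr))// -mulrA ler_peMr// ler_pdivlMr ?exprn_gt0// mul1r.
by rewrite lerXn2r ?nnegrE// ltW.
Qed.

End decay_instances.

Section remainder.
Variables (R : realType) (n : nat).
Implicit Types (u v f g phi : 'rV[R]_n -> R) (i j : 'I_n) (x : 'rV[R]_n) (w : seq 'I_n).
Local Notation off0 := (~` [set (0 : 'rV[R]_n)]).

Lemma off0_neq0 x : off0 x -> x != 0. Proof. by move/eqP. Qed.

Lemma powR_le1_far x (a : R) : far_region x -> a <= 0 -> `|x| `^ a <= 1.
Proof.
move=> x1 a0; rewrite [leRHS](_ : 1 = 1 `^ a); last by rewrite powR1.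
by apply: powR_le_neg => //; exact: ltW.
Qed.

Lemma powR_le_near x (a : R) : punctured_ball x -> 0 <= a -> `|x| `^ a <= 2 `^ a.
Proof. by move=> /andP[x0 x2] a0; apply: ge0_ler_powR => //; rewrite ?nnegrE// ltW. Qed.

Lemma derive_bound_split j N (a : R) u :
  (exists2 C, 0 <= C & derive_bound (@punctured_ball R n) j N a C u) ->
  (exists2 C, 0 <= C & derive_bound (@far_region R n) j N a C u) ->
  exists2 C, 0 <= C & derive_bound off0 j N a C u.
Proof.
move=> [C C0 bC] [C' C'0 bC']; exists (C + C'); first exact: addr_ge0.
apply: derive_bound_sub (@off0_cover R n) _.
apply: derive_bound_union; [exact: open_punctured_ball|exact: open_far_region| |].
  by apply: derive_bound_le bC; rewrite lerDl.
by apply: derive_bound_le bC'; rewrite lerDr.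
Qed.

Variables (g : 'rV[R]_n -> R) (r : nat).
Hypotheses (g_decay : forall N, rapidly_decaying N g) (g_flat : taylor r g = fun=> 1)
  (r_gt0 : (0 < r)%N).

Lemma flat_derive_bound j N :
  exists2 C, 0 <= C & derive_bound off0 j N r%:R C (fun x => g x - 1).
Proof.
apply: derive_bound_split.
  (* A Taylor bound of order r uses r derivatives, while N may be smaller than r. *)
  have [] := @derive_bound_taylor R n j (maxn N r) r g (leq_maxr _ _).
    by case: (g_decay (maxn N r)).
  move=> C C0; rewrite g_flat => bC; exists C => //.
  by apply: derive_bound_leq bC; exact: leq_maxl.
have [C C0 bC] := rapidly_decaying_far j r%:R (g_decay N).
exists (C + `|-1| * 1); first by rewrite addr_ge0// mulr_ge0.
apply: derive_boundD => //.
apply: derive_bound_weaken (derive_bound_cst _ _ _ _) => //.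
  exact: far_region_neq0.
by move=> x x1; rewrite powR_le1_far// sub0r oppr_le0.
Qed.

Lemma word_flat_near j N w :
  exists2 C, 0 <= C & derive_bound (@punctured_ball R n) j N r%:R C (fun x => word w x * (1 - g x)).
Proof.
have [C C0 bC] := flat_derive_bound j N.
have [C' C'0 bC'] := derive_bound_word j N w (@punctured_ball_neq0 R n).
have {}bC : derive_bound (@punctured_ball R n) j N r%:R (`|-1| * C) (fun x => 1 - g x).
  have := derive_boundZ (-1) (derive_bound_sub (U := off0) _ bC).
  rewrite (_ : (fun x => -1 * _) = fun x => 1 - g x); last first.
    by apply/funext => x; rewrite mulN1r opprB.
  by apply => x /punctured_ball_neq0/eqP.
have C10 : 0 <= `|-1| * C by rewrite mulr_ge0.
have := derive_boundM (@punctured_ball_neq0 R n) C'0 C10 bC' bC.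
move=> /(derive_bound_weaken (b := r%:R) (K := 2 `^ (size w)%:R) (@punctured_ball_neq0 R n)) H.
eexists; last first.
  apply: H; first by rewrite !mulr_ge0// exprn_ge0.
  by move=> x xB; rewrite addrK; exact: powR_le_near.
by rewrite !mulr_ge0 ?exprn_ge0 ?powR_ge0.
Qed.

Lemma word_flat_far j N (a : R) w :
  exists2 C, 0 <= C & derive_bound (@far_region R n) j N a C (fun x => word w x * g x).
Proof.
have [C C0 bC] := rapidly_decaying_far j (a - (size w)%:R) (g_decay N).
have [C' C'0 bC'] := derive_bound_word j N w (@far_region_neq0 R n).
exists (2 ^+ N * (C' * C)); first by rewrite !mulr_ge0// exprn_ge0.
have := derive_boundM (@far_region_neq0 R n) C'0 C0 bC' bC.
by rewrite addrC subrK.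
Qed.

Lemma derive_bound_sum (U : set 'rV[R]_n) j N (a : R) (l : seq (R * seq 'I_n))
    (F : seq 'I_n -> 'rV[R]_n -> R) :
  (forall w, exists2 C, 0 <= C & derive_bound U j N a C (F w)) ->
  exists2 C, 0 <= C & derive_bound U j N a C (fun x => \sum_(p <- l) p.1 * F p.2 x).
Proof.
move=> HF; elim: l => [|[c w] l [C C0 bC]].
  exists 0 => //; rewrite (_ : (fun x => _) = fun=> 0); first exact: derive_bound0.
  by apply/funext => x; rewrite big_nil.
have [C' C'0 bC'] := HF w.
exists (`|c| * C' + C); first by rewrite addr_ge0// mulr_ge0.
rewrite (_ : (fun x => _) = fun x => c * F w x + \sum_(p <- l) p.1 * F p.2 x); last first.
  by apply/funext => x; rewrite big_cons.
by apply: derive_boundD => //; exact: derive_boundZ.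
Qed.

(** Near 0, phi - T g = (phi - T) + T (1 - g), where both terms are flat of order r; far out, phi
    and T g decay rapidly. *)
Lemma remainder_derive_bound j N phi : (r <= N)%N -> rapidly_decaying N phi ->
  exists2 C, 0 <= C & derive_bound off0 j N r%:R C (fun x => phi x - taylor r phi x * g x).
Proof.
move=> rN dphi; have [l [_ Tl]] := taylor_words r phi; apply: derive_bound_split.
  have [C C0 bC] := derive_bound_taylor j rN (proj1 dphi).
  have [C' C'0 bC'] := derive_bound_sum l (word_flat_near j N).
  exists (C + C'); first exact: addr_ge0.
  have := derive_boundD bC bC'; congr derive_bound; apply/funext => x.
  under [X in _ + X]eq_bigr do rewrite mulrA.
  by rewrite -mulr_suml -Tl; ring.
have [C C0 bC] := rapidly_decaying_far j r%:R dphi.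
have [C' C'0 bC'] := derive_bound_sum l (word_flat_far j N r%:R).
exists (C + `|-1| * C'); first by rewrite addr_ge0// mulr_ge0.
have := derive_boundD bC (derive_boundZ (-1) bC'); congr derive_bound; apply/funext => x.
under eq_bigr do rewrite mulrA.
by rewrite -mulr_suml -Tl mulN1r.
Qed.

End remainder.

(** * Invertibility of K *)

Section grid_facts.
Variables (R : realType) (n kappa : nat).
Implicit Types (eta b : 'rV[int]_n) (x : 'rV[R]_n) (l : 'I_n).

Lemma moment_exponentE eta l :
  moment_exponent kappa eta 0 l = eta 0 l * 2 - (l < kappa)%:R.
Proof.
rewrite /moment_exponent mulr2n !mxE summxE; congr (_ - _); first by ring.
rewrite big_mkcond/= (bigD1 l)//= big1 ?addr0; last first.
  by move=> i /negbTE il; case: ifP => // _; rewrite mxE eq_sym il.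
by case: ifP; rewrite ?mxE ?eqxx.
Qed.

(* 2 eta - e_1 - ... - e_kappa as a natural exponent; the subtraction does not
   truncate on the grid, where eta_l >= 1 for l < kappa. *)
Definition exponent eta l : nat := ((absz (eta ord0 l)).*2 - (l < kappa))%N.

Lemma nonneg_gridP p eta : nonneg_grid kappa p eta ->
  [/\ (norm1 eta <= p)%N, forall l, eta 0 l = (absz (eta ord0 l))%:Z &
      forall l, (l < kappa)%N -> (0 < absz (eta ord0 l))%N].
Proof.
move=> [[np /prodf_neq0 kp] e0]; split=> // [l|l lk]; first by rewrite gez0_abs.
by rewrite absz_gt0; exact: kp.
Qed.

Lemma nonneg_gridI p eta : (norm1 eta <= p)%N -> (forall l, 0 <= eta 0 l) ->
  (forall l, (l < kappa)%N -> eta 0 l != 0) -> nonneg_grid kappa p eta.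
Proof. by move=> np e0 ek; split=> //; split=> //; apply/prodf_neq0 => l; exact: ek. Qed.

Lemma monomial_grid p eta x : nonneg_grid kappa p eta ->
  monomial (moment_exponent kappa eta) x = \prod_l x 0 l ^+ exponent eta l.
Proof.
move=> /nonneg_gridP[_ e0 ek]; apply: eq_bigr => l _.
rewrite moment_exponentE e0 exprnP; congr (_ ^ _).
rewrite /exponent; case: ltnP => lk /=; last by rewrite subr0 subn0 -muln2 PoszM.
have := ek l lk; rewrite -muln2; set a := absz _ => a0.
by rewrite -subzn ?PoszM//; lia.
Qed.

Definition orbit_size eta : R := \sum_(b \in sign_orbit eta) (1 : R).

Lemma finite_sign_orbit eta : finite_set (sign_orbit eta).
Proof.
apply: (@sub_finite_set _ _ ((fun k : {ffun 'I_n -> bool} =>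
    \row_j ((-1) ^+ k j * eta 0 j)) @` setT)).
  move=> b [k ->]; exists [ffun j => k j] => //.
  by apply/rowP => j; rewrite !mxE ffunE.
by apply: finite_image; exact: finite_finset.
Qed.

Lemma orbit_size_gt0 eta : 0 < orbit_size eta.
Proof.
rewrite /orbit_size (fsbigD1 eta); last 2 first.
- exact: finite_sign_orbit.
- by exists (fun=> false); apply/rowP => j; rewrite mxE expr0 mul1r.
by rewrite ltr_pwDl// fsumr_ge0.
Qed.

Lemma orbit_sum_cst eta (F : 'rV[int]_n -> R) c : (forall b, sign_orbit eta b -> F b = c) ->
  \sum_(b \in sign_orbit eta) F b = orbit_size eta * c.
Proof.
move=> Fc; rewrite /orbit_size !fsbig_finite/=; try exact: finite_sign_orbit.
rewrite mulr_suml big_seq [RHS]big_seq; apply: eq_bigr => b.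
by rewrite in_fset_set ?inE ?mul1r; [exact: Fc|exact: finite_sign_orbit].
Qed.

Lemma sign_orbit_absz eta b : sign_orbit eta b -> forall l, absz (b ord0 l) = absz (eta ord0 l).
Proof.
by move=> [k ->] l; rewrite mxE abszM abszX abszN1 exp1n mul1n.
Qed.

(** For l < kappa the exponent is odd and the sign of b_l turns b_l^(2a+1) into |b_l|^(2a+1); the
    other exponents are even. Hence the summand of K is constant on an orbit. *)
Lemma signed_monomial p eta zeta b : nonneg_grid kappa p eta -> nonneg_grid kappa p zeta ->
  sign_orbit zeta b ->
  (Num.sg (kprod kappa b))%:~R * monomial (moment_exponent kappa eta) (map_mx intr b) =
  \prod_l (absz (zeta ord0 l))%:R ^+ exponent eta l :> R.
Proof.
move=> Ge Gz bz; rewrite (monomial_grid _ Ge) /kprod.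
have -> : (Num.sg (\prod_(j < n | (j < kappa)%N) b 0 j))%:~R =
    \prod_(j < n) (if (j < kappa)%N then (Num.sg (b 0 j))%:~R else 1) :> R.
  rewrite -big_mkcond/= -[LHS]/(intr _).
  rewrite (big_morph Num.sg (@sgrM _) (@sgr1 _)).
  by rewrite (big_morph intr (@intrM _) (erefl _)).
rewrite -big_split/=; apply: eq_bigr => l _; rewrite mxE -(sign_orbit_absz bz).
have [_ _ ek] := nonneg_gridP Ge; rewrite /exponent.
have nE (z : int) : (absz z)%:R = `|z%:~R| :> R by rewrite natr_absz intr_norm.
have sgE (z : int) : (Num.sg z)%:~R * z%:~R = `|z%:~R| :> R.
  by rewrite -intrM -normrEsg intr_norm.
have sq (y : R) a : `|y| ^+ a.*2 = y ^+ a.*2.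
  by rewrite -mul2n !exprM real_normK ?num_real.
rewrite nE; case: ifP => lk; last by rewrite mul1r subn0 sq.
have := ek l lk; case: (absz (eta ord0 l)) => // a _.
by rewrite doubleS subn1/= !exprS sq mulrA sgE.
Qed.

Variables (m : nat) (p : nat) (xi : 'I_m -> 'rV[int]_n).
Hypothesis xi_enum : set_bij setT (nonneg_grid kappa p) xi.

Let xi_grid i : nonneg_grid kappa p (xi i).
Proof. by case: xi_enum => /(_ i I). Qed.

Lemma system_KE i j : system_K R kappa xi i j =
  orbit_size (xi j) * \prod_l (absz (xi j ord0 l))%:R ^+ exponent (xi i) l.
Proof.
rewrite mxE; apply: orbit_sum_cst => b bj.
exact: (signed_monomial (xi_grid i) (xi_grid j) bj).
Qed.

(* Newton's interpolation basis in the squared variables: it vanishes at all grid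
   points that do not dominate [z] coordinatewise. *)
Definition newton1 (c z : nat) (y : R) : R :=
  y ^+ c * \prod_(k < z - c) (y ^+ 2 - (k + c)%:R ^+ 2).

(** The powers y^(2e+c) with e <= z - c are those occurring in grid monomials with coordinate e + c
    <= z. Summing up to p gives all coordinates the same index range, as needed to expand a product
    of such sums. *)
Lemma newton1_expand (c z : nat) : (z <= p)%N -> exists a : nat -> R,
  (forall e, (z - c < e)%N -> a e = 0) /\
  forall y, newton1 c z y = \sum_(e < p.+1) a e * y ^+ (e.*2 + c).
Proof.
move=> zp.
pose P : {poly R} := \prod_(k <- index_iota 0 (z - c)) ('X - ((k + c)%:R ^+ 2)%:P).
have sP : size P = (z - c).+1 by rewrite size_prod_XsubC size_iota subn0.
exists (fun e => P`_e); split=> [e ze|y]; first by rewrite nth_default// sP.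
rewrite /newton1 -(big_mkord xpredT (fun k : nat => y ^+ 2 - (k + c)%:R ^+ 2)).
have -> : \prod_(0 <= k < z - c) (y ^+ 2 - (k + c)%:R ^+ 2) = P.[y ^+ 2].
  by rewrite horner_prod; apply: eq_bigr => k _; rewrite !hornerE.
rewrite (@horner_coef_wide _ p.+1); last by rewrite sP ltnS (leq_trans (leq_subr _ _)).
rewrite mulr_sumr; apply: eq_bigr => e _.
by rewrite exprD -mul2n exprM; ring.
Qed.

Lemma newton1_neq0 (c z y : nat) : (c <= y)%N -> newton1 c z y%:R != 0 -> (z <= y)%N.
Proof.
move=> cy; apply: contraNT; rewrite -ltnNge => yz.
have yc : (y - c < z - c)%N by rewrite ltn_sub2r// (leq_ltn_trans cy).
by rewrite /newton1 (bigD1 (Ordinal yc))//= subnK// subrr mul0r mulr0.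
Qed.

Lemma newton1_diag (c z : nat) : (c <= 1)%N -> (c <= z)%N -> newton1 c z z%:R != 0.
Proof.
move=> c1 cz; rewrite mulf_neq0//.
  case: c c1 cz => [|[|]]// _ z0; by rewrite ?expr0 ?oner_eq0// expr1 pnatr_eq0 -lt0n.
apply/prodf_neq0 => -[k kz] _ /=; rewrite subr_eq0 -!natrX eqr_nat eqn_exp2r//.
by rewrite gtn_eqF//; lia.
Qed.

Definition newton (zeta eta : 'rV[int]_n) : R :=
  \prod_(l < n) newton1 (l < kappa)%N (absz (zeta ord0 l)) (absz (eta ord0 l))%:R.

Lemma norm1E eta : norm1 eta = (\sum_(l < n) absz (eta ord0 l))%N.
Proof. by []. Qed.

(** Expanded, the Newton function of zeta involves only monomials of points eta below zeta
    coordinatewise, with eta_l >= 1 for l < kappa. Such points belong to the grid again, because the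
    condition on the 1-norm is inherited downwards. *)
Lemma newton_orthogonal (w : 'I_m -> R) zeta : nonneg_grid kappa p zeta ->
  (forall i, \sum_j w j * \prod_l (absz (xi j ord0 l))%:R ^+ exponent (xi i) l = 0) ->
  \sum_j w j * newton zeta (xi j) = 0.
Proof.
move=> Gz w0; have [np _ ek] := nonneg_gridP Gz.
have zp (l : 'I_n) : (absz (zeta ord0 l) <= p)%N.
  by apply: leq_trans np; rewrite norm1E (bigD1 l)//= leq_addr.
have /choice[a Ha] (l : 'I_n) := newton1_expand (l < kappa)%N (zp l).
have E j : newton zeta (xi j) = \sum_(f : {ffun 'I_n -> 'I_p.+1})
    (\prod_(l < n) a l (f l)) * \prod_l (absz (xi j ord0 l))%:R ^+ ((f l).*2 + (l < kappa)).
  rewrite /newton (eq_bigr _ (fun l _ => proj2 (Ha l) _)).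
  by rewrite bigA_distr_bigA/=; apply: eq_bigr => f _; rewrite big_split.
under eq_bigr do rewrite E mulr_sumr.
rewrite exchange_big/= big1// => f _.
have [/existsP[l /eqP al]|/existsPn af] := boolP [exists l, a l (f l) == 0].
  by rewrite big1// => j _; rewrite (bigD1 l)//= al !mul0r mulr0.
have fz l : (f l + (l < kappa) <= absz (zeta ord0 l))%N.
  have : (f l <= absz (zeta ord0 l) - (l < kappa))%N.
    by rewrite leqNgt; apply: contra (af l) => /(proj1 (Ha l)) ->.
  by have := ek l; case: (l < kappa)%N => /= [/(_ isT)|_]; lia.
pose eta : 'rV[int]_n := \row_l (f l + (l < kappa))%:Z.
have Ge : nonneg_grid kappa p eta.
  apply: nonneg_gridI => [|l|l lk]; rewrite ?mxE//; last by rewrite lk addn1.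
  apply: leq_trans np; rewrite !norm1E; apply: leq_sum => l _.
  by rewrite mxE absz_nat.
have [i _ ie] : (xi @` setT) eta by case: xi_enum => _ _; apply.
rewrite (eq_bigr (fun j => (\prod_(l < n) a l (f l)) *
    (w j * \prod_l (absz (xi j ord0 l))%:R ^+ exponent (xi i) l))); last first.
  move=> j _; have -> : exponent (xi i) = fun l => ((f l).*2 + (l < kappa))%N.
    apply/funext => l; rewrite ie /exponent mxE absz_nat doubleD; lia.
  exact: mulrCA.
by rewrite -mulr_sumr w0 mulr0.
Qed.

Lemma newton_domination zeta eta : nonneg_grid kappa p zeta -> nonneg_grid kappa p eta ->
  newton zeta eta != 0 -> zeta = eta \/ (norm1 zeta < norm1 eta)%N.
Proof.
move=> Gz Ge /prodf_neq0 H; have [_ z0 _] := nonneg_gridP Gz; have [_ e0 ek] := nonneg_gridP Ge.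
have ze l : (absz (zeta ord0 l) <= absz (eta ord0 l))%N.
  apply: newton1_neq0 (H l isT).
  by have := ek l; case: (l < kappa)%N => /= [/(_ isT)|_].
have [->|nze] := eqVneq zeta eta; [by left|right].
have [l lne] : exists l, zeta 0 l != eta 0 l.
  apply/existsP; apply: contraNT nze => /existsPn E.
  by apply/eqP/rowP => l; apply/eqP; have := E l; rewrite negbK.
rewrite !norm1E (bigD1 l)//= [ltnRHS](bigD1 l)//= -addSn leq_add ?leq_sum//.
rewrite ltn_neqAle ze andbT; apply: contraNneq lne => E.
by rewrite z0 e0 E.
Qed.

Lemma newton_diag zeta : nonneg_grid kappa p zeta -> newton zeta zeta != 0.
Proof.
move=> Gz; have [_ _ ek] := nonneg_gridP Gz; apply/prodf_neq0 => l _.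
apply: newton1_diag; first by case: (l < kappa)%N.
by have := ek l; case: (l < kappa)%N => /= [/(_ isT)|_].
Qed.

(** A kernel vector, rescaled by the orbit sizes, annihilates every Newton function. The Newton
    function of zeta is nonzero at zeta and, elsewhere on the grid, can be nonzero only at points of
    larger 1-norm, so the entry at zeta vanishes once those at larger norms do. *)
Lemma system_K_unit : system_K R kappa xi \in unitmx.
Proof.
rewrite unitmxE unitfE -det_tr; apply/negP => /det0P[v v0 vK].
pose w j := v 0 j * orbit_size (xi j).
have w0 i : \sum_j w j * \prod_l (absz (xi j ord0 l))%:R ^+ exponent (xi i) l = 0.
  have /rowP/(_ i) := vK; rewrite mxE [RHS]mxE => E; rewrite -[RHS]E.
  by apply: eq_bigr => j _; rewrite [in RHS]mxE system_KE mulrA.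
have inj i j : xi i = xi j -> i = j by case: xi_enum => _ /(_ i j) + _; rewrite !inE; apply.
(* Downward induction on the 1-norm, measured by its distance to p. *)
have wz d j : (p - norm1 (xi j) < d)%N -> w j = 0.
  elim: d j => // d IH j jd.
  have := newton_orthogonal (xi_grid j) w0; rewrite (bigD1 j)//= big1 ?addr0 => [/eqP|i ij].
    by rewrite mulf_eq0 (negbTE (newton_diag (xi_grid j))) orbF => /eqP.
  have [->|Nij] := eqVneq (newton (xi j) (xi i)) 0; first by rewrite mulr0.
  have [/inj E|ji] := newton_domination (xi_grid j) (xi_grid i) Nij.
    by rewrite E eqxx in ij.
  rewrite IH ?mul0r//; have [np _ _] := nonneg_gridP (xi_grid i).
  by move: jd ji np; lia.
move/negP: v0; apply; apply/eqP/rowP => j; rewrite mxE; have := wz _ j (ltnSn _).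
by move/eqP; rewrite mulf_eq0 (gt_eqF (orbit_size_gt0 _)) orbF => /eqP.
Qed.

End grid_facts.

(** * Moments *)

Section tame_calculus.
Variables (R : realType) (n : nat) (d : R).
Hypothesis d0n : 0 < d <= n%:R.
Local Notation mu := (lebesgue_Rn R n).
Implicit Types (F G : 'rV[R]_n -> R) (h c : R) (j : 'I_n) (x : 'rV[R]_n).

Lemma tameD F G : tame d F -> tame d G -> tame d (fun x => F x + G x).
Proof.
move=> [F0 cF [A FA]] [G0 cG [B GB]]; split; first by rewrite F0 G0 addr0.
  by move=> x x0; apply: continuousD; [exact: cF|exact: cG].
exists (A + B) => x x0; have [F1 F2] := FA x x0; have [G1 G2] := GB x x0.
by split; rewrite mulrDl (le_trans (ler_normD _ _))// lerD.
Qed.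

Lemma tameZ c F : tame d F -> tame d (fun x => c * F x).
Proof.
move=> [F0 cF [A FA]]; split; first by rewrite F0 mulr0.
  by move=> x x0; apply: continuousM; [exact: cst_continuous|exact: cF].
by exists (`|c| * A) => x x0; have [F1 F2] := FA x x0; split;
  rewrite normrM -mulrA ler_wpM2l.
Qed.

Definition trapezoid_error h F : R := trapezoid h F - \int[mu]_x F x.

Lemma trapezoid_errorD h F G : 0 < h -> tame d F -> tame d G ->
  trapezoid_error h (fun x => F x + G x) = trapezoid_error h F + trapezoid_error h G.
Proof.
move=> h0 tF tG; have [iF _ _] := tame_cvg d0n h0 tF; have [iG _ _] := tame_cvg d0n h0 tG.
rewrite /trapezoid_error RintegralD// /trapezoid.
rewrite (_ : (fun x => _) \o _ = (F \o @lattice_pt R n h) \+ (G \o @lattice_pt R n h))//.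
rewrite lattice_sumD; [ring|exact: tame_lattice_summable tF|exact: tame_lattice_summable tG].
Qed.

Lemma trapezoid_errorZ h c F : 0 < h -> tame d F ->
  trapezoid_error h (fun x => c * F x) = c * trapezoid_error h F.
Proof.
move=> h0 tF; have [iF _ _] := tame_cvg d0n h0 tF.
rewrite /trapezoid_error RintegralZl// /trapezoid.
rewrite (_ : (fun x => _) \o _ = c \*o (F \o @lattice_pt R n h))//.
rewrite lattice_sumZ; [ring|exact: tame_lattice_summable tF].
Qed.

(** Since the integral is the limit of the trapezoid rule, identities between lattice sums carry
    over to integrals. *)
Lemma integral_unique F (T : R) h : 0 < h -> tame d F ->
  (trapezoid (h / 2 ^+ k) F @[k --> \oo] --> T) -> \int[mu]_x F x = T.
Proof.
move=> h0 tF cT; have := trapezoid_cvg d0n h0 tF.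
by move=> /(cvg_lim (@Rhausdorff _)) <-; exact: (cvg_lim (@Rhausdorff _)).
Qed.

Lemma trapezoid_homothety h (l : R) F : 0 < l ->
  trapezoid h (fun x => F (l *: x)) = l ^- n * trapezoid (l * h) F.
Proof.
move=> l0; rewrite /trapezoid exprMn !mulrA mulVf ?mul1r; last by rewrite expf_neq0// gt_eqF.
by congr (_ * lattice_sum _); apply/funext => b; rewrite /= /lattice_pt scalerA.
Qed.

Lemma trapezoid_error_homothety h (l : R) F : 0 < l -> 0 < h -> tame d F ->
  tame d (fun x => F (l *: x)) ->
  trapezoid_error h (fun x => F (l *: x)) = l ^- n * trapezoid_error (l * h) F.
Proof.
move=> l0 h0 tF tFl; rewrite /trapezoid_error trapezoid_homothety// mulrBr; congr (_ - _).
apply: (integral_unique h0 tFl).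
under eq_fun do rewrite trapezoid_homothety// mulrA.
by apply: cvgM; [exact: cvg_cst|apply: trapezoid_cvg d0n _ tF; rewrite mulr_gt0].
Qed.

Definition reflect_int j (b : 'rV[int]_n) : 'rV[int]_n :=
  \row_i (if i == j then - b 0 i else b 0 i).

Lemma reflect_intK j : involutive (reflect_int j).
Proof. by move=> b; apply/rowP => i; rewrite !mxE; case: eqP => // _; rewrite opprK. Qed.

Lemma reflect_lattice j h b : reflect_coord j (lattice_pt h b) = lattice_pt h (reflect_int j b) :> 'rV[R]_n.
Proof. by apply/rowP => i; rewrite !mxE; case: eqP => // _; rewrite intrN mulrN. Qed.

Lemma trapezoid_reflect h j F : trapezoid h (F \o reflect_coord j) = trapezoid h F.
Proof.
rewrite /trapezoid -(lattice_sum_bij _ (inv_bij (reflect_intK j))).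
by congr (_ * lattice_sum _); apply/funext => b; rewrite /= reflect_lattice reflect_intK.
Qed.

Lemma trapezoid_error_odd h j F : 0 < h -> tame d F ->
  (forall x, F (reflect_coord j x) = - F x) -> trapezoid_error h F = 0.
Proof.
move=> h0 tF oF.
have T0 t : 0 < t -> trapezoid t F = 0.
  move=> t0; have := trapezoid_reflect t j F.
  rewrite (_ : F \o _ = fun x => -1 * F x); last by apply/funext => x; rewrite /= oF mulN1r.
  rewrite /trapezoid (_ : (fun x => -1 * F x) \o _ = (-1) \*o (F \o @lattice_pt R n t))//.
  rewrite lattice_sumZ; last exact: tame_lattice_summable tF.
  by rewrite mulN1r mulrN; move: (_ * _) => z E; lra.
rewrite /trapezoid_error T0// (integral_unique (T := 0) h0 tF) ?subr0//.
under eq_fun do rewrite T0 ?divr_gt0 ?exprn_gt0//.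
exact: cvg_cst.
Qed.

End tame_calculus.

Section homogeneous_kernel.
Variables (R : realType) (n : nat) (d : R) (s0 : 'rV[R]_n -> R).
Hypotheses (n_gt0 : (0 < n)%N) (d0n : 0 < d < n%:R) (s00 : s0 0 = 0)
  (s0_cont : forall x, x != 0 -> {for x, continuous s0})
  (s0_bound : forall j N, exists2 C, 0 <= C &
     derive_bound (~` [set 0]) j N (d - n%:R) C s0)
  (s0_hom : forall t x, 0 < t -> s0 (t *: x) = t `^ (d - n%:R) * s0 x).
Implicit Types (f : 'rV[R]_n -> R) (h : R) (j : 'I_n) (x : 'rV[R]_n).

Let d0 : 0 < d. Proof. by case/andP: d0n. Qed.
Let d0n' : 0 < d <= n%:R. Proof. by case/andP: d0n => -> /ltW ->. Qed.

Lemma s0_norm : exists2 C, 0 <= C & forall x, x != 0 -> `|s0 x| <= C * `|x| `^ (d - n%:R).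
Proof.
have [C C0 bC] := s0_bound (Ordinal n_gt0) 0.
by exists C => // x /eqP; exact: (derive_bound_norm bC).
Qed.

(** The exponent is chosen so that -(d + 1) + (d - n) = -(n + 1): multiplied by the kernel, f
    acquires the decay demanded by [tame]. *)
Definition mild f := (forall x, {for x, continuous f}) /\
  exists2 C, 0 <= C & forall x, far_region x -> `|f x| <= C * `|x| `^ (- (d + 1)).

Lemma mild_tame f : mild f -> tame d (fun x => f x * s0 x).
Proof.
move=> [cf [C C0 fC]]; split; first by rewrite s00 mulr0.
  by move=> x x0; apply: continuousM; [exact: cf|exact: s0_cont].
have [M M0 fM] := bound_near0 cf; have [B B0 sB] := s0_norm.
have dn : - (d + 1) <= 0 by rewrite oppr_le0 addr_ge0// ltW.
pose K := C + M * (1 + 2 `^ (d + 1)).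
have K0 : 0 <= K by rewrite addr_ge0// mulr_ge0// addr_ge0// powR_ge0.
have fK x : x != 0 -> `|f x| <= K /\ `|f x| <= K * `|x| `^ (- (d + 1)).
  move=> /eqP/off0_cover[xn|xf]; split.
  - have x2 : `|x| <= 2 by case/andP: xn => _ /ltW.
    rewrite (le_trans (fM _ x2))// /K mulrDr mulr1 addrCA lerDl addr_ge0//.
    by rewrite mulr_ge0// powR_ge0.
  - have x2 : forall x, `|x| <= 2 -> `|f x| <= M by [].
    rewrite (le_trans (bound_powR_near0 dn M0 x2 xn))// ler_wpM2r ?powR_ge0// opprK.
    by rewrite /K mulrDr mulr1 addrA lerDr addr_ge0.
  - rewrite (le_trans (fC _ xf))// (@le_trans _ _ C)//.
      by rewrite ler_piMr// powR_le1_far.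
    by rewrite /K lerDl mulr_ge0// addr_ge0// powR_ge0.
  - rewrite (le_trans (fC _ xf))// ler_wpM2r ?powR_ge0//.
    by rewrite /K lerDl mulr_ge0// addr_ge0// powR_ge0.
exists (K * B) => x x0; have [f1 f2] := fK x x0; have s1 := sB x x0.
rewrite !normrM; split; first by rewrite -mulrA ler_pM.
have -> : - (n%:R + 1) = - (d + 1) + (d - n%:R) by ring.
by rewrite powRD_gt0 ?normr_gt0// mulrACA ler_pM.
Qed.

Lemma mildD f1 f2 : mild f1 -> mild f2 -> mild (fun x => f1 x + f2 x).
Proof.
move=> [c1 [C1 C10 H1]] [c2 [C2 C20 H2]]; split.
  by move=> x; apply: continuousD; [exact: c1|exact: c2].
exists (C1 + C2); first exact: addr_ge0.
by move=> x xf; rewrite (le_trans (ler_normD _ _))// mulrDl lerD// ?H1 ?H2.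
Qed.

Lemma mildZ c f : mild f -> mild (fun x => c * f x).
Proof.
move=> [cf [C C0 H]]; split.
  by move=> x; apply: continuousM; [exact: cst_continuous|exact: cf].
exists (`|c| * C); first exact: mulr_ge0.
by move=> x xf; rewrite normrM -mulrA ler_wpM2l// H.
Qed.

Lemma rapidly_decaying_mild f : rapidly_decaying 0 f -> mild f.
Proof.
move=> df; split=> [x|]; first exact: (Ck_on_continuous (proj1 df) I).
have [C C0 bC] := rapidly_decaying_far (Ordinal n_gt0) (- (d + 1)) df.
by exists C => // x xf; exact: (derive_bound_norm bC).
Qed.

Lemma word_continuous (w : seq 'I_n) x : {for x, continuous (@word R n w)}.
Proof.
elim: w => [|i w IH].
  by rewrite (_ : word [::] = cst 1); [exact: cst_continuous|apply/funext => y; rewrite /word big_nil].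
rewrite (_ : word (i :: w) = fun y : 'rV[R]_n => y 0 i * word w y); last first.
  by apply/funext => y; rewrite /word big_cons.
by apply: continuousM; [exact: coord_continuous|exact: IH].
Qed.

Lemma homothety_continuous (l : R) f x : {for l *: x, continuous f} ->
  {for x, continuous (fun y : 'rV[R]_n => f (l *: y))}.
Proof.
move=> cf; apply: (@continuous_comp _ _ _ (fun y : 'rV[R]_n => l *: y) f x _ cf).
exact: (@scaler_continuous R 'rV[R]_n l x).
Qed.

End homogeneous_kernel.

Lemma archimedean_nat (R : realType) (x : R) : exists N : nat, x < N%:R.
Proof.
exists (Num.Def.archi_bound `|x|); apply: le_lt_trans (ler_norm x) _.
exact: archi_boundP.
Qed.

Lemma word_homothety (R : realType) (n : nat) (w : seq 'I_n) (l : R) (x : 'rV[R]_n) :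
  word w (l *: x) = l ^+ size w * word w x.
Proof.
rewrite /word; elim: w => [|i w IH]; first by rewrite !big_nil expr0 mulr1.
by rewrite !big_cons IH mxE exprS; ring.
Qed.

Lemma tame_homothety (R : realType) (n : nat) (d l : R) (F : 'rV[R]_n -> R) :
  0 < l -> tame d F -> tame d (fun x => F (l *: x)).
Proof.
move=> l0 [F0 cF [A FA]].
have lx0 (x : 'rV[R]_n) : x != 0 -> l *: x != 0 by move=> x0; rewrite scaler_eq0 (gt_eqF l0).
split; first by rewrite scaler0.
  by move=> x /lx0 x0; apply: homothety_continuous; exact: cF.
exists (`|A| * (l `^ (d - n%:R) + l `^ (- (n%:R + 1)))) => x x0.
have [F1 F2] := FA _ (lx0 _ x0).
have H (a b : R) : `|F (l *: x)| <= A * `|l *: x| `^ a ->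
    `|F (l *: x)| <= `|A| * (l `^ a + l `^ b) * `|x| `^ a.
  have E : `|l *: x| `^ a = l `^ a * `|x| `^ a.
    by rewrite normrZ gtr0_norm// powRM ?(ltW l0).
  rewrite E mulrA; move/le_trans; apply; rewrite ler_wpM2r ?powR_ge0//.
  rewrite (@le_trans _ _ (`|A| * l `^ a))//.
    by rewrite ler_wpM2r ?powR_ge0// ler_norm.
  by rewrite ler_wpM2l// lerDl powR_ge0.
by split; [exact: H|rewrite (addrC (l `^ _)); exact: H].
Qed.

Section moments.
Variables (R : realType) (n : nat) (d : R) (s0 : 'rV[R]_n -> R).
Hypotheses (n_gt0 : (0 < n)%N) (d0n : 0 < d < n%:R) (s00 : s0 0 = 0)
  (s0_cont : forall x, x != 0 -> {for x, continuous s0})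
  (s0_bound : forall j N, exists2 C, 0 <= C &
     derive_bound (~` [set 0]) j N (d - n%:R) C s0)
  (s0_hom : forall t x, 0 < t -> s0 (t *: x) = t `^ (d - n%:R) * s0 x).
Implicit Types (f : 'rV[R]_n -> R) (h : R) (j : 'I_n) (x : 'rV[R]_n) (w : seq 'I_n).
Variables (g : 'rV[R]_n -> R) (r : nat).
Hypotheses (g_decay : forall N, rapidly_decaying N g) (g_flat : taylor r g = fun=> 1)
  (r_gt0 : (0 < r)%N).

Let d0 : 0 < d. Proof. by case/andP: d0n. Qed.
Let d0n' : 0 < d <= n%:R. Proof. by case/andP: d0n => -> /ltW ->. Qed.
Local Notation off0 := (~` [set (0 : 'rV[R]_n)]).

(** F is tame with the exponent d of the kernel, while the rate q comes from the power bounds on F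
    and may be much larger. *)
Lemma product_error q N : 0 < q -> q < N%:R -> exists2 C, 0 <= C &
  forall F A, tame d F -> 0 <= A -> (forall j, derive_bound off0 j N (q - n%:R) A F) ->
  forall h, 0 < h -> `|trapezoid_error h F| <= C * A * h `^ q.
Proof.
move=> q0 qN; have [C C0 HC] := @quadrature_error R n q N q0 qN.
exists C => // F A tF A0 bF h h0; apply: (HC d) => //.
  by move=> x /eqP; exact: (derive_bound_norm (bF (Ordinal n_gt0))).
apply: derive_bound_diff_bound => //.
by rewrite (le_trans (ltW qN))// lerDr.
Qed.

Definition moment_integrand w x : R := word w x * g x * s0 x.

Lemma mild_word w : mild d (fun x => word w x * g x).
Proof.
split=> [x|].
  apply: continuousM; first exact: word_continuous.
  exact: (Ck_on_continuous (proj1 (g_decay 0)) I).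
have [C C0 bC] := word_flat_far g_decay (Ordinal n_gt0) 0 (- (d + 1)) w.
by exists C => // x xf; exact: (derive_bound_norm bC).
Qed.

Lemma tame_moment w : tame d (moment_integrand w).
Proof. exact: (mild_tame n_gt0 d0n s00 s0_cont s0_bound (mild_word w)). Qed.

(** The minus sign is there because [trapezoid_error] is rule minus integral, the opposite of the
    difference in c_i(h). *)
Definition moment w h : R :=
  (h `^ ((size w)%:R + d))^-1 * - trapezoid_error h (moment_integrand w).

(** g(l x) - 1 inherits the bound of g - 1 with an additional factor l^r <= 1, so A can be taken
    independent of l. *)
Lemma moment_difference_bound w N : exists2 A, 0 <= A &
  forall (l : R) j, 0 < l <= 1 ->
  derive_bound off0 j N ((size w)%:R + r%:R + d - n%:R) A
    (fun x => word w x * (g x - g (l *: x)) * s0 x).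
Proof.
have off0P := @off0_neq0 R n.
have /choice[A HA] j : exists A, 0 <= A /\ forall l, 0 < l <= 1 ->
    derive_bound off0 j N ((size w)%:R + r%:R + d - n%:R) A
      (fun x => word w x * (g x - g (l *: x)) * s0 x).
  have [B B0 bB] := flat_derive_bound g_decay g_flat j N.
  have [W W0 bW] := derive_bound_word j N w off0P.
  have [S S0 bS] := s0_bound j N.
  exists (2 ^+ N * (2 ^+ N * (W * (B + B)) * S)); split.
    by rewrite !mulr_ge0 ?exprn_ge0// addr_ge0.
  move=> l /andP[l0 l1].
  have bl : derive_bound off0 j N r%:R (B + B) (fun x => g x - g (l *: x)).
    have := derive_bound_homothety l0 _ bB => /(_ _)/wrap[|bl].
      by move=> x /= /eqP x0; apply/eqP; rewrite scaler_eq0 (gt_eqF l0).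
    have := derive_boundD bB (derive_boundZ (-1) bl).
    rewrite (_ : (fun x => _) = fun x => g x - g (l *: x)); last by apply/funext => x; ring.
    have lr1 : l `^ r%:R <= 1 by rewrite powR_mulrn ?exprn_ile1 ?(ltW l0).
    by apply: derive_bound_le; rewrite normrN1 mul1r lerD2l ler_piMr.
  have := derive_boundM off0P W0 (addr_ge0 B0 B0) bW bl.
  move=> bwl; have := derive_boundM off0P _ S0 bwl bS => /(_ _)/wrap[|].
    by rewrite !mulr_ge0 ?exprn_ge0// addr_ge0.
  by rewrite addrA.
exists (\sum_j A j); first by apply: sumr_ge0 => j _; case: (HA j).
move=> l j l01; apply: derive_bound_le (proj2 (HA j) l l01).
by rewrite (bigD1 j)//= lerDl sumr_ge0// => i _; case: (HA i).
Qed.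

Lemma moment_cauchy w : exists2 C, 0 <= C &
  forall (l h : R), 0 < l <= 1 -> 0 < h -> `|moment w (l * h) - moment w h| <= C * h ^+ r.
Proof.
pose q : R := (size w)%:R + r%:R + d.
have q0 : 0 < q by rewrite ltr_wpDl.
have [N qN] := archimedean_nat q.
have [C C0 HC] := product_error q0 qN.
have [A A0 HA] := moment_difference_bound w N.
exists (C * A); first exact: mulr_ge0.
move=> l h l01 h0; have /andP[l0 l1] := l01.
pose F := moment_integrand w.
(* By homogeneity of the kernel and the monomial, c F(l x) = - x^w g(l x) s(x). *)
pose c : R := - (l `^ (n%:R - (size w)%:R - d)).
have E : (fun x => word w x * (g x - g (l *: x)) * s0 x) = fun x => F x + c * F (l *: x).
  apply/funext => x; rewrite /F /moment_integrand word_homothety s0_hom// /c.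
  have : l `^ (n%:R - (size w)%:R - d) * l ^+ size w * l `^ (d - n%:R) = 1.
    by rewrite -powR_mulrn ?ltW// -!powRD_gt0//
      (_ : _ - _ - d + _ + _ = 0) ?powRr0//; ring.
  set u := l `^ _; set v := l ^+ _; set z := l `^ _ => uvz.
  rewrite (_ : _ * (v * _ * _ * _) = - (u * v * z) * (word w x * g (l *: x) * s0 x)); last by ring.
  by rewrite uvz; ring.
have tF : tame d F := tame_moment w.
have tFl : tame d (fun x => c * F (l *: x)) by apply: tameZ; exact: tame_homothety.
have := HC _ A _ A0 (fun j => HA l j l01) h h0.
rewrite E => /(_ (tameD tF tFl)).
rewrite (trapezoid_errorD d0n' h0 tF tFl) (trapezoid_errorZ d0n')//; last exact: tame_homothety.
rewrite (trapezoid_error_homothety d0n' l0 h0 tF); last exact: tame_homothety.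
rewrite /moment -/F; set e1 := trapezoid_error h F; set e2 := trapezoid_error (l * h) F => H.
pose a : R := (size w)%:R + d.
have ha0 : 0 < h `^ a by exact: powR_gt0.
have la0 : 0 < l `^ a by exact: powR_gt0.
have -> : ((l * h) `^ a)^-1 * - e2 - (h `^ a)^-1 * - e1 =
    (h `^ a)^-1 * (e1 + c * (l ^- n * e2)).
  have -> : c * (l ^- n * e2) = - ((l `^ a)^-1 * e2).
    rewrite /c mulNr mulrA; congr (- (_ * _)).
    by rewrite -powR_mulrn ?ltW// -!powRN -powRD_gt0//; congr (_ `^ _); rewrite /a; ring.
  by rewrite powRM ?ltW//; field; rewrite !gt_eqF.
have hq : h `^ q = h `^ a * h ^+ r.
  by rewrite -powR_mulrn ?ltW// -powRD_gt0//; congr (_ `^ _); rewrite /q /a; ring.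
rewrite normrM ger0_norm ?invr_ge0 ?(ltW ha0)// ler_pdivrMl// (le_trans H)// hq.
by rewrite mulrCA.
Qed.

(* The limit is the supremum of the lower bounds c(h) - C h^r. *)
Lemma moment_limit w : exists c C, 0 <= C /\
  forall h, 0 < h -> `|moment w h - c| <= C * h ^+ r.
Proof.
have [C C0 HC] := moment_cauchy w.
have H h h' : 0 < h -> 0 < h' -> moment w h - C * h ^+ r <= moment w h' + C * h' ^+ r.
  have K t t' : 0 < t -> t <= t' -> `|moment w t - moment w t'| <= C * t' ^+ r.
    move=> t0 tt'; have t'0 : 0 < t' by exact: lt_le_trans tt'.
    have := HC (t / t') t'; rewrite divfK ?gt_eqF//; apply => //.
    by rewrite divr_gt0// ler_pdivrMr// mul1r.
  move=> h0 h'0; have Ch : 0 <= C * h ^+ r by rewrite mulr_ge0// exprn_ge0// ltW.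
  have Ch' : 0 <= C * h' ^+ r by rewrite mulr_ge0// exprn_ge0// ltW.
  have [hh'|h'h] := leP h h'; [have := K _ _ h0 hh'|have := K _ _ h'0 (ltW h'h)];
    rewrite ler_norml => /andP[]; lra.
pose S := [set y | exists2 h, 0 < h & y = moment w h - C * h ^+ r].
have S0 : S !=set0 by exists (moment w 1 - C * 1 ^+ r), 1.
have Sub h : 0 < h -> ubound S (moment w h + C * h ^+ r).
  by move=> h0 _ [h' h'0 ->]; exact: H.
exists (sup S), C; split=> // h h0.
have h1 : sup S <= moment w h + C * h ^+ r by apply: ge_sup => //; exact: Sub.
have h2 : moment w h - C * h ^+ r <= sup S.
  apply: ub_le_sup; last by exists h.
  by exists (moment w 1 + C * 1 ^+ r); exact: Sub.
by rewrite ler_norml; lra.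
Qed.

Lemma remainder_error phi N : (r <= N)%N -> r%:R + d < N%:R -> rapidly_decaying N phi ->
  exists2 C, 0 <= C & forall h, 0 < h ->
    `|trapezoid_error h (fun x => (phi x - taylor r phi x * g x) * s0 x)| <= C * h `^ (r%:R + d).
Proof.
move=> rN qN dphi; have q0 : 0 < r%:R + d by rewrite ltr_wpDl.
have [C C0 HC] := product_error q0 qN.
have /choice[A HA] j : exists A, 0 <= A /\ derive_bound off0 j N (r%:R + d - n%:R) A
    (fun x => (phi x - taylor r phi x * g x) * s0 x).
  have [B B0 bB] := remainder_derive_bound g_decay g_flat j rN dphi.
  have [S S0 bS] := s0_bound j N.
  exists (2 ^+ N * (B * S)); split; first by rewrite !mulr_ge0// exprn_ge0.
  by have := derive_boundM (@off0_neq0 R n) B0 S0 bB bS; rewrite addrA.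
have A0 : 0 <= \sum_j A j by apply: sumr_ge0 => j _; case: (HA j).
exists (C * \sum_j A j); first exact: mulr_ge0.
move=> h h0; apply: HC => //; last first.
  move=> j; apply: derive_bound_le (proj2 (HA j)).
  by rewrite (bigD1 j)//= lerDl sumr_ge0// => i _; case: (HA i).
apply: (mild_tame n_gt0 d0n s00 s0_cont s0_bound).
have dphi0 : rapidly_decaying 0 phi.
  split; first exact: Ck_on_leq (proj1 dphi).
  by move=> j k M; rewrite leqn0 => /eqP ->; exact: (proj2 dphi).
have [l [_ Tl]] := taylor_words r phi.
have : mild d (fun x => phi x + (-1) * \sum_(p <- l) p.1 * (word p.2 x * g x)).
  apply: mildD; first exact: rapidly_decaying_mild.
  apply: mildZ; elim: l {Tl} => [|[c w] l IH].
    rewrite (_ : (fun x => _) = fun x => 0 * (word [::] x * g x)); last first.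
      by apply/funext => x; rewrite big_nil mul0r.
    by apply: mildZ; exact: mild_word.
  rewrite (_ : (fun x => _) = fun x => c * (word w x * g x) +
    \sum_(p <- l) p.1 * (word p.2 x * g x)); last by apply/funext => x; rewrite big_cons.
  by apply: mildD => //; apply: mildZ; exact: mild_word.
congr mild; apply/funext => x; under eq_bigr do rewrite mulrA.
by rewrite -mulr_suml -Tl mulN1r.
Qed.

End moments.

(** * Parity *)

Section parity.
Variables (R : realType) (n kappa : nat).
Hypothesis kappa_n : (kappa <= n)%N.
Implicit Types (w : seq 'I_n) (x : 'rV[R]_n) (l j : 'I_n) (b eta : 'rV[int]_n).

Lemma word_count w x : word w x = \prod_l x 0 l ^+ count_mem l w.
Proof.
rewrite /word; elim: w => [|i w IH] /=; first by rewrite big_nil big1.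
rewrite big_cons IH; under [RHS]eq_bigr do rewrite exprD.
rewrite big_split/= -IH; congr (_ * _); rewrite (bigD1 i)//= eqxx expr1.
rewrite (eq_bigr (fun=> 1)) ?big1_eq ?mulr1// => l.
by rewrite eq_sym => /negbTE ->.
Qed.

Lemma size_count w : size w = (\sum_l count_mem l w)%N.
Proof.
elim: w => [|i w IH] /=; first by rewrite big1.
rewrite big_split/= -IH -[LHS]add1n; congr (_ + _)%N.
by rewrite (bigD1 i)//= eqxx big1// => l; rewrite eq_sym => /negbTE ->.
Qed.

Definition grid_word eta : seq 'I_n :=
  flatten [seq nseq (exponent kappa eta l) l | l <- enum 'I_n].

Lemma count_grid_word eta l : count_mem l (grid_word eta) = exponent kappa eta l.
Proof.
rewrite /grid_word count_flatten -map_comp sumnE big_map big_enum/= (bigD1 l)//=.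
rewrite count_nseq/= eqxx mul1n big1 ?addn0// => i il.
by rewrite count_nseq/= (negbTE il).
Qed.

Lemma word_monomial p eta x : nonneg_grid kappa p eta ->
  monomial (moment_exponent kappa eta) x = word (grid_word eta) x.
Proof.
by move=> Ge; rewrite (monomial_grid _ Ge) word_count; apply: eq_bigr => l _; rewrite count_grid_word.
Qed.

Lemma sum_lt_kappa : (\sum_(l < n) (l < kappa) = kappa)%N.
Proof.
have H k : (\sum_(l < k) (l < kappa) = minn k kappa)%N.
  elim: k => [|k IH]; first by rewrite big_ord0 min0n.
  by rewrite big_ord_recr/= IH; case: (ltnP k kappa) => /= ?; lia.
by rewrite H; exact/minn_idPr.
Qed.

Lemma size_grid_word p eta : nonneg_grid kappa p eta ->
  (size (grid_word eta) + kappa = 2 * norm1 eta)%N.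
Proof.
move=> /nonneg_gridP[_ _ ek]; rewrite size_count -[X in (_ + X)%N]sum_lt_kappa -big_split/=.
rewrite norm1E big_distrr/=; apply: eq_bigr => l _; rewrite count_grid_word /exponent.
by have := ek l; case: (l < kappa)%N => /= [/(_ isT)|_]; lia.
Qed.

(** Words with the parity pattern of the kernel: their product with it is even in every
    coordinate. *)
Definition matched w := [forall l : 'I_n, odd (count_mem l w) == (l < kappa)%N].

(** The l-th coordinate of the grid point is half of the count of l in w, plus 1 if l < kappa. Twice
    its 1-norm is thus size w + kappa < 2p + 2, so the 1-norm is at most p: the Taylor degrees below
    r are exactly those that the grid can serve. *)
Lemma matched_grid p w : matched w -> (size w < 2 * p - kappa + 2)%N -> (kappa <= 2 * p)%N ->
  exists eta, [/\ nonneg_grid kappa p eta, size (grid_word eta) = size w &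
    forall x, word w x = word (grid_word eta) x].
Proof.
move=> /forallP mw sw kp.
pose c l := ((count_mem l w + (l < kappa))./2)%N.
pose eta : 'rV[int]_n := \row_l (c l)%:Z.
have cE l : ((c l).*2 = count_mem l w + (l < kappa))%N.
  rewrite /c; have /eqP := mw l; case: (l < kappa)%N => ow; have := odd_double_half (count_mem l w + 1);
    have := odd_double_half (count_mem l w + 0); rewrite !oddD ow /=; lia.
have cabs l : absz (eta ord0 l) = c l by rewrite mxE absz_nat.
have expE l : exponent kappa eta l = count_mem l w by rewrite /exponent cabs cE addnK.
have sE : (size w + kappa = 2 * norm1 eta)%N.
  rewrite size_count -[X in (_ + X)%N]sum_lt_kappa -big_split/= norm1E big_distrr/=.
  by apply: eq_bigr => l _; rewrite cabs mul2n cE.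
have Ge : nonneg_grid kappa p eta.
  apply: nonneg_gridI => [|l|l lk]; [lia|by rewrite mxE|rewrite mxE].
  by have := cE l; rewrite lk; lia.
exists eta; split=> //.
  by have := size_grid_word Ge; lia.
by move=> x; rewrite !word_count; apply: eq_bigr => l _; rewrite count_grid_word expE.
Qed.

Lemma word_reflect w j x : word w (reflect_coord j x) = (-1) ^+ count_mem j w * word w x.
Proof.
rewrite !word_count (bigD1 j)//= [X in _ = _ * X](bigD1 j)//= mulrA mxE eqxx [in LHS]exprNn.
by congr (_ * _); apply: eq_bigr => l lj; rewrite mxE (negbTE lj).
Qed.

Lemma kprod_reflect j b :
  kprod kappa (reflect_int j b) = (-1) ^+ (j < kappa)%N * kprod kappa b.
Proof.
rewrite /kprod; case: (boolP (j < kappa)%N) => jk.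
  rewrite (bigD1 j)//= [X in _ = _ * X](bigD1 j)//= mxE eqxx expr1 mulrA mulN1r.
  by congr (_ * _); apply: eq_bigr => l /andP[_ lj]; rewrite mxE (negbTE lj).
rewrite expr0 mul1r; apply: eq_bigr => l lk; rewrite mxE; case: eqP => // lj.
by rewrite -lj lk in jk.
Qed.

Lemma reflect_orbit eta j : set_bij (sign_orbit eta) (sign_orbit eta) (reflect_int j).
Proof.
have st b : sign_orbit eta b -> sign_orbit eta (reflect_int j b).
  move=> [k ->]; exists (fun i => if i == j then ~~ k i else k i).
  by apply/rowP => i; rewrite !mxE; case: eqP => // _; rewrite signrN mulNr.
split=> //.
- by move=> b c _ _ /(congr1 (reflect_int j)); rewrite !reflect_intK.
- by move=> b bo; exists (reflect_int j b); [exact: st|exact: reflect_intK].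
Qed.

Lemma orbit_sum_odd eta j (F : 'rV[int]_n -> R) :
  (forall b, F (reflect_int j b) = - F b) -> \sum_(b \in sign_orbit eta) F b = 0.
Proof.
move=> oF; have E : \sum_(b \in sign_orbit eta) F b = - \sum_(b \in sign_orbit eta) F b.
  rewrite {1}(reindex_fsbig (reflect_int j) (sign_orbit eta)); last exact: reflect_orbit.
  rewrite (eq_fsbigr (fun b => - F b)); last by move=> b _; exact: oF.
  by rewrite !fsbig_finite/= ?sumrN//; exact: finite_sign_orbit.
lra.
Qed.

Lemma unmatchedP w : ~~ matched w -> exists j : 'I_n, odd (count_mem j w) != (j < kappa)%N.
Proof. by rewrite negb_forall => /existsP. Qed.

Lemma orbit_sum_unmatched w eta : ~~ matched w ->
  \sum_(b \in sign_orbit eta) (Num.sg (kprod kappa b))%:~R * word w (map_mx intr b : 'rV[R]_n) = 0.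
Proof.
move=> /unmatchedP[j jw]; apply: (@orbit_sum_odd eta j) => b.
have -> : map_mx intr (reflect_int j b) = reflect_coord j (map_mx intr b) :> 'rV[R]_n.
  by apply/rowP => i; rewrite !mxE; case: eqP => // _; rewrite intrN.
rewrite kprod_reflect word_reflect -(signr_odd _ (count_mem j w)) sgrM intrM.
move: jw; case: (odd _); case: (j < kappa)%N => //= _;
  by rewrite ?expr0 ?expr1 ?sgrN ?sgr1 ?mulN1r ?mul1r ?mulrN ?mulNr.
Qed.

End parity.

(** * The modified rule *)

Section euclidean_norm.
Variable R : realType.

Lemma enormZ m n (t : R) (A : 'M[R]_(m, n)) : 0 <= t -> enorm (t *: A) = t * enorm A.
Proof.
move=> t0; rewrite /enorm -[t in RHS](ger0_norm t0) -sqrtr_sqr -sqrtrM ?sqr_ge0//.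
congr Num.sqrt; rewrite mulr_sumr; apply: eq_bigr => i _.
by rewrite mulr_sumr; apply: eq_bigr => j _; rewrite mxE exprMn.
Qed.

Lemma enorm_ge0 m n (A : 'M[R]_(m, n)) : 0 <= enorm A.
Proof. exact: sqrtr_ge0. Qed.

Lemma enorm_le_sum m n (A : 'M[R]_(m, n)) : enorm A <= \sum_i \sum_j `|A i j|.
Proof.
have S0 : 0 <= \sum_i \sum_j `|A i j| by apply: sumr_ge0 => i _; exact: sumr_ge0.
rewrite -[leRHS](ger0_norm S0) -sqrtr_sqr ler_wsqrtr//.
rewrite expr2 mulr_suml; apply: ler_sum => i _.
rewrite mulr_suml; apply: ler_sum => j _.
rewrite -real_normK ?num_real// expr2 ler_wpM2l//.
rewrite (bigD1 i)//= (bigD1 j)//= -addrA lerDl addr_ge0//.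
  exact: sumr_ge0.
by apply: sumr_ge0 => k _; exact: sumr_ge0.
Qed.

Lemma mx_norm_le_sum m n (A : 'M[R]_(m, n)) : `|A| <= \sum_i \sum_j `|A i j|.
Proof.
rewrite [leLHS]/Num.Def.normr/= mx_normrE; apply/bigmax_leP; split.
  by apply: sumr_ge0 => i _; exact: sumr_ge0.
move=> [i j] _ /=; rewrite (bigD1 i)//= (bigD1 j)//= -addrA lerDl addr_ge0//.
  exact: sumr_ge0.
by apply: sumr_ge0 => k _; exact: sumr_ge0.
Qed.

Lemma enorm_absz n (h : R) (b c : 'rV[int]_n) : (forall l, absz (b ord0 l) = absz (c ord0 l)) ->
  enorm (lattice_pt h b) = enorm (lattice_pt h c).
Proof.
move=> bc; congr Num.sqrt; apply: eq_bigr => i _; apply: eq_bigr => l _.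
rewrite !mxE !exprMn !(ord1 i); congr (_ * _).
by rewrite -[LHS]real_normK ?num_real// -[RHS]real_normK ?num_real// -!intr_norm -!abszE bc.
Qed.

Lemma enorm_reflect n j (x : 'rV[R]_n) : enorm (reflect_coord j x) = enorm x.
Proof.
congr Num.sqrt; apply: eq_bigr => i _; apply: eq_bigr => l _; rewrite !mxE !(ord1 i).
by case: eqP; rewrite ?sqrrN.
Qed.

End euclidean_norm.

Section kernel.
Variables (R : realType) (n : nat).
Local Notation mu := (lebesgue_Rn R n).
Hypothesis n_gt0 : (0 < n)%N.
Implicit Types (s f F G : 'rV[R]_n -> R) (x : 'rV[R]_n).

(** The value of the kernel at 0 is arbitrary; setting it to 0 turns punctured sums into full
    lattice sums and, for n > 0, leaves integrals unchanged. *)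
Definition zero_at0 s : 'rV[R]_n -> R := fun x => if x == 0 then 0 else s x.

Lemma zero_at0_neq0 s x : x != 0 -> zero_at0 s x = s x.
Proof. by rewrite /zero_at0 => /negbTE ->. Qed.

Lemma zero_at0_0 s : zero_at0 s 0 = 0. Proof. by rewrite /zero_at0 eqxx. Qed.

Lemma near_zero_at0 s x : x != 0 -> \forall y \near x, zero_at0 s y = s y.
Proof.
move=> x0; have : \forall y \near x, (~` [set 0]) y.
  by apply: open_nbhs_nbhs; split; [exact: open_off0|exact/eqP].
by apply: filterS => y /eqP; exact: zero_at0_neq0.
Qed.

Lemma continuous_zero_at0 s x : x != 0 -> {for x, continuous s} -> {for x, continuous (zero_at0 s)}.
Proof.
move=> x0 cs; rewrite /prop_for /continuous_at zero_at0_neq0//.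
apply: cvg_trans cs; apply: (@near_eq_cvg _ _ (nbhs x) (nbhs_filter x)).
by apply: filterS (near_zero_at0 s x0) => y ->.
Qed.

Lemma punctured_trapezoidalE h F G : 0 < h -> G 0 = 0 -> (forall x, x != 0 -> F x = G x) ->
  punctured_trapezoidal h F = trapezoid h G.
Proof.
move=> h0 G0 FG; rewrite /punctured_trapezoidal real_sum_punctured; congr (_ * lattice_sum _).
apply/funext => b; rewrite /=; case: eqVneq => [->|b0].
  by rewrite /lattice_pt map_mx0 scaler0 G0.
by rewrite FG// lattice_pt_eq0.
Qed.

Lemma Rintegral_off0E F G : G 0 = 0 -> (forall x, x != 0 -> F x = G x) ->
  \int[mu]_(x in ~` [set 0]) F x = \int[mu]_x G x.
Proof.
move=> G0 FG; rewrite Rintegral_mkcond; apply: eq_Rintegral => x _.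
rewrite patchE; have [->|x0] := eqVneq x 0; first by rewrite memNset//= => /(_ erefl).
by rewrite mem_set ?FG//; exact/eqP.
Qed.

Lemma lebesgue_Rn_point : mu [set 0] = 0%E.
Proof.
rewrite (_ : [set 0] = [set x : 'rV[R]_n | forall i, [set (0 : R)] (x 0 i)]); last first.
  apply/seteqP; split=> x /=; first by move=> -> i; rewrite mxE.
  by move=> x0; apply/rowP => i; rewrite mxE x0.
rewrite (lebesgue_Rn_box (A := fun=> [set (0 : R)]))//.
rewrite (bigD1 (Ordinal n_gt0))//= lebesgue_measure_set1 mul0e; by [].
Qed.

(** F and G differ at most at the origin, a null set as n > 0. F is measurable because it inherits
    the continuity of G off 0. *)
Lemma Rintegral_punctureE F G : (forall x, x != 0 -> {for x, continuous G}) -> G 0 = 0 ->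
  (forall x, x != 0 -> F x = G x) -> \int[mu]_x F x = \int[mu]_x G x.
Proof.
move=> cG G0 FG.
have GF : G = zero_at0 F.
  apply/funext => x; have [->|x0] := eqVneq x 0; first by rewrite G0 zero_at0_0.
  by rewrite zero_at0_neq0// FG.
have cF x : x != 0 -> {for x, continuous F}.
  move=> x0; have := cG x x0; rewrite GF /prop_for /continuous_at zero_at0_neq0// => cg.
  apply: cvg_trans cg; apply: (@near_eq_cvg _ _ (nbhs x) (nbhs_filter x)).
  by apply: filterS (near_zero_at0 F x0) => y ->.
have mF := continuous_off0_measurable cF; have mG := continuous_off0_measurable cG.
congr fine; apply: ae_eq_integral => //; [exact/measurable_EFinP|exact/measurable_EFinP|].
exists [set 0]; split; first 2 last.
- by move=> x /=; apply: contra_notP => /eqP x0 _; rewrite FG.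
- rewrite (_ : [set 0] = [set x : 'rV[R]_n | forall i, [set (0 : R)] (x 0 i)]).
    by apply: (measurable_box (A := fun=> [set (0 : R)])) => i; exact: measurable_set1.
  apply/seteqP; split=> x /=; first by move=> -> i; rewrite mxE.
  by move=> x0; apply/rowP => i; rewrite mxE x0.
- exact: lebesgue_Rn_point.
Qed.

Lemma dilation_homogeneous d s t x : dilation d s -> 0 < t -> x != 0 ->
  s (t *: x) = t `^ (d - n%:R) * s x.
Proof.
move=> [rho [_ _ sE]] t0 x0.
have tx0 : t *: x != 0 by rewrite scaler_eq0 (gt_eqF t0).
rewrite !sE// enormZ ?ltW// powRM ?enorm_ge0 ?(ltW t0)// mulrA; congr (_ * rho _).
by rewrite scalerA invfM mulrAC mulVf ?mul1r// gt_eqF.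
Qed.

Lemma zero_at0_homogeneous d s t x : dilation d s -> 0 < t ->
  zero_at0 s (t *: x) = t `^ (d - n%:R) * zero_at0 s x.
Proof.
move=> ds t0; have [->|x0] := eqVneq x 0; first by rewrite scaler0 zero_at0_0 mulr0.
by rewrite !zero_at0_neq0 ?scaler_eq0 ?(gt_eqF t0)//; exact: dilation_homogeneous.
Qed.

Lemma zero_at0_derive_bound d s j N : smooth_on (~` [set 0]) s -> dilation d s ->
  exists2 C, 0 <= C & derive_bound (~` [set 0]) j N (d - n%:R) C (zero_at0 s).
Proof.
move=> Ss ds; have hs (t : R) (x : 'rV[R]_n) (t0 : 0 < t) (x0 : x != 0) :=
  dilation_homogeneous ds t0 x0.
have [C C0 bC] := homogeneous_derive_bound j (Ss N) hs.
exists C => //; apply: derive_bound_congr bC; first exact: open_off0.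
by move=> x /eqP x0; rewrite zero_at0_neq0.
Qed.

Lemma reflect_coord_eq0 j (x : 'rV[R]_n) : (reflect_coord j x == 0) = (x == 0).
Proof.
apply/eqP/eqP => [/rowP E|->]; apply/rowP => i.
  by have := E i; rewrite !mxE; case: eqP => // _ /eqP; rewrite oppr_eq0 => /eqP.
by rewrite !mxE oppr0 if_same.
Qed.

Lemma zero_at0_symmetric kappa s j x : symmetric_kernel kappa s ->
  zero_at0 s (reflect_coord j x) = (-1) ^+ (j < kappa)%N * zero_at0 s x.
Proof.
move=> ss; rewrite /zero_at0 reflect_coord_eq0; case: eqVneq => [|x0]; first by rewrite mulr0.
by rewrite (ss x x0 j); case: (j < kappa)%N; rewrite /= ?expr1 ?mulN1r ?opprK ?expr0 ?mul1r.
Qed.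

End kernel.

Lemma rapidly_decaying_le (R : realType) n (k N : nat) (u : 'rV[R]_n -> R) : (k <= N)%N ->
  rapidly_decaying N u -> rapidly_decaying k u.
Proof.
move=> kN [Cu du]; split; first exact: Ck_on_leq Cu.
by move=> j l M lk; apply: du; exact: leq_trans kN.
Qed.

Section modified_rule.
Variables (R : realType) (n : nat) (d : R) (s0 : 'rV[R]_n -> R).
Hypotheses (n_gt0 : (0 < n)%N) (d0n : 0 < d < n%:R) (s00 : s0 0 = 0)
  (s0_cont : forall x : 'rV[R]_n, x != 0 -> {for x, continuous s0})
  (s0_bound : forall j N, exists2 C : R, 0 <= C &
     derive_bound (~` [set 0]) j N (d - n%:R) C s0)
  (s0_hom : forall (t : R) (x : 'rV[R]_n), 0 < t -> s0 (t *: x) = t `^ (d - n%:R) * s0 x).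
Variables (kappa p : nat).
Hypotheses (kappa_n : (kappa <= n)%N) (kappa_2p : (kappa <= 2 * p)%N)
  (s0_sym : forall j x, s0 (reflect_coord j x) = (-1) ^+ (j < kappa)%N * s0 x).
Local Notation r := (2 * p - kappa + 2)%N.
Variable g : 'rV[R]_n -> R.
Hypotheses (g_decay : forall N, rapidly_decaying N g) (g_flat : taylor r g = fun=> 1)
  (g_radial : radial g) (g0 : g 0 = 1).
Variables (m : nat) (xi : 'I_m -> 'rV[int]_n).
Hypothesis xi_enum : set_bij setT (nonneg_grid kappa p) xi.
Implicit Types (f : 'rV[R]_n -> R) (h : R) (j : 'I_n) (x : 'rV[R]_n) (w : seq 'I_n)
  (b eta : 'rV[int]_n).

Let d0n' : 0 < d <= n%:R. Proof. by case/andP: d0n => -> /ltW ->. Qed.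
Let r_gt0 : (0 < r)%N. Proof. by rewrite addn2. Qed.
Let xi_grid i : nonneg_grid kappa p (xi i).
Proof. by case: xi_enum => xi_fun _ _; exact: xi_fun. Qed.

Lemma g_sub1_norm : exists2 C, 0 <= C & forall x, `|g x - 1| <= C * `|x| ^+ r.
Proof.
have [C C0 /derive_bound_norm bC] :=
  flat_derive_bound g_decay g_flat (Ordinal n_gt0) 0.
exists C => // x; have [->|/eqP x0] := eqVneq x 0.
  by rewrite g0 subrr normr0 mulr_ge0// exprn_ge0.
by rewrite -powR_mulrn//; exact: bC.
Qed.

Lemma norm_lattice_pt h b : 0 < h -> `|lattice_pt h b| = h * `|map_mx intr b : 'rV[R]_n|.
Proof. by move=> h0; rewrite /lattice_pt normrZ gtr0_norm. Qed.

Lemma g_grid_bound : exists2 D, 0 <= D &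
  forall h i, 0 < h -> `|g (lattice_pt h (xi i)) - 1| <= D * h ^+ r.
Proof.
have [C C0 bC] := g_sub1_norm.
pose T i := C * `|map_mx intr (xi i) : 'rV[R]_n| ^+ r.
have T0 i : 0 <= T i by rewrite mulr_ge0// exprn_ge0.
exists (\sum_i T i); first exact: sumr_ge0.
move=> h i h0; apply: (le_trans (bC _)); rewrite norm_lattice_pt// exprMn mulrCA mulrC.
rewrite ler_wpM2r ?exprn_ge0 ?(ltW h0)// (bigD1 i)//= lerDl; exact: sumr_ge0.
Qed.

Lemma g_orbit h i b : sign_orbit (xi i) b -> g (lattice_pt h b) = g (lattice_pt h (xi i)).
Proof. by move=> /sign_orbit_absz bE; apply: g_radial; exact: enorm_absz. Qed.

Definition orbit_sum eta h f : R :=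
  \sum_(b \in sign_orbit eta) (Num.sg (kprod kappa b))%:~R * f (lattice_pt h b).

Lemma orbit_sumD eta h f1 f2 :
  orbit_sum eta h (fun x => f1 x + f2 x) = orbit_sum eta h f1 + orbit_sum eta h f2.
Proof.
rewrite /orbit_sum -fsbig_split/=; last exact: finite_sign_orbit.
by apply: eq_fsbigr => b _; rewrite mulrDr.
Qed.

Lemma orbit_sumZ eta h c f : orbit_sum eta h (fun x => c * f x) = c * orbit_sum eta h f.
Proof.
rewrite /orbit_sum !(fsbig_finite _ _ (finite_sign_orbit eta))/= mulr_sumr.
by apply: eq_bigr => b _; rewrite mulrCA.
Qed.

Variable wbar : 'cV[R]_m.

Definition rule_error h f : R := trapezoid_error h (fun x => f x * s0 x) +
  h `^ d * \sum_i wbar i 0 * orbit_sum (xi i) h f.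

Lemma rule_errorD h f1 f2 : 0 < h -> mild d f1 -> mild d f2 ->
  rule_error h (fun x => f1 x + f2 x) = rule_error h f1 + rule_error h f2.
Proof.
move=> h0 m1 m2; rewrite /rule_error.
have t1 := mild_tame n_gt0 d0n s00 s0_cont s0_bound m1.
have t2 := mild_tame n_gt0 d0n s00 s0_cont s0_bound m2.
rewrite addrACA -(trapezoid_errorD d0n')// -mulrDr -big_split/=; congr (_ + _ * _).
  by congr trapezoid_error; apply/funext => x; rewrite mulrDl.
by apply: eq_bigr => i _; rewrite orbit_sumD mulrDr.
Qed.

Lemma rule_errorZ h c f : 0 < h -> mild d f ->
  rule_error h (fun x => c * f x) = c * rule_error h f.
Proof.
move=> h0 m1; rewrite /rule_error.
have t1 := mild_tame n_gt0 d0n s00 s0_cont s0_bound m1.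
rewrite mulrDr -(trapezoid_errorZ d0n')//; congr (_ + _).
  by congr trapezoid_error; apply/funext => x; rewrite mulrA.
rewrite mulrCA; congr (_ * _); rewrite mulr_sumr; apply: eq_bigr => i _.
by rewrite orbit_sumZ mulrCA.
Qed.

Lemma rule_error_words h (l : seq (R * seq 'I_n)) : 0 < h ->
  rule_error h (fun x => \sum_(q <- l) q.1 * (word q.2 x * g x)) =
  \sum_(q <- l) q.1 * rule_error h (fun x => word q.2 x * g x) /\
  mild d (fun x => \sum_(q <- l) q.1 * (word q.2 x * g x)).
Proof.
move=> h0; elim: l => [|q l [IH ml]].
  have -> : (fun x => \sum_(q <- [::]) q.1 * (word q.2 x * g x)) =
            (fun x : 'rV[R]_n => 0 * (word [::] x * g x)).
    by apply/funext => x; rewrite big_nil mul0r.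
  have m0 := mild_word d n_gt0 g_decay [::].
  by split; [rewrite rule_errorZ// mul0r big_nil|exact: mildZ].
have -> : (fun x => \sum_(q <- q :: l) q.1 * (word q.2 x * g x)) =
   (fun x => q.1 * (word q.2 x * g x) + \sum_(q <- l) q.1 * (word q.2 x * g x)).
  by apply/funext => x; rewrite big_cons.
have mq := mild_word d n_gt0 g_decay q.2.
split; last by apply: mildD => //; exact: mildZ.
by rewrite rule_errorD ?rule_errorZ ?big_cons ?IH//; exact: mildZ.
Qed.

Lemma orbit_sum_word h w i : orbit_sum (xi i) h (fun x => word w x * g x) =
  h ^+ size w * g (lattice_pt h (xi i)) *
  \sum_(b \in sign_orbit (xi i)) (Num.sg (kprod kappa b))%:~R * word w (map_mx intr b : 'rV[R]_n).
Proof.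
rewrite /orbit_sum !(fsbig_finite _ _ (finite_sign_orbit (xi i)))/= mulr_sumr.
rewrite big_seq [RHS]big_seq; apply: eq_bigr => b; rewrite in_fset_set; last exact: finite_sign_orbit.
by move=> /set_mem/g_orbit ->; rewrite {1}/lattice_pt word_homothety; ring.
Qed.

Lemma rule_error_unmatched h w : 0 < h -> ~~ matched kappa w ->
  rule_error h (fun x => word w x * g x) = 0.
Proof.
move=> h0 uw; have [j jw] := unmatchedP uw; rewrite /rule_error.
have tw := tame_moment n_gt0 d0n s00 s0_cont s0_bound g_decay w.
have odd_w x : moment_integrand s0 g w (reflect_coord j x) = - moment_integrand s0 g w x.
  rewrite /moment_integrand s0_sym word_reflect (g_radial (enorm_reflect j x)) -signr_odd.
  by move: jw; case: (odd _); case: (j < kappa)%N => // _; rewrite /= ?expr1 ?expr0; ring.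
rewrite (trapezoid_error_odd d0n' h0 tw odd_w) add0r big1 ?mulr0// => i _.
by rewrite orbit_sum_word orbit_sum_unmatched// !mulr0.
Qed.

Lemma system_K_word (i j : 'I_m) : system_K R kappa xi i j =
  \sum_(b \in sign_orbit (xi j)) (Num.sg (kprod kappa b))%:~R *
     word (grid_word kappa (xi i)) (map_mx intr b : 'rV[R]_n).
Proof. by rewrite mxE; apply: eq_fsbigr => b _; rewrite (word_monomial _ (xi_grid i)). Qed.

Definition moments h : 'cV[R]_m := \col_i moment d s0 g (grid_word kappa (xi i)) h.

Hypothesis wbar_limit : forall i, exists C : R, 0 <= C /\
  forall h, 0 < h -> `|moments h i 0 - (system_K R kappa xi *m wbar) i 0| <= C * h ^+ r.

Lemma rule_error_grid_word i : exists C : R, 0 <= C /\ forall h, 0 < h <= 1 ->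
  `|rule_error h (fun x => word (grid_word kappa (xi i)) x * g x)| <= C * h `^ (r%:R + d).
Proof.
set w := grid_word _ _; have [C [C0 HC]] := wbar_limit i; have [D D0 HD] := g_grid_bound.
pose E := \sum_j `|system_K R kappa xi i j| * D * `|wbar j 0|.
have E0 : 0 <= E by apply: sumr_ge0 => j _; rewrite !mulr_ge0.
exists (C + E); split=> [|h /andP[h0 h1]]; first exact: addr_ge0.
have -> : rule_error h (fun x => word w x * g x) = h `^ ((size w)%:R + d) *
    (((system_K R kappa xi *m wbar) i 0 - moments h i 0) +
     \sum_j system_K R kappa xi i j * (g (lattice_pt h (xi j)) - 1) * wbar j 0).
  have -> : rule_error h (fun x => word w x * g x) =
     trapezoid_error h (moment_integrand s0 g w) + h `^ d * \sum_j wbar j 0 *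
       (h ^+ size w * g (lattice_pt h (xi j)) * system_K R kappa xi i j).
    congr (_ + _ * _); apply: eq_bigr => j _.
    by rewrite orbit_sum_word system_K_word.
  have p0 : h `^ ((size w)%:R + d) != 0 by rewrite gt_eqF// powR_gt0.
  rewrite !mxE /moment -/w mulrDr mulrBr mulrA divff// mul1r opprK.
  rewrite [RHS](_ : _ = trapezoid_error h (moment_integrand s0 g w) +
    h `^ ((size w)%:R + d) * ((\sum_j system_K R kappa xi i j * wbar j 0) +
     \sum_j system_K R kappa xi i j * (g (lattice_pt h (xi j)) - 1) * wbar j 0)); last by ring.
  congr (_ + _); rewrite -big_split/= powRD_gt0// powR_mulrn ?ltW//.
  rewrite [h ^+ _ * _]mulrC -mulrA; congr (_ * _); rewrite mulr_sumr.
  by apply: eq_bigr => j _; ring.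
rewrite normrM ger0_norm ?powR_ge0//.
apply: (@le_trans _ _ (h `^ ((size w)%:R + d) * ((C + E) * h ^+ r))).
  rewrite ler_wpM2l ?powR_ge0// mulrDl (le_trans (ler_normD _ _))// lerD//.
    by rewrite distrC HC.
  rewrite (le_trans (ler_norm_sum _ _ _))// mulr_suml ler_sum// => j _.
  by rewrite !normrM [leRHS]mulrAC ler_wpM2r// -mulrA ler_wpM2l// HD.
(* The factor h^|w| is at most 1 and is dropped. *)
rewrite mulrCA ler_wpM2l ?addr_ge0// -powR_mulrn ?(ltW h0)// -powRD_gt0// ger_powR ?h0//.
by rewrite -addrA [d + _]addrC lerDr.
Qed.

Lemma rule_error_word w : (size w < r)%N -> exists C : R, 0 <= C /\ forall h, 0 < h <= 1 ->
  `|rule_error h (fun x => word w x * g x)| <= C * h `^ (r%:R + d).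
Proof.
move=> wr; have [mw|uw] := boolP (matched kappa w); last first.
  exists 0; split=> // h /andP[h0 _].
  by rewrite rule_error_unmatched// normr0 mul0r.
have [eta [eta_grid _ wE]] := matched_grid R kappa_n mw wr kappa_2p.
have [_ _ xi_surj] := xi_enum; have [i _ xi_eta] := xi_surj _ eta_grid.
rewrite (_ : (fun x => _) = fun x => word (grid_word kappa (xi i)) x * g x).
  exact: rule_error_grid_word.
by apply/funext => x; rewrite wE xi_eta.
Qed.

(** The weights act at points of norm O(h), where phi - T g is O(|x|^r); with the prefactor h^d
    their contribution has the rate of the quadrature part. *)
Lemma rule_error_remainder phi N : (r <= N)%N -> r%:R + d < N%:R -> rapidly_decaying N phi ->
  exists C : R, 0 <= C /\ forall h, 0 < h ->
    `|rule_error h (fun x => phi x - taylor r phi x * g x)| <= C * h `^ (r%:R + d).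
Proof.
move=> rN dN phiN.
have [C C0 HC] := remainder_error n_gt0 d0n s00 s0_cont s0_bound g_decay g_flat rN dN phiN.
have [D D0 /derive_bound_norm bD] := remainder_derive_bound g_decay g_flat (Ordinal n_gt0) rN phiN.
pose Phi x := phi x - taylor r phi x * g x.
have bPhi x : `|Phi x| <= D * `|x| ^+ r.
  have [->|/eqP x0] := eqVneq x 0; last by rewrite -powR_mulrn//; exact: bD.
  rewrite /Phi (_ : r = (2 * p - kappa).+2); last by rewrite addn2.
  by rewrite taylorS_0 g0 mulr1 subrr normr0 mulr_ge0// exprn_ge0.
pose T i := \sum_(b \in sign_orbit (xi i)) (D * `|map_mx intr b : 'rV[R]_n| ^+ r).
have T0 i : 0 <= T i.
  rewrite /T (fsbig_finite _ _ (finite_sign_orbit (xi i)))/=.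
  by apply: sumr_ge0 => b _; rewrite mulr_ge0// exprn_ge0.
have bT : forall (h : R) (i : 'I_m), 0 < h -> `|orbit_sum (xi i) h Phi| <= T i * h ^+ r.
  move=> h i h0; rewrite /orbit_sum /T !(fsbig_finite _ _ (finite_sign_orbit (xi i)))/=.
  rewrite (le_trans (ler_norm_sum _ _ _))// mulr_suml; apply: ler_sum => b _.
  rewrite normrM -mulrA [_ * h ^+ r]mulrC -exprMn -norm_lattice_pt//.
  apply: le_trans (bPhi _); rewrite ler_piMl// -intr_norm.
  by rewrite normr_sg; case: (_ == _); rewrite /= ?mulr0z ?mulr1z ?ler01 ?lexx.
exists (C + \sum_i `|wbar i 0| * T i); split.
  by rewrite addr_ge0// sumr_ge0// => i _; rewrite mulr_ge0.
move=> h h0; rewrite /rule_error mulrDl (le_trans (ler_normD _ _))// lerD ?HC//.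
rewrite normrM ger0_norm ?powR_ge0// addrC powRD_gt0// powR_mulrn ?(ltW h0)// mulrCA ler_wpM2l ?powR_ge0//.
rewrite (le_trans (ler_norm_sum _ _ _))// mulr_suml ler_sum// => i _.
by rewrite normrM -mulrA ler_wpM2l// bT.
Qed.

Lemma rule_error_bound phi N : (r <= N)%N -> r%:R + d < N%:R -> rapidly_decaying N phi ->
  exists2 C : R, 0 < C & forall h, 0 < h <= 1 -> `|rule_error h phi| <= C * h `^ (r%:R + d).
Proof.
move=> rN dN phiN; have [B [B0 HB]] := rule_error_remainder rN dN phiN.
have [l [lr lE]] := taylor_words r phi.
(* Constants are chosen for all words at once, with the dummy value 0 for those of length at least
   r, so that they can be summed over the list l. *)
have /choice[C HC] w : exists C : R, 0 <= C /\ ((size w < r)%N -> forall h, 0 < h <= 1 ->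
    `|rule_error h (fun x => word w x * g x)| <= C * h `^ (r%:R + d)).
  have [wr|wr] := boolP (size w < r)%N; last by exists 0; split.
  by have [C [C0 HC]] := rule_error_word wr; exists C; split.
have C0 w : 0 <= C w by have [] := HC w.
(* The summand 1 makes the constant strictly positive. *)
exists (B + \sum_(q <- l) `|q.1| * C q.2 + 1).
  by rewrite ltr_wpDl// addr_ge0// sumr_ge0// => q _; rewrite mulr_ge0.
move=> h /[dup] h01 /andP[h0 h1].
have phi_mild : mild d phi by apply: rapidly_decaying_mild => //; exact: rapidly_decaying_le (leq0n N) phiN.
have [words_sum words_mild] := rule_error_words l h0.
pose W x := \sum_(q <- l) q.1 * (word q.2 x * g x).
have phiW : phi = fun x => (phi x - taylor r phi x * g x) + W x.
  apply/funext => x; rewrite [W x](_ : _ = taylor r phi x * g x) ?subrK//.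
  by rewrite lE mulr_suml; apply: eq_bigr => q _; rewrite mulrA.
have rem_mild : mild d (fun x => phi x - taylor r phi x * g x).
  rewrite (_ : (fun x => _) = fun x => phi x + -1 * W x); first by apply: mildD => //; exact: mildZ.
  by apply/funext => x; rewrite [in RHS]phiW mulN1r addrK.
rewrite phiW rule_errorD// words_sum.
rewrite (le_trans (ler_normD _ _))// -addrA mulrDl lerD ?HB// mulrDl.
rewrite (le_trans (ler_norm_sum _ _ _))// ler_wpDr ?mul1r ?powR_ge0// mulr_suml.
rewrite big_seq [leRHS]big_seq; apply: ler_sum => q ql.
by rewrite normrM -mulrA ler_wpM2l//; case: (HC q.2) => _; apply=> //; exact: lr.
Qed.

End modified_rule.

(** * The linear system as a perturbation of K *)

Section perturbed_system.
Variables (R : realType) (m r : nat) (K : 'M[R]_m) (c : R -> 'cV[R]_m) (cbar : 'cV[R]_m)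
  (q : R -> 'rV[R]_m) (C D : R).
Hypotheses (K_unit : K \in unitmx) (r_gt0 : (0 < r)%N) (C0 : 0 <= C) (D0 : 0 <= D)
  (c_rate : forall h i, 0 < h -> `|c h i 0 - cbar i 0| <= C * h ^+ r)
  (q_rate : forall h i, 0 < h -> `|q h 0 i - 1| <= D * h ^+ r).
Implicit Types h : R.

Lemma near_half : \forall h \near 0^'+, forall i, 2^-1 <= q h 0 i.
Proof.
(* For h below this threshold and below 1, D h^r <= 1/2; D + 1 instead of D keeps the denominator
   positive. *)
have e0 : 0 < (2 * (D + 1))^-1 by rewrite invr_gt0 mulr_gt0// ltr_wpDl.
near=> h => i.
have h0 : 0 < h by near: h; exact: nbhs_right_gt.
have h1 : h <= 1 by near: h; apply: nbhs_right_le.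
have he : h <= (2 * (D + 1))^-1 by near: h; exact: nbhs_right_le.
have hr : h ^+ r <= h by rewrite -[leRHS]expr1 ler_wiXn2l// ltW.
have : `|q h 0 i - 1| <= 2^-1.
  rewrite (le_trans (q_rate i h0))//.
  rewrite (@le_trans _ _ ((D + 1) * (2 * (D + 1))^-1))//.
    by apply: ler_pM => //; [rewrite exprn_ge0// ltW|rewrite lerDl|exact: le_trans he].
  by rewrite invfM mulrCA divff ?mulr1// gt_eqF// ltr_wpDl.
by rewrite ler_norml => /andP[H _]; lra.
Unshelve. all: by end_near. Qed.

Lemma perturbed_unit : \forall h \near 0^'+, K *m diag_mx (q h) \in unitmx.
Proof.
apply: filterS near_half => h hq; rewrite unitmx_mul K_unit/= unitmxE det_diag unitfE.
by apply/prodf_neq0 => i _; rewrite gt_eqF// (lt_le_trans _ (hq i))// invr_gt0.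
Qed.

(** Applying K^-1 leaves the diagonal system q_i omega_i = (K^-1 c)_i. Subtracting q_i wbar_i on
    both sides separates the error of c from that of q. *)
Lemma perturbed_rate (omega : R -> 'cV[R]_m) :
  (\forall h \near 0^'+, K *m diag_mx (q h) *m omega h = c h) ->
  exists2 A, 0 <= A & \forall h \near 0^'+, 0 < h /\
    forall i, `|omega h i 0 - (invmx K *m cbar) i 0| <= A * h ^+ r.
Proof.
set wbar := invmx K *m cbar => Hw.
pose V i := \sum_j `|invmx K i j| * C.
have V0 i : 0 <= V i by apply: sumr_ge0 => j _; rewrite mulr_ge0.
(* The factor 2 is the bound on 1 / q_i. *)
pose A i := 2 * (V i + D * `|wbar i 0|).
have A0 i : 0 <= A i by rewrite mulr_ge0// addr_ge0// mulr_ge0.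
exists (\sum_i A i); first exact: sumr_ge0.
near=> h.
have h0 : 0 < h by near: h; exact: nbhs_right_gt.
have hq : forall i, 2^-1 <= q h 0 i by near: h; exact: near_half.
have Hh : K *m diag_mx (q h) *m omega h = c h by near: h.
split=> // i; have hr0 : 0 <= h ^+ r by rewrite exprn_ge0// ltW.
apply: (@le_trans _ _ (A i * h ^+ r)); last first.
  by rewrite ler_wpM2r// (bigD1 i)//= lerDl; exact: sumr_ge0.
have qi := hq i.
have vE : q h 0 i * omega h i 0 = (invmx K *m c h) i 0.
  rewrite -Hh -mulmxA mulKmx// mxE (bigD1 i)//= big1 ?addr0 ?mxE ?eqxx ?mulr1n//.
  by move=> k ki; rewrite mxE eq_sym (negbTE ki) mulr0n mul0r.
have vb : `|(invmx K *m c h) i 0 - wbar i 0| <= V i * h ^+ r.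
  rewrite /wbar !mxE -sumrB (le_trans (ler_norm_sum _ _ _))// mulr_suml ler_sum// => j _.
  by rewrite -mulrBr normrM -mulrA ler_wpM2l// c_rate.
have q0 : 0 < q h 0 i by apply: lt_le_trans qi; rewrite invr_gt0.
rewrite -(ler_pM2l q0) -[leLHS](_ : `|q h 0 i * (omega h i 0 - wbar i 0)| = _); last first.
  by rewrite normrM (gtr0_norm q0).
rewrite mulrBr vE.
have -> : (invmx K *m c h) i 0 - q h 0 i * wbar i 0 =
  ((invmx K *m c h) i 0 - wbar i 0) - (q h 0 i - 1) * wbar i 0 by ring.
rewrite (le_trans (ler_normB _ _))// normrM.
have qb : `|q h 0 i - 1| * `|wbar i 0| <= D * h ^+ r * `|wbar i 0| by rewrite ler_wpM2r// q_rate.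
apply: (@le_trans _ _ (2^-1 * (A i * h ^+ r))); last by rewrite ler_wpM2r// mulr_ge0.
rewrite /A; have -> : 2^-1 * (2 * (V i + D * `|wbar i 0|) * h ^+ r) =
  V i * h ^+ r + D * h ^+ r * `|wbar i 0| by field.
exact: lerD.
Unshelve. all: by end_near. Qed.

End perturbed_system.

Section rate.
Variables (R : realType) (m r : nat) (omega : R -> 'cV[R]_m) (wbar : 'cV[R]_m) (A : R).
Hypotheses (r_gt0 : (0 < r)%N) (A0 : 0 <= A)
  (omega_rate : \forall h \near 0^'+, 0 < h /\
    forall i, `|omega h i 0 - wbar i 0| <= A * h ^+ r).

Let entry_sum (h : R) : (forall i, `|omega h i 0 - wbar i 0| <= A * h ^+ r) ->
  \sum_i \sum_j `|(omega h - wbar) i j| <= m%:R * A * h ^+ r.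
Proof.
move=> H; rewrite -mulrA.
rewrite (le_trans (ler_sum _ (G := fun=> A * h ^+ r) _))//.
  by move=> i _; rewrite big_ord1 !mxE.
by rewrite sumr_const card_ord mulr_natl.
Qed.

Lemma rate_cvg : omega h @[h --> 0^'+] --> wbar.
Proof.
apply/cvgrPdist_le => e e0.
have B0 : 0 < (m%:R * A + 1)^-1 * e by rewrite mulr_gt0// invr_gt0 ltr_wpDl// mulr_ge0.
near=> h.
have [h0 H] : 0 < h /\ forall i, `|omega h i 0 - wbar i 0| <= A * h ^+ r by near: h.
have h1 : h <= 1 by near: h; apply: nbhs_right_le.
have he : h <= (m%:R * A + 1)^-1 * e by near: h; exact: nbhs_right_le.
have hr : h ^+ r <= h by rewrite -[leRHS]expr1 ler_wiXn2l// ltW.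
rewrite distrC (le_trans (mx_norm_le_sum _))// (le_trans (entry_sum H))//.
rewrite (@le_trans _ _ ((m%:R * A + 1) * ((m%:R * A + 1)^-1 * e)))//.
  apply: ler_pM; [exact: mulr_ge0|exact/exprn_ge0/ltW|by rewrite lerDl|exact: le_trans he].
by rewrite mulrA divff ?mul1r// gt_eqF// ltr_wpDl// mulr_ge0.
Unshelve. all: by end_near. Qed.

Lemma rate_bigO : (fun h => enorm (omega h - wbar)) =O_ (0^'+) (fun h => h ^+ r).
Proof.
apply/eqOP; near=> k; near=> h.
have [h0 H] : 0 < h /\ forall i, `|omega h i 0 - wbar i 0| <= A * h ^+ r by near: h.
rewrite !ger0_norm ?enorm_ge0 ?exprn_ge0 ?(ltW h0)//.
rewrite (le_trans (enorm_le_sum _))// (le_trans (entry_sum H))//.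
rewrite ler_wpM2r ?exprn_ge0 ?(ltW h0)//.
Unshelve. all: by end_near. Qed.

End rate.

(** * Assembly of the theorem *)

Section system_entries.
Variables (R : realType) (n : nat) (d : R) (s g : 'rV[R]_n -> R) (kappa p m : nat)
  (xi : 'I_m -> 'rV[int]_n).
Hypotheses (n_gt0 : (0 < n)%N) (s_cont : forall x, x != 0 -> {for x, continuous (zero_at0 s)})
  (g_cont : forall x, {for x, continuous g})
  (kappa_n : (kappa <= n)%N) (xi_enum : set_bij setT (nonneg_grid kappa p) xi).
Implicit Types h : R.

(** The exponent 2|xi|_1 - kappa is the length of the grid word, that is, the degree of its
    monomial; otherwise the integrand is altered only at the origin. *)
Lemma system_c_moments h : 0 < h ->
  system_c kappa xi d s g h = moments d (zero_at0 s) kappa g xi h.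
Proof.
move=> h0; apply/colP => i; rewrite !mxE.
have xi_grid : nonneg_grid kappa p (xi i) by case: xi_enum => xi_fun _ _; exact: xi_fun.
set w := grid_word kappa (xi i); set F := fun x => g x * s x * _.
have FG x : x != 0 -> F x = moment_integrand (zero_at0 s) g w x.
  move=> x0; rewrite /F /moment_integrand zero_at0_neq0// (word_monomial _ xi_grid) mulrC.
  by rewrite mulrA.
have G0 : moment_integrand (zero_at0 s) g w 0 = 0.
  by rewrite /moment_integrand zero_at0_0 mulr0.
have cG x : x != 0 -> {for x, continuous (moment_integrand (zero_at0 s) g w)}.
  move=> x0; apply: continuousM; last exact: s_cont.
  by apply: continuousM; [exact: word_continuous|exact: g_cont].
rewrite (punctured_trapezoidalE h0 G0 FG) (Rintegral_punctureE n_gt0 cG G0 FG).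
by rewrite /moment -/w /trapezoid_error opprB -(size_grid_word kappa_n xi_grid) natrD addrK.
Qed.

Lemma modified_trapezoidalE (w : 'cV[R]_m) h phi : 0 < h ->
  modified_trapezoidal kappa xi d s w h phi -
    \int[lebesgue_Rn R n]_(x in ~` [set 0]) (phi x * s x) =
  rule_error d (zero_at0 s) kappa xi w h phi.
Proof.
move=> h0; have G0 : phi 0 * zero_at0 s 0 = 0 by rewrite zero_at0_0 mulr0.
have FG x : x != 0 -> phi x * s x = phi x * zero_at0 s x.
  by move=> x0; rewrite zero_at0_neq0.
rewrite /modified_trapezoidal (punctured_trapezoidalE (G := fun x => phi x * zero_at0 s x) h0 G0 FG).
by rewrite (Rintegral_off0E (G := fun x => phi x * zero_at0 s x) G0 FG) addrAC.
Qed.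

End system_entries.

Theorem theorem3p1 (R : realType) (n : nat) (n_gt0 : (0 < n)%N)
    (s : 'rV[R]_n -> R) (delta : R) (kappa p : nat)
    (s_singular : weakly_singular s)
    (delta_bounds : 0 < delta < n%:R) (s_dilation : dilation delta s)
    (kappa_le_n : (kappa <= n)%N) (s_symmetric : symmetric_kernel kappa s)
    (kappa_le_2p : (kappa <= 2 * p)%N)
    (phi : 'rV[R]_n -> R)
    (phi_regular :
      (exists N : nat,
         Num.max ((2 * p - kappa + 2)%:R + delta) n%:R < N%:R /\ CkC N phi) \/
      schwartz phi)
    (g : 'rV[R]_n -> R)
    (g_schwartz : schwartz g) (g_radial : radial g) (g0 : g 0 = 1)
    (g_flat : forall k : 'rV[nat]_n,
      (1 <= mdegree k <= 2 * p - kappa + 1)%N -> mderive k g 0 = 0)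
    (m : nat) (xi : 'I_m -> 'rV[int]_n)
    (xi_enum : set_bij setT (nonneg_grid kappa p) xi) :
  (\forall h \near 0^'+, exists! w : 'cV[R]_m,
     system_K R kappa xi *m system_G xi g h *m w =
     system_c kappa xi delta s g h) /\
  forall omega : R -> 'cV[R]_m,
    (\forall h \near 0^'+,
       system_K R kappa xi *m system_G xi g h *m omega h =
       system_c kappa xi delta s g h) ->
    exists omegabar : 'cV[R]_m,
      [/\ omega h @[h --> 0^'+] --> omegabar,
          (fun h => enorm (omega h - omegabar)) =O_ (0^'+)
            (fun h => h ^+ (2 * p - kappa + 2)) &
          exists2 C : R, 0 < C & forall h : R, 0 < h <= 1 ->
            `|modified_trapezoidal kappa xi delta s omegabar h phi -
              \int[lebesgue_Rn R n]_(x in ~` [set 0]) (phi x * s x)| <=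
            C * h `^ ((2 * p - kappa + 2)%:R + delta)].
Proof.
have [s_smooth _] := s_singular; set r := (2 * p - kappa + 2)%N.
have r_gt0 : (0 < r)%N by rewrite /r addn2.
have s0_cont (x : 'rV[R]_n) (x0 : x != 0) : {for x, continuous (zero_at0 s)}.
  by apply: continuous_zero_at0 => //; apply: (Ck_on_continuous (s_smooth 0%N)); exact/eqP.
have s0_bound j N := zero_at0_derive_bound j N s_smooth s_dilation.
have s0_hom (t : R) (x : 'rV[R]_n) (t0 : 0 < t) := zero_at0_homogeneous x s_dilation t0.
have s0_sym j x := zero_at0_symmetric j x s_symmetric.
have g_decay N := schwartz_rapidly_decaying N n_gt0 g_schwartz.
have g_taylor : taylor r g = fun=> 1.
  have [g_smooth _] := g_schwartz.
  by rewrite /r addnS (taylor_flat g_smooth g_flat) g0.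
(* From here on both classes of phi are treated alike: rapidly decaying with N derivatives for some
   N > r + delta. *)
have [N [rN dN phiN]] : exists N, [/\ (r <= N)%N, r%:R + delta < N%:R & rapidly_decaying N phi].
  have d0 : 0 <= delta by case/andP: delta_bounds => /ltW.
  case: phi_regular => [[N [+ phiN]]|Sphi].
    rewrite gt_max => /andP[dN _]; exists N; split=> //; last exact: CkC_rapidly_decaying.
    by rewrite -(ler_nat R) ltW// (le_lt_trans _ dN)// lerDl.
  have [N dN] := archimedean_nat (r%:R + delta); exists N; split=> //.
    by rewrite -(ler_nat R) ltW// (le_lt_trans _ dN)// lerDl.
  exact: schwartz_rapidly_decaying.
pose mom := moments delta (zero_at0 s) kappa g xi.
have /choice[cb /choice[C HC]] (i : 'I_m) :=
  moment_limit n_gt0 delta_bounds (zero_at0_0 s) s0_cont s0_bound s0_hom g_decay g_taylor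
    (grid_word kappa (xi i)).
pose cbar := \col_i cb i.
have C0 i : 0 <= C i by have [] := HC i.
have mom_rate h i : 0 < h -> `|mom h i 0 - cbar i 0| <= (\sum_j C j) * h ^+ r.
  move=> h0; rewrite !mxE; have [_ /(_ h h0) Hi] := HC i; apply: (le_trans Hi).
  rewrite ler_wpM2r ?exprn_ge0 ?(ltW h0)// (bigD1 i)//= lerDl; exact: sumr_ge0.
have [D D0 g_rate] := g_grid_bound n_gt0 g_decay g_taylor g0 xi.
have K_unit := system_K_unit R xi_enum.
pose q h := \row_i g (lattice_pt h (xi i)).
have q_rate h i : 0 < h -> `|q h 0 i - 1| <= D * h ^+ r by rewrite mxE; exact: g_rate.
have cE h : 0 < h -> system_c kappa xi delta s g h = mom h.
  apply: (system_c_moments _ n_gt0 s0_cont _ kappa_le_n xi_enum).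
  by move=> x; have [cg _] := g_decay 0%N; exact: (Ck_on_continuous cg).
split.
  apply: filterS (perturbed_unit K_unit r_gt0 D0 q_rate) => h KG.
  exists (invmx (system_K R kappa xi *m system_G xi g h) *m system_c kappa xi delta s g h).
  by split=> [|w <-]; [exact: mulKVmx|exact: mulKmx].
(* As G(h) tends to the identity, the limit has to solve K wbar = lim c. *)
move=> omega Homega; pose wbar := invmx (system_K R kappa xi) *m cbar.
have [A A0 omega_rate] : exists2 A, 0 <= A & \forall h \near 0^'+, 0 < h /\
    forall i, `|omega h i 0 - wbar i 0| <= A * h ^+ r.
  apply: (perturbed_rate K_unit r_gt0 _ D0 mom_rate q_rate); first exact: sumr_ge0.
  near=> h; rewrite -cE; last by near: h; exact: nbhs_right_gt.
  by near: h.
exists wbar; split; [exact: rate_cvg omega_rate|exact: rate_bigO omega_rate|].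
have wbar_limit i : exists C : R, 0 <= C /\
    forall h, 0 < h -> `|mom h i 0 - (system_K R kappa xi *m wbar) i 0| <= C * h ^+ r.
  exists (\sum_j C j); split; first exact: sumr_ge0.
  by move=> h h0; rewrite mulKVmx// mom_rate.
have [E E0 HE] := rule_error_bound n_gt0 delta_bounds (zero_at0_0 s) s0_cont s0_bound
  kappa_le_n kappa_le_2p s0_sym g_decay g_taylor g_radial g0 xi_enum wbar_limit rN dN phiN.
exists E => // h /[dup] h01 /andP[h0 _].
by rewrite modified_trapezoidalE// HE.
Unshelve. all: by end_near. Qed.
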